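(* Let $k$ and $d$ be positive integers with $d \leq 2(k+1)$, and let $G$ be a graph. If $\gamma(G) \leq k + \frac{d}{d+k+1}$, then the edge set of $G$ can be partitioned into $k+1$ forests such that in one of these forests every connected component has at most $d$ edges.
   Context: Graphs are finite, undirected, have no loops, and may contain parallel edges. For a graph $H$, write $v(H)=|V(H)|$ and $e(H)=|E(H)|$. The fractional arboricity of $G$ is $$\gamma(G) = \max_{H \subseteq G,\ v(H)\geq 2} \frac{e(H)}{v(H)-1},$$ the maximum being over all subgraphs $H$ of $G$ with at least two vertices (if $G$ has fewer than two vertices, the bound on $\gamma(G)$ is regarded as vacuously satisfied). A partition (decomposition) of $G$ into $k+1$ forests means a partition of $E(G)$ into $k+1$ pairwise disjoint, possibly empty sets, each of which is the edge set of an acyclic graph on the vertex set $V(G)$ (two parallel edges form a cycle). *)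

(* Defs.v *)
From mathcomp Require Import all_boot all_order all_algebra.

Set Implicit Arguments.
Unset Strict Implicit.
Unset Printing Implicit Defensive.

Import Order.TTheory GRing.Theory Num.Theory.
Local Open Scope ring_scope.

(* Since the ends of an edge form a set of size exactly 2, edges are undirected
   and there are no loops; two edges may have the same ends. *)
Record multigraph := Multigraph {
  vertex : finType;
  edge : finType;
  ends : edge -> {set vertex};
  card_ends : forall e, #|ends e| = 2%N
}.

Section Multigraph.
Variable G : multigraph.
Implicit Types (F : {set edge G}) (x y : vertex G).

Definition is_subgraph (H : {set vertex G} * {set edge G}) : bool :=
  [forall e in H.2, ends e \subset H.1].

(* Every ratio is nonnegative, so the default value 0 of the iterated maximum
   matters only when G has fewer than two vertices; gamma is then 0, and any
   nonnegative upper bound on it holds vacuously. *)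
Definition gamma : rat :=
  \big[Num.max/0]_(H : {set vertex G} * {set edge G}
                   | is_subgraph H && (2 <= #|H.1|)%N)
    (#|H.2|%:R / (#|H.1|%:R - 1)).

(* A cycle v_0, e_0, v_1, ..., v_(n-1), e_(n-1), v_0, with ordS the cyclic
   successor; n = 2 is a pair of parallel edges. *)
Definition is_cycle n (v : 'I_n -> vertex G) (e : 'I_n -> edge G) : Prop :=
  [/\ (2 <= n)%N, injective v, injective e
    & forall i, ends (e i) = [set v i; v (ordS i)]].

Definition forest F : Prop :=
  forall n (v : 'I_n -> vertex G) (e : 'I_n -> edge G),
    is_cycle v e -> ~ (forall i, e i \in F).

Definition adj F : rel (vertex G) :=
  fun x y => [exists e in F, ends e == [set x; y]].

(* The connected component of x in the spanning subgraph (V(G), F). *)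
Definition component F x : {set vertex G} := [set y | connect (adj F) x y].

Definition component_edges F x : {set edge G} :=
  [set e in F | ends e \subset component F x].

Definition edge_partition m (P : 'I_m -> {set edge G}) : Prop :=
  (forall i j, i != j -> [disjoint P i & P j])
  /\ \bigcup_i P i = [set: edge G].

End Multigraph.

(* Main.v *)
Require Import Defs.
From mathcomp Require Import all_boot all_order all_algebra zify.

Set Implicit Arguments.
Unset Strict Implicit.
Unset Printing Implicit Defensive.

Import Order.TTheory GRing.Theory Num.Theory.

(**
Call a set of edges m-sparse if every nonempty vertex set X spans at most m (|X| -
1) of its edges, and m-tight the sets X for which equality holds. By Nash-Williams'
theorem ([nash_williams]) a k-sparse set is a union of k forests, so the aim is to
write the edge set as B + F where B is k-sparse and F is a good forest: one whose
components have at most d + 1 vertices. The bound on gamma says that every X spans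
at most (k + d / (d + k + 1)) (|X| - 1) edges.

Edges are added one at a time ([outer_step]). Let A = B + F be decomposed with B as
large as possible and let h be the next edge. If h does not fit in B, its ends lie
in a k-tight set W of B which no edge of F leaves, so one may restrict to W and
assume that B spans all vertices tightly. Then B is a union of k spanning trees,
which are rooted at an end r of h; every vertex other than r has one arc of each
colour, leading to its father in the tree of this colour.

Explore the components of F one after the other; the next one must contain an end of
h or the head of an arc from a vertex already explored. Among all decompositions A =
B + F with their rooted trees and all explorations, take one whose list of component
sizes is lexicographically least, a longer list being better than its prefixes. The
set H of explored vertices is then closed under all arcs, so it spans k (|H| - 1)
edges of B, as well as |H| - t edges of F if there are t components, and h. The
density bound gives
  (k + 1) (|H| - t) + 2 d + k + 1 <= d t,
which says that the components are too small on average. It is contradicted by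
  d t <= (k + 1) (|H| - t) + 2 d                                  ([discharging]).
Here a component of b vertices contributes (k + 1) (b - 1) on the right, at least d
unless b is 1 or 2, as d <= 2 (k + 1). So small components, except those of the two
ends of h, must be paid for by the component of a vertex from which they are
reached.

Suppose that an arc leads from a vertex a to such a small component. This arc may be
moved to F if some edges of F are moved to B in exchange ([exchange]). Let X0 be the
set of vertices from which a cannot be reached along arcs. Some edge f0, either h or
an edge of F in an explored component, crosses X0; it can be added to B once the arc
of a is gone, since a tight set would be closed under the remaining arcs
([redir_cut]). The trees can be rebuilt without changing an arc at a vertex of X0
([extend_arcs]). Thus the exchange either accommodates h, or makes an early
component smaller and leaves the earlier ones alone; both are impossible. Hence it
must fail by creating a component with more than d + 1 vertices. When arcs of two or
three vertices of one component Q and one colour are moved at the same time, further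
edges of Q are moved to B so as to separate these vertices ([cut2], [cut3]); this is
possible since in B + f0 a set containing j of the vertices lacks j - 1 edges
([redir_deficit]). Consequently, in each colour, only components with d or d + 1
vertices have arcs to components that need a payment, and only very few.

One case needs more. If x is a leaf of a component with d + 1 vertices and has an
arc to an isolated vertex y, the cost of y exceeds what the colour of this arc can
pay together with another charge. Either replacing the arc by the pendant edge x z
at x already improves the exploration, or z is a descendant of x ([leaf_relay]); in
the latter case let a be the child of x above z. Then the arcs of a and x can be
moved together in exchange for x z, which turns {x, y} into a small component
reached from a (a relay). The component of a pays a part of the cost of y. Counting
the charges then gives the inequality above.
*)

(** * Sparse edge sets and tight sets *)

Section Sparse.
Variables (V E : finType) (s t : E -> V).
Implicit Types (A B F : {set E}) (X Y Z : {set V}) (e f : E) (m : nat).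

Definition ein e X := (s e \in X) && (t e \in X).
Definition inn A X := [set e in A | ein e X].
Definition cross e X := (s e \in X) != (t e \in X).
(** The 1-sparse sets are the forests. *)
Definition sparse m A :=
  [forall X : {set V}, (X != set0) ==> (#|inn A X| + m <= m * #|X|)].
Definition tight m A X := (X != set0) && (#|inn A X| + m == m * #|X|).
(** For m = 1 and a forest A this is the component of x. *)
Definition block m A x := \bigcup_(X | tight m A X && (x \in X)) X.

Lemma in_inn A X e : (e \in inn A X) = (e \in A) && ein e X.
Proof. by rewrite inE. Qed.

Lemma tight_def m A X :
  tight m A X = (X != set0) && (#|inn A X| + m == m * #|X|).
Proof. by []. Qed.

Lemma sparseP m A :
  reflect (forall X, X != set0 -> #|inn A X| + m <= m * #|X|) (sparse m A).
Proof.
apply: (iffP forallP) => H X; first by move: (H X) => /implyP.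
by apply/implyP; apply: H.
Qed.

Lemma inn_sub A B X : A \subset B -> inn A X \subset inn B X.
Proof.
by move=> AB; apply/subsetP => e; rewrite !in_inn => /andP[/(subsetP AB)-> ->].
Qed.

Lemma sparse_sub m A B : A \subset B -> sparse m B -> sparse m A.
Proof.
move=> AB /sparseP H; apply/sparseP => X X0; have := H X X0.
by have := subset_leq_card (inn_sub X AB); lia.
Qed.

Lemma sparseD m A K : sparse m A -> sparse m (A :\: K).
Proof. exact: sparse_sub (subsetDl A K). Qed.

Lemma sparseD1 m A e : sparse m A -> sparse m (A :\ e).
Proof. exact: sparseD. Qed.

Lemma tightP m A X : sparse m A -> X != set0 -> m * #|X| <= #|inn A X| + m ->
  tight m A X.
Proof. by move=> /sparseP/(_ X) H X0 ?; rewrite /tight X0; have := H X0; lia. Qed.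

Lemma tight_neq0 m A X : tight m A X -> X != set0.
Proof. by case/andP. Qed.

Lemma tightE m A X : tight m A X -> #|inn A X| + m = m * #|X|.
Proof. by case/andP => _ /eqP. Qed.

Lemma inn_submod A X Y :
  #|inn A X| + #|inn A Y| <= #|inn A (X :|: Y)| + #|inn A (X :&: Y)|.
Proof.
rewrite -cardsUI leq_add ?subset_leq_card //; apply/subsetP => e.
  rewrite in_setU !in_inn /ein !in_setU.
  by case/orP => /and3P[-> -> ->]; rewrite ?orbT.
by rewrite in_setI !in_inn /ein !in_setI => /andP[/and3P[-> -> ->] /and3P[_ -> ->]].
Qed.

Lemma inn_split A X Y : (forall e, e \in A -> ein e X -> ~~ cross e Y) ->
  #|inn A X| <= #|inn A (X :&: Y)| + #|inn A (X :\: Y)|.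
Proof.
move=> H; rewrite -cardsUI -[X in X <= _]addn0 leq_add ?subset_leq_card //.
apply/subsetP => e; rewrite in_setU !in_inn => /andP[eA eX].
move: (H e eA eX); rewrite /cross negbK => /eqP.
move: eX; rewrite /ein eA !in_setI !in_setD => /andP[-> ->] <-.
by case: (_ \in Y).
Qed.

Lemma card_UI X Y : #|X :|: Y| + #|X :&: Y| = #|X| + #|Y|.
Proof. exact: cardsUI. Qed.

(** The number of spanned edges is supermodular, so two tight sets that meet leave
    no slack in their union and their intersection. *)
Lemma tightUI m A X Y : sparse m A -> tight m A X -> tight m A Y ->
  X :&: Y != set0 -> tight m A (X :|: Y) && tight m A (X :&: Y).
Proof.
move=> /sparseP spA tX tY I0.
have U0 : X :|: Y != set0.
  by apply: contraNneq (tight_neq0 tX) => U; rewrite -subset0 -U subsetUl.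
have := inn_submod A X Y; have := spA _ I0; have := spA _ U0.
have := card_UI X Y; have := tightE tX; have := tightE tY => *.
have Hm : m * #|X :|: Y| + m * #|X :&: Y| = m * #|X| + m * #|Y|.
  by rewrite -!mulnDr; congr muln.
by rewrite /tight U0 I0 /=; lia.
Qed.

Lemma tightU m A X Y x : sparse m A -> tight m A X -> tight m A Y ->
  x \in X -> x \in Y -> tight m A (X :|: Y).
Proof.
move=> spA tX tY xX xY; have I0 : X :&: Y != set0.
  by apply/set0Pn; exists x; rewrite inE xX.
by case/andP: (tightUI spA tX tY I0).
Qed.

Lemma tightI m A X Y x : sparse m A -> tight m A X -> tight m A Y ->
  x \in X -> x \in Y -> tight m A (X :&: Y).
Proof.
move=> spA tX tY xX xY; have I0 : X :&: Y != set0.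
  by apply/set0Pn; exists x; rewrite inE xX.
by case/andP: (tightUI spA tX tY I0).
Qed.

Lemma tight1 m A x : sparse m A -> tight m A [set x].
Proof.
move=> spA; have x0 : [set x] != set0 by apply/set0Pn; exists x; rewrite inE.
by apply: tightP => //; rewrite cards1 muln1 leq_addl.
Qed.

(** Otherwise the edges inside X would be shared by two nonempty parts, each of
    which misses m edges, while X itself misses only m. *)
Lemma tight_cross m A X Y : 0 < m -> sparse m A -> tight m A X ->
  X :&: Y != set0 -> X :\: Y != set0 ->
  exists e, [/\ e \in A, ein e X & cross e Y].
Proof.
move=> m0 /sparseP spA tX I0 D0.
have [/existsP[e /and3P[? ? ?]]|/existsPn H] :=
  boolP [exists e, [&& e \in A, ein e X & cross e Y]]; first by exists e.
have /inn_split : forall e, e \in A -> ein e X -> ~~ cross e Y.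
  by move=> e eA eX; move: (H e); rewrite eA eX.
have := spA _ I0; have := spA _ D0; have := tightE tX.
have Hm : m * #|X| = m * #|X :&: Y| + m * #|X :\: Y|.
  by rewrite -mulnDr cardsID.
lia.
Qed.

Lemma block_self m A x : sparse m A -> x \in block m A x.
Proof.
move=> spA; apply/bigcupP; exists [set x]; last by rewrite inE.
by rewrite tight1 // inE eqxx.
Qed.

Lemma block_sub m A X x : tight m A X -> x \in X -> X \subset block m A x.
Proof. by move=> tX xX; apply: (bigcup_sup X); rewrite tX. Qed.

Lemma block_tight m A x : sparse m A -> tight m A (block m A x).
Proof.
move=> spA; have : (block m A x == set0)
    || (x \in block m A x) && tight m A (block m A x).
  rewrite /block; elim/big_rec: _ => [|X U /andP[tX xX]]; first by rewrite eqxx.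
  case/orP => [/eqP->|/andP[xU tU]]; first by rewrite setU0 xX tX orbT.
  by rewrite inE xX (tightU spA tX tU xX xU) orbT.
case/orP => [/eqP b0|/andP[]//].
by have := block_self x spA; rewrite b0 inE.
Qed.

Lemma block_eq m A x y : sparse m A -> y \in block m A x ->
  block m A y = block m A x.
Proof.
move=> spA yx; have tx := block_tight x spA; have ty := block_tight y spA.
have yy := block_self y spA.
have sxy := block_sub tx yx.
by apply/eqP; rewrite eqEsubset sxy andbT block_sub // (subsetP sxy) ?block_self.
Qed.

Lemma block_disj m A x y : sparse m A -> y \notin block m A x ->
  [disjoint block m A x & block m A y].
Proof.
move=> spA yx; rewrite -setI_eq0; apply: contraNT yx => /set0Pn[z].
rewrite inE => /andP[zx zy]; rewrite -(block_eq spA zx) (block_eq spA zy).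
exact: block_self.
Qed.

Lemma inn_U1 A e X : #|inn (e |: A) X| <= #|inn A X| + ein e X.
Proof.
have [eX|eX] := boolP (ein e X).
  apply: leq_trans (_ : #|e |: inn A X| <= _).
    apply/subset_leq_card/subsetP => f; rewrite !inE => /andP[/orP[->//|->] ->].
    by rewrite orbT.
  by rewrite cardsU1; case: (_ \notin _) => /=; lia.
rewrite addn0; apply/subset_leq_card/subsetP => f; rewrite !inE.
by case/andP => /orP[/eqP-> fX|-> ->//]; rewrite fX in eX.
Qed.

Lemma sparse_add m A e : sparse m A -> (forall X, tight m A X -> ~~ ein e X) ->
  sparse m (e |: A).
Proof.
move=> spA H; apply/sparseP => X X0; have := inn_U1 A e X.
have /sparseP/(_ X X0) le := spA.
have [tX|ntX] := boolP (tight m A X); first by rewrite (negbTE (H X tX)); lia.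
by move: ntX; rewrite /tight X0 /=; case: (ein e X); lia.
Qed.

Lemma sparse_addN m A e : sparse m A -> ~~ sparse m (e |: A) ->
  exists2 X, tight m A X & ein e X.
Proof.
move=> spA; have [/existsP[X /andP[? ?]] _|/existsPn H] :=
  boolP [exists X, tight m A X && ein e X]; first by exists X.
case/negP; apply: sparse_add => // X tX.
by move: (H X); rewrite tX.
Qed.

(** A tight set that contains one end of e and meets the block lies in the block, so
    no tight set contains both ends. *)
Lemma sparse_cross m A e x : sparse m A -> cross e (block m A x) ->
  sparse m (e |: A).
Proof.
move=> spA cr; apply: sparse_add => // X tX; apply/negP => /andP[sX tX'].
have tb := block_tight x spA.
move: cr; rewrite /cross; case sb: (s e \in _); case tb': (t e \in _) => // _.
  have := block_sub (tightU spA tX tb sX sb) (x := x).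
  by rewrite inE block_self // orbT => /(_ isT)/subsetP/(_ (t e)); rewrite inE tX' tb' => /(_ isT).
have := block_sub (tightU spA tX tb tX' tb') (x := x).
by rewrite inE block_self // orbT => /(_ isT)/subsetP/(_ (s e)); rewrite inE sX sb => /(_ isT).
Qed.

Lemma sparse_tight_notin m A e X : e \notin A -> sparse m (e |: A) ->
  tight m A X -> ~~ ein e X.
Proof.
move=> eA /sparseP sp tX; apply/negP => eX; have := sp X (tight_neq0 tX).
have -> : inn (e |: A) X = e |: inn A X.
  by apply/setP => f; rewrite !inE; case: eqP => [->|//]; rewrite eX.
by rewrite cardsU1 in_inn (negbTE eA) /= -(tightE tX); lia.
Qed.

Lemma tight_setD1 m A e X : e \in A -> sparse m A -> tight m (A :\ e) X -> ~~ ein e X.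
Proof. by move=> eA spA; apply: sparse_tight_notin; rewrite ?setD11 ?setD1K. Qed.

Lemma tight_transfer m A B X : sparse m B -> tight m A X ->
  (forall e, e \in A -> ein e X -> e \in B) -> tight m B X.
Proof.
move=> spB tX AB; apply: tightP => //; first exact: tight_neq0 tX.
rewrite -(tightE tX) leq_add2r subset_leq_card //.
by apply/subsetP => e; rewrite !in_inn => /andP[eA eX]; rewrite (AB e).
Qed.

Lemma tight_sub m A B X : A \subset B -> sparse m B -> tight m A X ->
  tight m B X.
Proof. by move=> /subsetP AB spB tX; apply: (tight_transfer spB tX) => e /AB. Qed.

Lemma block_mono m A B x : A \subset B -> sparse m B -> block m A x \subset block m B x.
Proof.
move=> AB spB; have spA := sparse_sub AB spB.
by apply: block_sub; [apply: tight_sub AB spB (block_tight x spA)|apply: block_self].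
Qed.

(** For m = 1, P is the vertex set of the path from a to b. *)
Lemma tight_hull m A X a b : sparse m A -> tight m A X -> a \in X -> b \in X ->
  exists P, [/\ tight m A P, a \in P, b \in P, P \subset X &
    forall Z, tight m A Z -> a \in Z -> b \in Z -> P \subset Z].
Proof.
move=> spA tX aX bX.
(* A smallest such set is the least one, as these sets are closed under
   intersection. *)
pose ok Z := [&& tight m A Z, a \in Z & b \in Z].
have okX : ok X by rewrite /ok tX aX bX.
have [P okP minP] := arg_minnP (fun Z => #|Z|) okX.
have hP Z : ok Z -> P \subset Z.
  case/and3P => tZ aZ bZ; case/and3P: (okP) => tP aP bP.
  have okI : ok (P :&: Z).
    by rewrite /ok (tightI spA tP tZ aP aZ) !inE aP aZ bP bZ.
  have /eqP <- : P :&: Z == P by rewrite eqEcard subsetIl minP.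
  exact: subsetIr.
case/and3P: (okP) => tP aP bP; exists P; split=> // [|Z tZ aZ bZ]; apply: hP => //.
by rewrite /ok tZ aZ bZ.
Qed.

(** Take an edge of the path from a to b that leaves Y. *)
Lemma path_cross F X Y a b : sparse 1 F -> tight 1 F X -> a \in X -> b \in X ->
  a \in Y -> b \notin Y ->
  exists f, [/\ f \in F, ein f X, cross f Y
    & forall Z, tight 1 (F :\ f) Z -> a \in Z -> b \notin Z].
Proof.
move=> spF tX aX bX aY bY.
have [P [tP aP bP PX minP]] := tight_hull spF tX aX bX.
have [f [fF fP fY]] : exists e, [/\ e \in F, ein e P & cross e Y].
  by apply: (tight_cross _ spF tP) => //; apply/set0Pn; [exists a|exists b];
     rewrite !inE ?aP ?aY ?bP ?bY.
have fX : ein f X by case/andP: fP => ? ?; rewrite /ein !(subsetP PX).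
exists f; split=> // Z tZ aZ; apply/negP => bZ.
have PZ : P \subset Z.
  by apply: minP => //; apply: tight_sub tZ; rewrite ?subD1set.
have : ~~ ein f Z.
  exact: tight_setD1 tZ.
by case/andP: fP => ? ?; rewrite /ein !(subsetP PZ).
Qed.

Lemma forest_noloop F e : sparse 1 F -> e \in F -> s e != t e.
Proof.
move=> spF eF; apply/eqP => eq; have := tight1 (s e) spF => /tightE.
have : 0 < #|inn F [set s e]|.
  by apply/card_gt0P; exists e; rewrite in_inn eF /ein -eq inE eqxx.
by rewrite cards1; lia.
Qed.

Lemma edge_tight F e : sparse 1 F -> e \in F -> tight 1 F [set s e; t e].
Proof.
move=> spF eF; have st := forest_noloop spF eF.
apply: tightP => //; first by apply/set0Pn; exists (s e); rewrite !inE eqxx.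
rewrite cards2 st mul1n addn1 ltnS; apply/card_gt0P; exists e.
by rewrite in_inn eF /ein !inE !eqxx orbT.
Qed.

Lemma block_edge F e x : sparse 1 F -> e \in F -> ~~ cross e (block 1 F x).
Proof.
move=> spF eF; rewrite /cross negbK; apply/eqP.
have te := edge_tight spF eF.
have es : t e \in block 1 F (s e).
  by apply: (subsetP (block_sub te _)); rewrite !inE eqxx ?orbT.
have eb := block_eq spF es.
apply/idP/idP => h.
  by rewrite -(block_eq spF h).
by rewrite -(block_eq spF h) eb block_self.
Qed.

Lemma edge_block F e x : sparse 1 F -> e \in F ->
  (s e \in block 1 F x) = (t e \in block 1 F x).
Proof. by move=> spF eF; apply/eqP; have := block_edge x spF eF; rewrite negbK. Qed.

(** Tight sets of a forest are connected. With p the membership in a closed set this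
    bounds the components from above. *)
Lemma mono_tight (T : eqType) (p : V -> T) F X : sparse 1 F ->
  (forall e, e \in F -> p (s e) = p (t e)) -> tight 1 F X ->
  forall x y, x \in X -> y \in X -> p x = p y.
Proof.
move=> spF pF tX x y xX yX; apply/eqP/contraT => pxy.
have [e [eF _]] : exists e, [/\ e \in F, ein e X & cross e [set z | p z == p x]].
  apply: (tight_cross _ spF tX) => //; apply/set0Pn; first by exists x; rewrite !inE xX eqxx.
  by exists y; rewrite !inE yX eq_sym pxy.
by rewrite /cross !inE pF // eqxx.
Qed.

End Sparse.

(** * Partition of a sparse set into forests *)

Section NashWilliams.
Variables (V E : finType) (s t : E -> V) (k : nat).
Implicit Types (A B F : {set E}) (X Y Z : {set V}) (e f : E).
Local Notation sparse := (sparse s t).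
Local Notation tight := (tight s t).
Local Notation inn := (inn s t).
Local Notation ein := (ein s t).
Local Notation state := ({ffun E -> 'I_k} * E)%type.

Definition colour_class A (c : {ffun E -> 'I_k}) x i :=
  [set y in A | (y != x) && (c y == i)].

(** A state is a colouring with one uncoloured edge. A move gives this edge the
    colour of another edge, which becomes the uncoloured one; this must keep the
    class a forest. *)
Definition recolour A : rel state := fun p q =>
  [&& q.2 \in A, q.2 != p.2,
      q.1 == [ffun z => if z == p.2 then p.1 q.2 else p.1 z]
    & sparse 1 (p.2 |: (colour_class A p.1 p.2 (p.1 q.2) :\ q.2))].

Lemma recolour_class A p q j : p.2 \in A -> recolour A p q ->
  colour_class A q.1 q.2 j =
    if j == p.1 q.2 then p.2 |: (colour_class A p.1 p.2 j :\ q.2)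
    else colour_class A p.1 p.2 j.
Proof.
case: p q => c x [c' y] /= xA /and4P[/= yA yx /eqP-> _].
have xy : x != y by rewrite eq_sym.
apply/setP => z; case: ifP => [/eqP->|jc]; rewrite !inE ffunE.
  have [->|zx] := eqVneq z x; first by rewrite xA xy eqxx.
  by rewrite /= andbCA.
have [->|zx] := eqVneq z x; first by rewrite (eq_sym (c y)) jc !andbF.
have [->|zy] := eqVneq z y; first by rewrite (eq_sym (c y)) jc !andbF.
by [].
Qed.

Section Augment.
Variables (A : {set E}) (c0 : {ffun E -> 'I_k}) (x0 : E).
Hypotheses (x0A : x0 \in A) (spA : sparse k A)
  (sp0 : forall i, sparse 1 (colour_class A c0 x0 i)).
Let reach := connect (recolour A) (c0, x0).
Hypothesis stuck :
  forall p i, reach p -> ~~ sparse 1 (p.2 |: colour_class A p.1 p.2 i).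
Let S := [set y | [exists c, reach (c, y)]].
Let cS (p : state) i := colour_class A p.1 p.2 i :&: S.

Let reach_ok p : reach p ->
  p.2 \in A /\ forall i, sparse 1 (colour_class A p.1 p.2 i).
Proof.
case/connectP => l; elim/last_ind: l p => [|l q IH] p /=; first by move=> _ ->.
rewrite rcons_path last_rcons => /andP[pl rq] ->.
have [lA spl] := IH _ pl erefl; split=> [|i]; first by case/and4P: rq.
rewrite (recolour_class i lA rq); case: ifP => // /eqP->.
by case/and4P: rq.
Qed.

(** When p.2 cannot get the colour i, it closes a cycle with a path of colour i. A
    move can uncolour precisely the edges of this path, so all of them lie in S. *)
Let reach_hull p i : reach p -> exists P,
  [/\ tight 1 (colour_class A p.1 p.2 i) P, ein p.2 P, tight 1 (cS p i) P
    & forall y, y \in colour_class A p.1 p.2 i ->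
        (sparse 1 (p.2 |: colour_class A p.1 p.2 i :\ y)) = ein y P].
Proof.
move=> rp; have [pA spc] := reach_ok rp; set C := colour_class _ _ _ _.
have spC : sparse 1 C by exact: spc.
have [X tX /andP[sX tX']] := sparse_addN spC (stuck i rp).
have [P [tP sP tP' PX minP]] := tight_hull spC tX sX tX'.
have key y : y \in C -> (sparse 1 (p.2 |: C :\ y)) = ein y P.
  have pC : p.2 \notin C by rewrite !inE eqxx andbF.
  move=> yC; have py : p.2 != y by apply: contraNneq pC => ->.
  apply/idP/idP => [sp|yP].
    apply: contraT => yP; have tP2 : tight 1 (C :\ y) P.
      apply: tight_transfer tP _ => [|z zC zP]; first exact: sparseD1.
      by rewrite in_setD1 zC andbT; apply: contraNneq yP => <-.
    have : ~~ ein p.2 P.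
      by apply: sparse_tight_notin sp tP2; rewrite in_setD1 negb_and pC orbT.
    by rewrite /ein sP tP'.
  apply: sparse_add; first exact: sparseD1.
  move=> Z tZ; apply/negP => /andP[sZ tZ'].
  have PZ : P \subset Z by apply: minP => //; apply: tight_sub tZ; rewrite ?subD1set.
  have : ~~ ein y Z.
    exact: tight_setD1 tZ.
  by case/andP: yP => ? ?; rewrite /ein !(subsetP PZ).
exists P; split=> //; first by rewrite /ein sP.
apply: tightP (tight_neq0 tP) _; first by apply: sparse_sub spC; rewrite subsetIl.
rewrite -(tightE tP) leq_add2r subset_leq_card //.
apply/subsetP => y; rewrite !in_inn in_setI => /andP[yC yP].
rewrite yC yP andbT /= inE; apply/existsP.
exists [ffun z => if z == p.2 then p.1 y else p.1 z].
apply: connect_trans rp (connect1 _).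
move: (yC); rewrite inE => /and3P[yA yx /eqP ci]; rewrite /recolour /= yA yx eqxx /=.
by rewrite ci key.
Qed.

(** A move exchanges two edges of one cycle, all other edges of which belong to S;
    so it does not change which vertices are connected by edges of S of colour j. *)
Let back_step p q j Z : reach p -> recolour A p q -> tight 1 (cS q j) Z ->
  exists2 Z' : {set V}, Z \subset Z' & tight 1 (cS p j) Z'.
Proof.
move=> rp mv tZ; have [pA spp] := reach_ok rp.
have rq : reach q by apply: connect_trans rp (connect1 mv).
have spS : sparse 1 (cS p j) by apply: sparse_sub (spp j); rewrite subsetIl.
have spSq : sparse 1 (cS q j).
  by apply: sparse_sub (proj2 (reach_ok rq) j); rewrite subsetIl.
have cE := recolour_class j pA mv.
have [jc|jc] := boolP (j == p.1 q.2); last first.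
  by exists Z => //; move: tZ; rewrite /cS cE (negbTE jc).
have pS : p.2 \in S by rewrite inE; apply/existsP; exists p.1; rewrite -surjective_pairing.
have yS : q.2 \in S by rewrite inE; apply/existsP; exists q.1; rewrite -surjective_pairing.
have pC : p.2 \notin colour_class A p.1 p.2 j by rewrite !inE eqxx andbF.
have yC : q.2 \in colour_class A p.1 p.2 j.
  by case/and4P: mv => yA yx _ _; rewrite !inE yA yx eq_sym.
have qp : p.2 != q.2 by case/and4P: mv; rewrite eq_sym.
have sE : cS q j = p.2 |: (cS p j :\ q.2).
  apply/setP => z; rewrite /cS cE jc /= !(in_setI, in_setU1, in_setD1).
  have [->|zx] := eqVneq z p.2; first by rewrite pS.
  by rewrite /= andbA.
have [P [tP pP tSP Pkey]] := reach_hull j rp.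
have yP : ein q.2 P.
  by rewrite -(Pkey _ yC); case/and4P: mv => _ _ _; rewrite -(eqP jc).
have cnt X : ein p.2 X -> ein q.2 X -> #|inn (cS p j) X| = #|inn (cS q j) X|.
  move=> pX yX; have -> : inn (cS q j) X = p.2 |: (inn (cS p j) X :\ q.2).
    apply/setP => z; rewrite sE in_inn !in_setU1 !in_setD1 in_inn andb_orl.
    by have [->|] := eqVneq z p.2; rewrite ?pX //= andbA.
  have y2 : q.2 \in inn (cS p j) X by rewrite in_inn yX in_setI yC yS.
  rewrite (cardsD1 q.2 (inn _ X)) y2 cardsU1 !inE.
  by move: pC; rewrite inE => /negbTE ->; rewrite andbF /=.
have [pZ|pZ] := boolP (ein p.2 Z); last first.
  exists Z => //; apply: tightP (tight_neq0 tZ) _ => //.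
  rewrite -(tightE tZ) leq_add2r subset_leq_card //.
  apply/subsetP => z; rewrite !in_inn sE !in_setU1 => /andP[/orP[/eqP->|] zZ].
    by rewrite zZ in pZ.
  by move: zZ; rewrite in_setD1 => /andP[_ ->] ->.
have tPq : tight 1 (cS q j) P.
  by apply: tightP (tight_neq0 tP) _ => //; rewrite -(cnt _ pP yP) (tightE tSP).
have sPp : s p.2 \in P by case/andP: pP.
have sZp : s p.2 \in Z by case/andP: pZ.
have tU := tightU spSq tZ tPq sZp sPp.
exists (Z :|: P); first exact: subsetUl.
apply: tightP (tight_neq0 tU) _ => //; rewrite cnt ?(tightE tU) //.
  by case/andP: pP => ? ?; rewrite /ein !inE; apply/andP; split; apply/orP; right.
by case/andP: yP => ? ?; rewrite /ein !inE; apply/andP; split; apply/orP; right.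
Qed.

Let back p j Z : reach p -> tight 1 (cS p j) Z ->
  exists2 Z' : {set V}, Z \subset Z' & tight 1 (cS (c0, x0) j) Z'.
Proof.
case/connectP => l; elim/last_ind: l p Z => [|l q IH] p Z /=.
  by move=> _ -> tZ; exists Z.
rewrite rcons_path last_rcons => /andP[pl mv] -> tZ.
have rl : reach (last (c0, x0) l) by apply/connectP; exists l.
have [Z1 ZZ1 tZ1] := back_step rl mv tZ.
have [Z2 Z12 tZ2] := IH _ _ pl erefl tZ1.
by exists Z2 => //; apply: subset_trans ZZ1 Z12.
Qed.

(** By the previous steps all colours have the same component X of edges of S around
    x0. Then X spans k trees and the additional edge x0, which is too much. *)
Lemma no_stuck : False.
Proof.
have r0 : reach (c0, x0) by exact: connect0.
have x0S : x0 \in S by rewrite inE; apply/existsP; exists c0.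
have sp0S i : sparse 1 (cS (c0, x0) i) by apply: sparse_sub (sp0 i); rewrite subsetIl.
pose X i := block s t 1 (cS (c0, x0) i) (s x0).
have Xs i : s x0 \in X i by apply: block_self.
have ncr y i : y \in S -> (s y \in X i) = (t y \in X i).
  rewrite inE => /existsP[c rc].
  have [P [_ /andP[sP tP'] tP _]] := reach_hull i rc.
  have [Z PZ tZ] := back rc tP.
  move/(subsetP PZ): sP => /= sZ; move/(subsetP PZ): tP' => /= tZ'.
  have H u v : u \in Z -> v \in Z -> u \in X i -> v \in X i.
    move=> uZ vZ uX; rewrite /X -(block_eq (sp0S i) uX).
    exact: (subsetP (block_sub tZ uZ)).
  by apply/idP/idP; apply: H.
have XX i j : X i = X j.
  suff H i' j' : X j' \subset X i' by apply/eqP; rewrite eqEsubset !H.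
  apply: contraT => nsub.
  have [e [/setIP[_ eS] _]] : exists e, [/\ e \in cS (c0, x0) j', ein e (X j')
      & cross s t e (X i')].
    apply: (tight_cross _ (sp0S j') (block_tight _ (sp0S j'))) => //.
      by apply/set0Pn; exists (s x0); rewrite inE !Xs.
    by rewrite setD_eq0.
  by rewrite /cross (ncr e i' eS) eqxx.
pose i0 := c0 x0.
have := sparseP _ _ _ _ spA (X i0).
have X0 : X i0 != set0 by apply/set0Pn; exists (s x0).
move/(_ X0).
have x0X : ein x0 (X i0) by rewrite /ein Xs -(ncr x0 i0 x0S) Xs.
have : \sum_(i < k) (#|X i0| - 1) <= #|inn A (X i0) :\ x0|.
  rewrite -[leqRHS]sum1_card (partition_big c0 predT) //=; apply: leq_sum => i _.
  rewrite sum1_card; have := tightE (block_tight (s x0) (sp0S i)).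
  rewrite mul1n -/(X i) (XX i i0) => <-.
  rewrite addnK; apply: subset_leq_card; apply/subsetP => z.
  rewrite !inE => /andP[/andP[/and3P[zA zx ci] zS] zX].
  by rewrite unfold_in /= !inE zA zx zX ci.
rewrite sum_nat_const card_ord (cardsD1 x0 (inn _ _)) in_inn x0A x0X.
have : 0 < #|X i0| by rewrite card_gt0.
by case: #|X i0| => // n _; rewrite subn1 /= mulnS; lia.
Qed.

End Augment.

Theorem nash_williams A : 0 < k -> sparse k A ->
  exists c : {ffun E -> 'I_k}, forall i, sparse 1 [set y in A | c y == i].
Proof.
move=> k0; have [n] := ubnP #|A|; elim: n A => // n IH A cA spA.
have [->|/set0Pn[x0 x0A]] := eqVneq A set0.
  exists [ffun _ => Ordinal k0] => i; apply/sparseP => X X0.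
  have -> : inn [set y in set0 | [ffun _ => Ordinal k0] y == i] X = set0.
    by apply/setP => z; rewrite !inE.
  by rewrite cards0 mul1n card_gt0.
have [|c0 spc0] := IH (A :\ x0) _ (sparse_sub (subD1set _ _) spA).
  by move: cA; rewrite (cardsD1 x0) x0A; lia.
have sp0 i : sparse 1 (colour_class A c0 x0 i).
  have -> // : colour_class A c0 x0 i = [set y in A :\ x0 | c0 y == i].
  by apply/setP => y; rewrite !inE andbA (andbC (y \in A)).
pose good p := connect (recolour A) (c0, x0) p
   && [exists i, sparse 1 (p.2 |: colour_class A p.1 p.2 i)].
have [/existsP[p /andP[rp /existsP[i spi]]]|/existsPn H] := boolP [exists p, good p].
  have [pA spp] : p.2 \in A /\ forall i, sparse 1 (colour_class A p.1 p.2 i).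
    case/connectP: rp => l; elim/last_ind: l p {spi} => [|l q IHl] p /=.
      by move=> _ ->.
    rewrite rcons_path last_rcons => /andP[pl rq] ->.
    have [lA spl] := IHl _ pl erefl; split=> [|j]; first by case/and4P: rq.
    rewrite (recolour_class j lA rq); case: ifP => // /eqP->.
    by case/and4P: rq.
  exists [ffun z => if z == p.2 then i else p.1 z] => j.
  have [->|ji] := eqVneq j i; [apply: sparse_sub spi|apply: sparse_sub (spp j)];
    apply/subsetP => z; rewrite !inE ffunE => /andP[zA].
    by have [->//|zp] := eqVneq z p.2 => /= ->; rewrite zA.
  have [->|zp ->] := eqVneq z p.2; last by rewrite zA.
  by rewrite eq_sym (negbTE ji).
case: (@no_stuck A c0 x0 x0A spA sp0) => p i rp.
by apply/negP => spi; move: (H p); rewrite /good rp /=; case/existsP; exists i.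
Qed.

End NashWilliams.

(** * Rooted forests and their extension *)

Section Arcs.
Variables (V E : finType) (s t : E -> V) (k : nat).
Implicit Types (A B F : {set E}) (X Y Z C : {set V}) (e f : E) (v w x : V).
Implicit Types (rho : 'I_k -> {set V}) (o : 'I_k -> V -> E) (hd : 'I_k -> V -> V).
Local Notation sparse := (sparse s t).
Local Notation tight := (tight s t).
Local Notation inn := (inn s t).
Local Notation ein := (ein s t).

Definition joins e x y := (s e == x) && (t e == y) || (s e == y) && (t e == x).

Lemma joins_ein e x y X : joins e x y -> ein e X = (x \in X) && (y \in X).
Proof. by case/orP => /andP[/eqP <- /eqP <-]; rewrite /ein // andbC. Qed.

Lemma joinsC e x y : joins e x y = joins e y x.
Proof. by rewrite /joins orbC. Qed.

(** Every vertex reaches R under iteration of n. *)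
Definition acyclic_to (R : {set V}) (n : V -> V) :=
  forall C, C != set0 -> [disjoint C & R] -> exists2 v, v \in C & n v \notin C.

(** The set B is partitioned into k spanning forests; the j-th one is oriented
    towards its set rho j of roots, and o j v is its edge leaving v, with head hd j
    v. *)
Record arcs rho o hd B : Prop := Arcs {
  arcs_joins : forall j v, v \notin rho j -> joins (o j v) v (hd j v);
  arcs_inj : forall j v j' v', v \notin rho j -> v' \notin rho j' ->
    o j v = o j' v' -> j = j' /\ v = v';
  arcs_im : B = [set o p.1 p.2 | p : 'I_k * V & p.2 \notin rho p.1];
  arcs_acyc : forall j, acyclic_to (rho j) (hd j)
}.

Section ArcsTheory.
Variables (rho : 'I_k -> {set V}) (o : 'I_k -> V -> E) (hd : 'I_k -> V -> V).
Variable (B : {set E}).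
Hypothesis (aB : arcs rho o hd B).

Lemma arcs_mem j v : v \notin rho j -> o j v \in B.
Proof. by move=> vr; rewrite (arcs_im aB); apply/imsetP; exists (j, v); rewrite ?inE. Qed.

Lemma arcs_surj e : e \in B -> exists j v, v \notin rho j /\ e = o j v.
Proof.
by rewrite (arcs_im aB) => /imsetP[[j v]]; rewrite inE /= => vr ->; exists j, v.
Qed.

Let stay j Y := [set v in Y | (v \notin rho j) && (hd j v \in Y)].

Lemma arcs_inn Y : #|inn B Y| = \sum_j #|stay j Y|.
Proof.
pose P := [set p : 'I_k * V | p.2 \in stay p.1 Y].
have -> : inn B Y = [set o p.1 p.2 | p in P].
  apply/setP => e; rewrite in_inn (arcs_im aB); apply/andP/imsetP.
    case=> /imsetP[[j v]]; rewrite inE /= => vr -> ie; exists (j, v) => //.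
    by move: ie; rewrite (joins_ein _ (arcs_joins aB vr)) !inE vr /= => /andP[-> ->].
  case=> [[j v]]; rewrite !inE /= => /and3P[vY vr hY] ->; split.
    by apply/imsetP; exists (j, v); rewrite ?inE.
  by rewrite (joins_ein _ (arcs_joins aB vr)) vY hY.
rewrite card_in_imset; last first.
  move=> [j v] [j' v']; rewrite !inE /= => /and3P[_ vr _] /and3P[_ vr' _].
  by move/(arcs_inj aB vr vr') => [-> ->].
rewrite -sum1_card.
under [RHS]eq_bigr do rewrite -sum1_card.
by rewrite pair_big_dep /=; apply: eq_bigl => p; rewrite inE.
Qed.

(** A root has no arc, and if there is no root in Y then some arc leaves Y by
    acyclicity. *)
Lemma arcs_stay j Y : Y != set0 -> #|stay j Y| + maxn 1 #|rho j :&: Y| <= #|Y|.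
Proof.
move=> Y0; have sY : #|stay j Y| <= #|Y :\: rho j|.
  by apply/subset_leq_card/subsetP => v; rewrite !inE => /and3P[-> ->].
have := cardsID (rho j) Y; rewrite setIC => cY.
have [r0|r0] := posnP #|rho j :&: Y|; last by lia.
suff : #|stay j Y| < #|Y| by lia.
have dj : [disjoint Y & rho j] by rewrite -setI_eq0 setIC -cards_eq0 r0.
have [v vY hv] := arcs_acyc aB Y0 dj.
apply: proper_card; apply/properP; split.
  by apply/subsetP => u; rewrite inE => /and3P[].
by exists v => //; rewrite inE (negbTE hv) !andbF.
Qed.

Lemma arcs_count Y : Y != set0 ->
  #|inn B Y| + \sum_j maxn 1 #|rho j :&: Y| <= k * #|Y|.
Proof.
move=> Y0; rewrite arcs_inn -big_split /= -[k in leqRHS]card_ord -sum_nat_const.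
by apply: leq_sum => j _; apply: arcs_stay.
Qed.

Lemma arcs_sparse : sparse k B.
Proof.
apply/sparseP => Y Y0; apply: leq_trans (arcs_count Y0).
by rewrite leq_add2l -[k in leqLHS]muln1 -[k in leqLHS]card_ord -sum_nat_const leq_sum // => j _; rewrite leq_maxl.
Qed.

(** Equality in the previous count leaves no room for an arc out of Y. *)
Lemma arcs_closed Y j v : k * #|Y| <= #|inn B Y| + \sum_j maxn 1 #|rho j :&: Y| ->
  rho j :&: Y != set0 -> v \in Y -> v \notin rho j -> hd j v \in Y.
Proof.
move=> eqY rY vY vr; apply: contraT => hY.
have Y0 : Y != set0 by apply/set0Pn; exists v.
have lt : #|stay j Y| + maxn 1 #|rho j :&: Y| < #|Y|.
  have -> : maxn 1 #|rho j :&: Y| = #|rho j :&: Y|.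
    by apply/maxn_idPr; rewrite card_gt0.
  have := cardsID (rho j) Y; rewrite setIC => <-.
  rewrite addnC ltn_add2l; apply: proper_card; apply/properP; split.
    by apply/subsetP => u; rewrite !inE => /and3P[-> ->].
  by exists v; rewrite !inE vY vr // (negbTE hY).
move: eqY; rewrite arcs_inn -big_split /= leqNgt => /negP[].
rewrite -[k in ltnRHS]card_ord -sum_nat_const (bigD1 j) //= [ltnRHS](bigD1 j) //=.
rewrite -addSn leq_add //; apply: leq_sum => j' _; exact: arcs_stay.
Qed.

End ArcsTheory.

(** A subtree is grown from r along crossing edges. *)
Lemma root_tree (e0 : E) T Z r : sparse 1 T -> tight 1 T Z -> r \in Z ->
  exists (o : V -> E) (n : V -> V),
    [/\ forall v, v \in Z :\ r -> o v \in T /\ joins (o v) v (n v),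
        {in Z :\ r &, injective o}, forall v, v \in Z :\ r -> n v \in Z
      & forall C, C != set0 -> C \subset Z :\ r -> exists2 v, v \in C & n v \notin C].
Proof.
move=> spT tZ rZ.
suff H m : m < #|Z| -> exists (S : {set V}) (o : V -> E) (n : V -> V),
    [/\ #|S| = m.+1, S \subset Z, r \in S &
    [/\ forall v, v \in S :\ r -> o v \in T /\ joins (o v) v (n v),
        {in S :\ r &, injective o}, forall v, v \in S :\ r -> n v \in S
      & forall C, C != set0 -> C \subset S :\ r -> exists2 v, v \in C & n v \notin C]].
  have Z0 : 0 < #|Z| by rewrite card_gt0 (tight_neq0 tZ).
  have [|S [o [n [cS SZ rS [H1 H2 H3 H4]]]]] := H #|Z|.-1; first by rewrite prednK.
  have SE : S = Z by apply/eqP; rewrite eqEcard SZ cS; lia.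
  by exists o, n; rewrite -SE.
elim: m => [_|m IH lt].
  have noS v : v \in [set r] :\ r -> False by rewrite !inE; case: eqP.
  have noC C : C != set0 -> C \subset [set r] :\ r -> False.
    by move=> /set0Pn[x xC] /subsetP/(_ x xC)/noS.
  exists [set r], (fun=> e0), id; split; rewrite ?cards1 ?sub1set ?inE //.
  split=> [v vr|x y xr|v vr|C C0 Cr].
  - by case: (noS _ vr).
  - by case: (noS _ xr).
  - by case: (noS _ vr).
  - by case: (noC _ C0 Cr).
have [|S [o [n [cS SZ rS [H1 H2 H3 H4]]]]] := IH; first by lia.
have [e [eT eZ eS]] : exists e, [/\ e \in T, ein e Z & cross s t e S].
  apply: (tight_cross _ spT tZ) => //; apply/set0Pn.
    by exists r; rewrite inE rZ.
  suff /set0Pn [v] : Z :\: S != set0 by exists v.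
  by rewrite setD_eq0; apply: contraL lt => /subset_leq_card; rewrite cS; lia.
have [v [u [vZ uS vS ju]]] : exists v u, [/\ v \in Z, u \in S, v \notin S & joins e v u].
  move: eS eZ; rewrite /cross /ein; case sS: (s e \in S); case tS: (t e \in S) => //= _ /andP[sZ tZ'].
    by exists (t e), (s e); rewrite sS tS /joins !eqxx orbT.
  by exists (s e), (t e); rewrite sS tS /joins !eqxx.
have ev w : w \in S -> (w == v) = false by move=> wS; apply: contraNF vS => /eqP <-.
have vr : v != r by rewrite eq_sym ev.
exists (v |: S), (fun w => if w == v then e else o w), (fun w => if w == v then u else n w).
have inS w : w \in (v |: S) :\ r -> w != v -> w \in S :\ r.
  by rewrite !inE => /andP[-> /orP[/eqP->|->]] //; rewrite eqxx.
have oS w : w \in S :\ r -> ein (o w) S.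
  move=> wS; have [_ jw] := H1 _ wS; rewrite (joins_ein _ jw) H3 //.
  by move: wS; rewrite inE => /andP[_ ->].
have ne : ~~ ein e S by rewrite (joins_ein _ ju) (negbTE vS).
split.
- by rewrite cardsU1 vS cS.
- by rewrite subUset sub1set vZ.
- by rewrite !inE rS orbT.
split=> [w wS|x y xS yS|w wS|C C0 CS].
- by case: eqP => [->|/eqP wv] //; apply: H1; apply: inS.
- case: eqP => [->|/eqP xv]; case: eqP => [->|/eqP yv] // eo.
  + by move: ne; rewrite eo oS // inS.
  + by move: ne; rewrite -eo oS // inS.
  + by apply: H2 eo; apply: inS.
- case: eqP => [_|/eqP wv]; rewrite !inE ?uS ?orbT //.
  by rewrite H3 ?orbT // inS.
- have [C1|C1] := eqVneq (C :\ v) set0.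
    have Cv : C = [set v].
      have Csub y : y \in C -> y = v.
        by move=> yC; apply/eqP; apply: contraT => yv; move/setP/(_ y): C1; rewrite !inE yv yC.
      case/set0Pn: C0 => x xC; apply/setP => y; rewrite inE; apply/idP/eqP => [/Csub//|->].
      by rewrite -(Csub x xC).
    exists v; first by rewrite Cv inE.
    rewrite eqxx Cv /= in_set1; apply/negP => /eqP uv; by rewrite -uv uS in vS.
  have [w wC nw] : exists2 w, w \in C :\ v & n w \notin C :\ v.
    apply: H4 => //; apply/subsetP => w; rewrite in_setD1 => /andP[wv wC].
    by apply: inS => //; apply: (subsetP CS).
  move: wC; rewrite in_setD1 => /andP[wv wC]; exists w; rewrite // (negbTE wv).
  have nS : n w \in S by apply: H3; apply: inS => //; apply: (subsetP CS).
  by apply: contra nw => nC; rewrite in_setD1 nC andbT ev.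
Qed.

End Arcs.

Section Extend.
Variables (V E : finType) (s t : E -> V) (k : nat).
Implicit Types (B : {set E}) (X Y C : {set V}) (e : E) (v r : V).
Implicit Types (o : 'I_k -> V -> E) (hd : 'I_k -> V -> V).

(** Contract X0 to its root r. The edges outside X0 remain sparse, so they form k
    forests, which by their number are spanning trees of the quotient. Oriented
    towards r, they complete the given arcs inside X0. *)
Lemma extend_arcs (e0 : E) B X0 r o hd : 0 < k -> sparse s t k B -> #|B| + k = k * #|V| ->
  r \in X0 ->
  (forall j v, v \in X0 :\ r -> [/\ o j v \in B, joins s t (o j v) v (hd j v) & hd j v \in X0]) ->
  (forall j v j' v', v \in X0 :\ r -> v' \in X0 :\ r -> o j v = o j' v' -> j = j' /\ v = v') ->
  (forall j C, C != set0 -> C \subset X0 :\ r -> exists2 v, v \in C & hd j v \notin C) ->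
  exists o' hd', arcs s t (fun=> [set r]) o' hd' B /\
    forall j v, v \in X0 :\ r -> o' j v = o j v /\ hd' j v = hd j v.
Proof.
move=> k0 spB cB rX oX injX acX.
(* The contraction of X0. *)
pose q v := if v \in X0 then r else v.
pose s' e := q (s e); pose t' e := q (t e).
pose B1 := B :\: inn s t B X0.
have qr v : (q v == r) = (v \in X0).
  by rewrite /q; case: ifP => [_|vX]; [exact: eqxx|apply: contraFF vX => /eqP->].
have cX : k * #|X0| <= #|inn s t B X0| + k.
  pose P := [set p : 'I_k * V | p.2 \in X0 :\ r].
  have : #|[set o p.1 p.2 | p in P]| <= #|inn s t B X0|.
    apply/subset_leq_card/subsetP => e /imsetP[[j v]]; rewrite !inE -in_setD1 /= => vX ->.
    have [oB jo hX] := oX j _ vX; rewrite oB (joins_ein _ jo) hX andbT.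
    by move: vX; rewrite in_setD1 => /andP[].
  rewrite card_in_imset => [|[j v] [j' v']]; last first.
    by rewrite !inE -!in_setD1 /= => vX vX' /(injX _ _ _ _ vX vX')[-> ->].
  have -> : #|P| = k * #|X0 :\ r|.
    have -> : P = setX [set: 'I_k] (X0 :\ r) by apply/setP => p; rewrite !inE.
    by rewrite cardsX cardsT card_ord.
  by rewrite (cardsD1 r X0) rX add1n mulnS addnC; lia.
have spB1 : sparse s' t' k B1.
  apply/sparseP => Y Y0.
  pose Y1 := Y :\: X0.
  have X00 : X0 != set0 by apply/set0Pn; exists r.
  have eqin v : v \in X0 -> r \in Y -> (q v \in Y) = (v \in Y1 :|: X0).
    by move=> vX rY; rewrite /q vX rY !inE vX orbT.
  have eqout v : v \notin X0 -> (q v \in Y) = (v \in Y1).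
    by move=> vX; rewrite /q (negbTE vX) !inE vX.
  have [rY|rY] := boolP (r \in Y).
    have qY v : (q v \in Y) = (v \in Y1 :|: X0).
      have [vX|vX] := boolP (v \in X0); first exact: eqin.
      by rewrite eqout // in_setU (negbTE vX) orbF.
    have : #|inn s' t' B1 Y| + #|inn s t B X0| <= #|inn s t B (Y1 :|: X0)|.
      rewrite -cardsUI (_ : _ :&: _ = set0) ?cards0 ?addn0.
        apply/subset_leq_card/subsetP => e; rewrite !inE /ein !qY !inE.
        by case/orP => [/andP[/andP[_ ->] ->]|/and3P[-> -> ->]]; rewrite ?orbT.
      by apply/setP => e; rewrite !inE; case: (e \in B); case: (ein s t e X0); rewrite ?andbF.
    have U0 : Y1 :|: X0 != set0 by apply/set0Pn; exists r; rewrite inE rX orbT.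
    have := sparseP _ _ _ _ spB _ U0.
    have -> : #|Y1 :|: X0| = #|Y1| + #|X0|.
      by rewrite cardsU (_ : _ :&: _ = set0) ?cards0 ?subn0 //; apply/setP => v; rewrite /Y1 !inE; case: (v \in X0); rewrite ?andbF.
    have : #|Y1| < #|Y|.
      by apply: proper_card; apply/properP; split; rewrite ?subsetDl //; exists r; rewrite ?inE ?rX.
    by move=> lt; have := leq_mul (leqnn k) lt; rewrite mulnS mulnDr; lia.
  have qY v : (q v \in Y) = (v \in Y1).
    have [vX|vX] := boolP (v \in X0); last exact: eqout.
    by rewrite /q vX (negbTE rY) inE vX.
  have le : #|inn s' t' B1 Y| <= #|inn s t B Y1|.
    apply/subset_leq_card/subsetP => e; rewrite !inE /ein !qY !inE.
    by case/andP => /andP[_ ->] ->.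
  have [Y10|Y10] := eqVneq Y1 set0.
    have -> : #|inn s' t' B1 Y| = 0.
      apply/eqP; rewrite -leqn0; apply: leq_trans le _; rewrite leqn0 cards_eq0 Y10.
      by apply/eqP/setP => e; rewrite !inE /ein inE andbF.
    by rewrite add0n -[leqLHS]muln1 leq_mul2l card_gt0 Y0 orbT.
  have := sparseP _ _ _ _ spB _ Y10.
  have : #|Y1| <= #|Y| by rewrite subset_leq_card ?subsetDl.
  by move=> lt; have := leq_mul (leqnn k) lt; lia.
have [c spc] := nash_williams k0 spB1.
pose T i := [set y in B1 | c y == i].
pose Z := r |: ~: X0.
have ZE v : (q v \in Z) by rewrite /q; case: ifP => vX; rewrite !inE ?eqxx ?vX ?orbT.
have cZ : #|Z| = (#|V| - #|X0|).+1.
  by rewrite cardsU1 !inE rX /= add1n cardsCs setCK.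
have Z0 : Z != set0 by apply/set0Pn; exists r; rewrite !inE eqxx.
have innZ i : inn s' t' (T i) Z = T i.
  by apply/setP => e; rewrite in_inn /ein !ZE !andbT.
have leT i : #|T i| <= #|V| - #|X0|.
  by have := sparseP _ _ _ _ (spc i) _ Z0; rewrite -/(T i) innZ cZ; lia.
have sumT : \sum_i #|T i| = #|B1|.
  rewrite -[RHS]sum1_card (partition_big c predT) //=; apply: eq_bigr => i _.
  by rewrite sum1dep_card; apply: eq_card => y; rewrite !inE.
have cV : #|X0| <= #|V| by apply: max_card.
have cB1 : k * (#|V| - #|X0|) <= #|B1|.
  rewrite cardsD (setIidPr _); last by apply/subsetP => e; rewrite inE => /andP[].
  have := sparseP _ _ _ _ spB X0; have : X0 != set0 by apply/set0Pn; exists r.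
  by move=> X00 /(_ X00); rewrite mulnBr; lia.
(* None of the k forests can have more edges, so all have this number. *)
have eqT i : #|T i| = #|V| - #|X0|.
  apply/eqP; rewrite eqn_leq leT /= leqNgt; apply/negP => lt.
  move: cB1; rewrite -sumT leqNgt => /negP[].
  rewrite -[k in ltnRHS]card_ord -sum_nat_const (bigD1 i) //= [ltnRHS](bigD1 i) //=.
  by rewrite -addSn leq_add //; apply: leq_sum.
have tiT i : tight s' t' 1 (T i) Z.
  by apply: (tightP (spc i) Z0); rewrite -/(T i) innZ eqT cZ; lia.
have rZ : r \in Z by rewrite !inE eqxx.
have rt i := root_tree e0 (spc i) (tiT i) rZ.
have {rt} [o1 rt] := fin_all_exists rt; have {rt} [n1 rt] := fin_all_exists rt.
pose oth e v := if s e == v then t e else s e.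
have qE v u : v \notin X0 -> q u = v -> u = v.
  by move=> vX; rewrite /q; case: ifP => // _ rv; rewrite -rv rX in vX.
have outZ v : v \notin X0 -> v \in Z :\ r.
  by move=> vX; rewrite !inE vX orbT andbT; apply: contraNneq vX => ->.
have o1P j v : v \notin X0 -> [/\ o1 j v \in B1, joins s t (o1 j v) v (oth (o1 j v) v)
    & q (oth (o1 j v) v) = n1 j v].
  move=> vX; have [H1 _ _ _] := rt j; have [oT jo] := H1 v (outZ v vX).
  move: oT; rewrite inE => /andP[oB _]; split=> //.
    rewrite /joins /oth; case: (eqVneq (s (o1 j v)) v) => [->|sv]; first by rewrite !eqxx.
    case/orP: jo => /andP[/eqP sq /eqP tq].
      by rewrite (qE _ _ vX sq) eqxx in sv.
    by rewrite (qE _ _ vX tq) !eqxx orbT.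
  rewrite /oth; case: (eqVneq (s (o1 j v)) v) => sv; case/orP: jo => /andP[/eqP sq /eqP tq] //.
    have tv := qE _ _ vX tq; rewrite tv -sq /s' sv //.
  by rewrite (qE _ _ vX sq) eqxx in sv.
exists (fun j v => if v \in X0 then o j v else o1 j v).
exists (fun j v => if v \in X0 then hd j v else oth (o1 j v) v).
have oXin j v : v \in X0 :\ r -> o j v \in inn s t B X0.
  move=> vX; have [oB jo hX] := oX j v vX; rewrite in_inn oB (joins_ein _ jo) hX andbT.
  by move: vX; rewrite in_setD1 => /andP[].
have inX v : v \notin [set r] -> v \in X0 -> v \in X0 :\ r by rewrite !inE => -> ->.
split; last by move=> j v; rewrite in_setD1 => /andP[_ ->].
have Hinj j v j' v' : v \notin [set r] -> v' \notin [set r] ->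
    (if v \in X0 then o j v else o1 j v) = (if v' \in X0 then o j' v' else o1 j' v') ->
    j = j' /\ v = v'.
  move=> vr vr'; case: ifP => vX; case: ifP => vX' eo.
  - by apply: injX eo; apply: inX.
  - have [oB _ _] := o1P j' v' (negbT vX').
    by move: oB; rewrite -eo in_setD (oXin j v) ?inX.
  - have [oB _ _] := o1P j v (negbT vX).
    by move: oB; rewrite eo in_setD (oXin j' v') ?inX.
  - have jj : j = j'.
      have [H1 _ _ _] := rt j; have [oT _] := H1 v (outZ v (negbT vX)).
      have [H1' _ _ _] := rt j'; have [oT' _] := H1' v' (outZ v' (negbT vX')).
      by move: oT oT'; rewrite eo !inE => /andP[_ /eqP cj] /andP[_ /eqP cj']; exact: etrans (esym cj) cj'.
    rewrite -jj in eo *; split=> //; have [_ H2 _ _] := rt j.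
    by apply: H2 eo; apply: outZ; apply: negbT.
split=> //.
- move=> j v vr; case: ifP => vX; first by have [] := oX j v (inX v vr vX).
  by have [] := o1P j v (negbT vX).
- apply/eqP; rewrite eq_sym eqEcard; apply/andP; split.
    apply/subsetP => e /imsetP[[j v]]; rewrite !inE /= => vr ->; case: ifP => vX.
      by have [] := oX j v; rewrite // !inE vr.
    by have [] := o1P j v (negbT vX); rewrite inE => /andP[].
  rewrite card_in_imset => [|[j v] [j' v']]; last first.
    by rewrite !inE -!in_set1 /= => vr vr' /(Hinj _ _ _ _ vr vr')[-> ->].
  have -> : #|[set p : 'I_k * V | p.2 \notin [set r]]| = k * (#|V| - 1).
    have -> : [set p : 'I_k * V | p.2 \notin [set r]] = setX [set: 'I_k] (~: [set r]).
      by apply/setP => p; rewrite !inE.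
    by rewrite cardsX cardsT card_ord cardsCs setCK cards1.
  by rewrite mulnBr muln1; lia.
- move=> j C C0 dC; have rC : r \notin C.
    by apply: contraTN dC => rC; apply/pred0Pn; exists r; rewrite !inE rC /=.
  have [CX|CX] := eqVneq (C :&: X0) set0.
    have nX v : v \in C -> v \notin X0.
      by move=> vC; apply/negP => vX; move/setP/(_ v): CX; rewrite !inE vC vX.
    have [_ _ _ H4] := rt j; have [|v vC nv] := H4 C C0.
      by apply/subsetP => v /nX; apply: outZ.
    exists v; rewrite // (negbTE (nX v vC)).
    have [_ _ qo] := o1P j v (nX v vC).
    by apply: contra nv => oC; rewrite -qo /q (negbTE (nX _ oC)).
  have [|v] := acX j (C :&: X0) CX.
    by apply/subsetP => v; rewrite !inE => /andP[vC ->]; rewrite andbT; apply: contraNneq rC => <-.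
  rewrite !inE => /andP[vC vX] nv; exists v; rewrite // vX.
  have vr : v \in X0 :\ r by rewrite !inE vX andbT; apply: contraNneq rC => <-.
  by apply: contra nv => ->; have [_ _ ->] := oX j v vr.
Qed.
End Extend.

(** * Cutting a tree between several vertices *)

Section Cuts.
Variables (V E : finType) (s t : E -> V) (k : nat).
Implicit Types (A B F : {set E}) (X Y Z : {set V}) (e f : E).
Local Notation sparse := (sparse s t).
Local Notation tight := (tight s t).
Local Notation inn := (inn s t).
Local Notation ein := (ein s t).
Local Notation cross := (cross s t).
Local Notation block := (block s t).

(** Deleting an edge of a tree leaves two components. *)
Lemma tight_split F Q f v : sparse 1 F -> tight 1 F Q -> ein f Q -> v \in Q ->
  v \in block 1 (F :\ f) (s f) :|: block 1 (F :\ f) (t f).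
Proof.
move=> spF tQ /andP[sQ tQ'] vQ; set U := _ :|: _.
have spF' : sparse 1 (F :\ f) by exact: sparseD1.
apply: contraT => vU.
have [e [eF _]] : exists e, [/\ e \in F, ein e Q & cross e U].
  apply: (tight_cross _ spF tQ) => //; apply/set0Pn.
    by exists (s f); rewrite !inE sQ block_self.
  by exists v; rewrite in_setD vU.
have [->|ef] := eqVneq e f.
  by rewrite /cross !in_setU !block_self // orbT.
have eF' : e \in F :\ f by rewrite !inE ef.
by rewrite /cross !in_setU !(edge_block _ spF' eF') eqxx.
Qed.

Lemma inn_notin A e X : ~~ ein e X -> inn (e |: A) X = inn A X.
Proof.
move=> eX; apply/setP => f; rewrite !in_inn in_setU1.
by case: eqP => [->|//]; rewrite (negbTE eX) !andbF.
Qed.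

Lemma inn_in A e X : e \notin A -> ein e X -> #|inn (e |: A) X| = #|inn A X|.+1.
Proof.
move=> eA eX; have -> : inn (e |: A) X = e |: inn A X.
  by apply/setP => f; rewrite !inE; case: eqP => [->|//]; rewrite eX.
by rewrite cardsU1 in_inn (negbTE eA).
Qed.

Variables (B : {set E}) (AS : {set V}) (F0 : {set E}) (q0 : V).
Let Q := block 1 F0 q0.
Hypotheses (spB : sparse k B) (spF : sparse 1 F0).
Hypothesis defB : forall Y, Y != set0 -> #|inn B Y| + k + #|AS :&: Y| <= k * #|Y| + 1.
Hypothesis FB : forall f, f \in F0 -> f \notin B.
Hypothesis ASQ : AS \subset Q.

Let tQ : tight 1 F0 Q. Proof. exact: block_tight. Qed.

Let tightB Y a a' : tight k B Y -> a \in AS -> a' \in AS -> a \in Y -> a' \in Y -> a = a'.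
Proof.
move=> tY aA aA' aY aY'; have := defB (tight_neq0 tY); rewrite (tightE tY).
rewrite leq_add2l => /card_le1_eqP H; apply: H; rewrite inE ?aA ?aA' //.
Qed.

(** A tight set contains at most one vertex of AS, so the block of a1 in B does not
    contain a2; an edge of the path from a1 to a2 leaves this block. *)
Lemma cut2 a1 a2 : a1 \in AS -> a2 \in AS -> a1 != a2 ->
  exists f, [/\ f \in F0, ein f Q, sparse k (f |: B)
    & forall Z, tight 1 (F0 :\ f) Z -> a1 \in Z -> a2 \notin Z].
Proof.
move=> a1A a2A a12.
have a2Y : a2 \notin block k B a1.
  apply: contra a12 => a2Y; apply/eqP.
  by apply: tightB (block_tight a1 spB) a1A a2A _ a2Y; rewrite block_self.
have [f [fF fQ fc sep]] := path_cross spF tQ (subsetP ASQ _ a1A) (subsetP ASQ _ a2A)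
  (block_self a1 spB) a2Y.
by exists f; split=> //; apply: sparse_cross fc.
Qed.

(** The edge f1 separates a2 from a1 and a3. Let Y be the block of a1 in f1 |: B. If
    the path from a1 to a3 leaves Y, a second cut is found there. Otherwise Y
    contains a1, a3 and f1, hence by the deficits not a2. Then f1 is given up: an
    edge f1' of the path from a1 to a3 that is addable to B, and an edge f2 leaving
    Y between f1 and a2, can be added together. Indeed a tight set W with f1' and f2
    would meet Y in a tight set of B that contains f1'. *)
Let cut3_aux a1 a2 a3 f1 : a1 \in AS -> a2 \in AS -> a3 \in AS ->
  a1 != a2 -> a1 != a3 -> a2 != a3 -> f1 \in F0 -> ein f1 Q -> sparse k (f1 |: B) ->
  a3 \in block 1 (F0 :\ f1) a1 -> a2 \notin block 1 (F0 :\ f1) a1 ->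
  exists f g, [/\ f \in inn F0 Q, g \in inn F0 Q, f != g, sparse k (f |: (g |: B))
    & forall Z, tight 1 (F0 :\: [set f; g]) Z ->
       [&& ~~ ((a1 \in Z) && (a2 \in Z)), ~~ ((a1 \in Z) && (a3 \in Z))
         & ~~ ((a2 \in Z) && (a3 \in Z))]].
Proof.
move=> a1A a2A a3A a12 a13 a23 f1F f1Q sp1 a3K a2K.
set F1 := F0 :\ f1; set K := block 1 F1 a1 in a3K a2K.
have spF1 : sparse 1 F1 by exact: sparseD1.
have tK : tight 1 F1 K by apply: block_tight.
have a1K : a1 \in K by apply: block_self.
pose K2 := block 1 F1 a2.
have tK2 : tight 1 F1 K2 by apply: block_tight.
have a2K2 : a2 \in K2 by apply: block_self.
have dK : [disjoint K & K2] by apply: block_disj.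
have nK2 x : x \in K -> x \notin K2 by move=> xK; rewrite (disjointFr dK xK).
have inF x : x \in F1 -> x \in F0 by rewrite in_setD1 => /andP[].
have subQ X : tight 1 F1 X -> (exists2 a, a \in X & a \in Q) -> X \subset Q.
  move=> tX [a aX aQ]; rewrite /Q -(block_eq spF aQ).
  by apply: block_sub aX; apply: tight_sub tX => //; exact: subD1set.
have einQ f X : tight 1 F1 X -> (exists2 a, a \in X & a \in Q) -> f \in F0 -> ein f X ->
    f \in inn F0 Q.
  move=> tX /(subQ _ tX) XQ fF /andP[sX tX']; rewrite in_inn fF /ein.
  by rewrite !(subsetP XQ).
pose B2 := f1 |: B.
have f1B : f1 \notin B by apply: FB.
pose Y := block k B2 a1.
have tY : tight k B2 Y by apply: block_tight.
have a1Y : a1 \in Y by apply: block_self.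
have [P [tP a1P a3P PK minP]] := tight_hull spF1 tK a1K a3K.
have PQ : exists2 a, a \in P & a \in Q by exists a1; rewrite ?(subsetP ASQ).
have K2Q : exists2 a, a \in K2 & a \in Q by exists a2; rewrite ?(subsetP ASQ).
(* Although P is a path of F0 :\ f1 only, its edges separate a1 from a3 in F0: the
   set K contains the path, and f1 is not inside K. *)
have sep13 f Z : f \in F1 -> ein f P -> tight 1 (F0 :\ f) Z -> a1 \in Z -> a3 \notin Z.
  move=> fF fP tZ a1Z; apply/negP => a3Z.
  have tZ0 : tight 1 F0 Z by apply: tight_sub tZ; rewrite ?subD1set.
  have tK0 : tight 1 F0 K by apply: tight_sub tK; rewrite ?subD1set.
  have tI := tightI spF tZ0 tK0 a1Z a1K.
  have tI1 : tight 1 F1 (Z :&: K).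
    apply: tight_transfer tI _ => // e eF eZK; rewrite in_setD1 eF andbT.
    apply: contraTneq eZK => ->; apply/negP => /andP[sK tK'].
    have : ~~ ein f1 K by apply: tight_setD1 tK.
    by move: sK tK'; rewrite /ein !inE => /andP[_ ->] /andP[_ ->].
  have PZ : P \subset Z.
    by apply: subset_trans (subsetIl Z K); apply: minP; rewrite ?inE ?a1Z ?a3Z.
  have : ~~ ein f Z.
    by apply: tight_setD1 tZ; rewrite ?inF.
  by case/andP: fP => ? ?; rewrite /ein !(subsetP PZ).
have tC f g Z h : h \in [set f; g] -> tight 1 (F0 :\: [set f; g]) Z -> tight 1 (F0 :\ h) Z.
  move=> hfg tZ; apply: tight_sub tZ; last exact: sparseD1.
  by apply: setDS; rewrite sub1set.
have [PY|/subsetPn[p pP pY]] := boolP (P \subset Y); last first.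
  (* An edge of the path leaving Y can be added to f1 |: B. *)
  have [g [gF gP gY]] : exists e, [/\ e \in F1, ein e P & cross e Y].
    apply: (tight_cross _ spF1 tP) => //; apply/set0Pn; first by exists a1; rewrite inE a1P.
    by exists p; rewrite inE pY.
  exists g, f1; split.
  - exact: einQ tP PQ (inF _ gF) gP.
  - by rewrite in_inn f1F.
  - by move: gF; rewrite in_setD1 => /andP[].
  - by apply: sparse_cross gY.
  move=> Z tZ; have tZ1 : tight 1 F1 Z by apply: tC tZ; rewrite !inE eqxx orbT.
  have tZg : tight 1 (F0 :\ g) Z by apply: tC tZ; rewrite !inE eqxx.
  have Zsub x : x \in K -> x \in Z -> a2 \notin Z.
    move=> xK xZ; apply: contra a2K => a2Z.
    by apply: (subsetP (block_sub (tightU spF1 tZ1 tK xZ xK) _)); rewrite inE ?a1K ?a2Z ?orbT.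
  apply/and3P; split; apply/negP => /andP[h1 h2].
  - by move: (Zsub _ a1K h1); rewrite h2.
  - by move: (sep13 _ _ gF gP tZg h1); rewrite h2.
  - by move: (Zsub _ a3K h2); rewrite h1.
have a3Y : a3 \in Y by apply: (subsetP PY).
have f1Y : ein f1 Y.
  apply: contraT => f1Y; case/eqP: a13; apply: (@tightB Y) => //.
  by rewrite tight_def (tight_neq0 tY) -(inn_notin B f1Y) (tightE tY) eqxx.
have cY : #|inn B Y| + k.+1 = k * #|Y|.
  by rewrite -(tightE tY) (inn_in f1B f1Y) addSnnS.
have a2Y : a2 \notin Y.
  apply/negP => a2Y; have := defB (tight_neq0 tY).
  have : #|[set a1; a2; a3]| <= #|AS :&: Y|.
    by apply/subset_leq_card/subsetP => x; rewrite !inE => /orP[/orP[]|] /eqP ->;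
      rewrite ?a1A ?a2A ?a3A ?a1Y ?a2Y ?a3Y.
  have -> : #|[set a1; a2; a3]| = 3.
    by rewrite -setUA cardsU1 in_set2 negb_or a12 a13 cards2 a23.
  by rewrite -cY => h1 h2; clear -h1 h2; lia.
(* v and u are the ends of f1 on the side of a2 and on the side of a1. *)
have [v [u [vK2 uK2 ju]]] : exists v u, [/\ v \in K2, u \notin K2 & joins s t f1 v u].
  have nK : ~~ ein f1 K2 by apply: tight_setD1 tK2.
  have := tight_split spF tQ f1Q (subsetP ASQ _ a2A); rewrite -/F1 inE.
  case/orP => h; have := block_self a2 spF1; rewrite -/K2 => _.
    have sK : s f1 \in K2 by rewrite /K2 (block_eq spF1 h) block_self.
    exists (s f1), (t f1); split=> //; last by rewrite /joins !eqxx.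
    by move: nK; rewrite /ein sK.
  have sK : t f1 \in K2 by rewrite /K2 (block_eq spF1 h) block_self.
  exists (t f1), (s f1); split=> //; last by rewrite /joins !eqxx orbT.
  by move: nK; rewrite /ein sK andbT.
have vY : v \in Y by move: f1Y; rewrite (joins_ein _ ju) => /andP[].
have [f2 [f2F f2K f2Y sep2]] := path_cross spF1 tK2 vK2 a2K2 vY a2Y.
have sp2 : sparse k (f2 |: B2) by apply: sparse_cross f2Y.
have a3Z : a3 \notin block k B a1.
  apply: contra a13 => h; apply/eqP.
  by apply: tightB (block_tight a1 spB) a1A a3A _ h; rewrite block_self.
have [f1' [f1'F f1'P f1'Z]] : exists e, [/\ e \in F1, ein e P & cross e (block k B a1)].
  apply: (tight_cross _ spF1 tP) => //; apply/set0Pn; first by exists a1; rewrite inE a1P block_self.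
  by exists a3; rewrite inE a3Z.
have sp1' : sparse k (f1' |: B) by apply: sparse_cross f1'Z.
have f1'Y : ein f1' Y by case/andP: f1'P => ? ?; rewrite /ein !(subsetP PY).
have f2nY : ~~ ein f2 Y by move: f2Y; rewrite /cross /ein; case: (_ \in Y).
have f12 : f1' != f2 by apply: contraNneq f2nY => <-.
have f2B : f2 \notin B by apply: FB; apply: inF.
have f1'B : f1' \notin B by apply: FB; apply: inF.
have f2B2 : f2 \notin B2.
  by rewrite in_setU1 negb_or f2B andbT; move: f2F; rewrite in_setD1 => /andP[].
exists f1', f2; split=> //.
- exact: einQ tP PQ (inF _ f1'F) f1'P.
- exact: einQ tK2 K2Q (inF _ f2F) f2K.
- rewrite setUCA; apply: sparse_add => // W tW; apply/negP => f2W.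
  have W0 := tight_neq0 tW.
  have spB2' : sparse k (f2 |: B) by apply: sparse_sub sp2; rewrite setUS // subsetUr.
  have f1'W : ein f1' W.
    apply: contraT => h; have tW' : tight k B W by move: tW; rewrite tight_def (inn_notin B h).
    by have := sparse_tight_notin f2B spB2' tW'; rewrite f2W.
  have cW : #|inn B W| + k.+1 = k * #|W| by rewrite -(tightE tW) (inn_in f1'B f1'W) addSnnS.
  have nt X : X != set0 -> ein f2 X -> #|inn B2 X| + k.+1 <= k * #|X|.
    move=> X0 f2X; rewrite addnS ltn_neqAle (sparseP _ _ _ _ sp1 X X0) andbT.
    apply/negP => eqX; have := sparse_tight_notin f2B2 sp2 (X := X).
    by rewrite f2X tight_def X0 eqX => /(_ isT).
  have f1W : ~~ ein f1 W.
    by apply/negP => h; have := nt W W0 f2W; rewrite (inn_in f1B h) => h1; clear -cW h1; lia.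
  have I0 : W :&: Y != set0.
    apply/set0Pn; case/andP: f2W => sW tW'; move: f2Y; rewrite /cross.
    case sY: (s f2 \in Y); case tY': (t f2 \in Y) => // _.
      by exists (s f2); rewrite inE sW.
    by exists (t f2); rewrite inE tW'.
  have U0 : W :|: Y != set0 by apply/set0Pn; exists a1; rewrite inE a1Y orbT.
  have f2U : ein f2 (W :|: Y) by case/andP: f2W => ? ?; rewrite /ein !inE; apply/andP; split; apply/orP; left.
  have f1I : ~~ ein f1 (W :&: Y).
    by apply: contra f1W; rewrite /ein !inE => /andP[/andP[-> _] /andP[-> _]].
  have := inn_submod s t B2 W Y; have := nt _ U0 f2U; have := tightE tY.
  rewrite (inn_notin B f1W) (inn_notin B f1I) => e1 e2 e3.
  have := card_UI W Y => /(congr1 (muln k)); rewrite !mulnDr => e4.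
  have tI : tight k B (W :&: Y) by apply: tightP => //; clear -cW e1 e2 e3 e4; lia.
  have := sparse_tight_notin f1'B sp1' tI.
  by move: f1'W f1'Y; rewrite /ein !inE => /andP[-> ->] /andP[-> ->].
move=> Z tZ; have tZ1' : tight 1 (F0 :\ f1') Z by apply: tC tZ; rewrite !inE eqxx.
pose J := block 1 (F1 :\ f2) a2.
have spF12 : sparse 1 (F1 :\ f2) by exact: sparseD1.
have tJ : tight 1 (F1 :\ f2) J by apply: block_tight.
have a2J : a2 \in J by apply: block_self.
have JK : J \subset K2 by apply: block_sub => //; apply: tight_sub tJ; rewrite ?subD1set.
have vJ : v \notin J by apply/negP => vJ; move: (sep2 _ tJ vJ); rewrite a2J.
have uJ : u \notin J by apply: contra uK2; apply: (subsetP JK).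
have mJ e : e \in F0 :\: [set f1'; f2] -> (s e \in J) = (t e \in J).
  rewrite !inE negb_or => /andP[/andP[_ e2] eF]; have [->|e1] := eqVneq e f1.
    by case/orP: ju => /andP[/eqP -> /eqP ->]; rewrite (negbTE uJ) (negbTE vJ).
  by apply: edge_block => //; rewrite !inE e1 e2.
have spFC : sparse 1 (F0 :\: [set f1'; f2]) by exact: sparseD.
have Jsep x : x \in K -> x \in Z -> a2 \notin Z.
  move=> xK xZ; apply/negP => a2Z; have := mono_tight (p := fun z => z \in J) spFC mJ tZ xZ a2Z.
  by rewrite /= a2J => /(subsetP JK); apply/negP; apply: nK2.
apply/and3P; split; apply/negP => /andP[h1 h2].
- by move: (Jsep _ a1K h1); rewrite h2.
- by move: (sep13 _ _ f1'F f1'P tZ1' h1); rewrite h2.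
- by move: (Jsep _ a3K h2); rewrite h1.
Qed.

(** After the first cut two of the three vertices are still together. *)
Lemma cut3 a1 a2 a3 : a1 \in AS -> a2 \in AS -> a3 \in AS ->
  a1 != a2 -> a1 != a3 -> a2 != a3 ->
  exists f g, [/\ f \in inn F0 Q, g \in inn F0 Q, f != g, sparse k (f |: (g |: B))
    & forall Z, tight 1 (F0 :\: [set f; g]) Z ->
       [&& ~~ ((a1 \in Z) && (a2 \in Z)), ~~ ((a1 \in Z) && (a3 \in Z))
         & ~~ ((a2 \in Z) && (a3 \in Z))]].
Proof.
move=> a1A a2A a3A a12 a13 a23.
have [f1 [f1F f1Q sp1 sep]] := cut2 a1A a2A a12.
have spF1 : sparse 1 (F0 :\ f1) by exact: sparseD1.
have a2K : a2 \notin block 1 (F0 :\ f1) a1 by apply: sep; rewrite ?block_tight ?block_self.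
have a1K : a1 \notin block 1 (F0 :\ f1) a2.
  by apply: contra a2K => h; rewrite (block_eq spF1 h) block_self.
have [h|h] := boolP (a3 \in block 1 (F0 :\ f1) a1).
  exact: (cut3_aux a1A a2A a3A a12 a13 a23 f1F f1Q).
have h2 : a3 \in block 1 (F0 :\ f1) a2.
  have sp x := tight_split spF tQ f1Q (v := x).
  have m x : x \in AS -> (block 1 (F0 :\ f1) x == block 1 (F0 :\ f1) (s f1))
      || (block 1 (F0 :\ f1) x == block 1 (F0 :\ f1) (t f1)).
    move=> xA; have := sp x (subsetP ASQ _ xA); rewrite inE.
    by case/orP => /(block_eq spF1) ->; rewrite eqxx ?orbT.
  have n12 : block 1 (F0 :\ f1) a1 != block 1 (F0 :\ f1) a2.
    by apply: contraNneq a2K => ->; rewrite block_self.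
  have n13 : block 1 (F0 :\ f1) a1 != block 1 (F0 :\ f1) a3.
    by apply: contraNneq h => ->; rewrite block_self.
  suff -> : block 1 (F0 :\ f1) a2 = block 1 (F0 :\ f1) a3 by rewrite block_self.
  move: (m _ a1A) (m _ a2A) (m _ a3A) n12 n13.
  by case/orP => /eqP ->; case/orP => /eqP ->; case/orP => /eqP ->; rewrite ?eqxx.
rewrite eq_sym in a12.
have [f [g [? ? ? ? sp]]] := cut3_aux a2A a1A a3A a12 a23 a13 f1F f1Q sp1 h2 a1K.
exists f, g; split=> // Z /sp /and3P[x1 x2 x3].
by rewrite (andbC (a1 \in Z)) x1 x3 x2.
Qed.

End Cuts.

(** * Redirecting arcs *)

Section Descend.
Variables (V : finType) (r : V) (n : V -> V).
Hypotheses (acn : acyclic_to [set r] n) (nr : n r = r).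
Implicit Types (S : {set V}) (v u a x : V).

Lemma fconnect_closed S v u : (forall w, w \in S -> n w \in S) -> v \in S ->
  fconnect n v u -> u \in S.
Proof.
move=> clS vS /iter_findex <-.
by elim: (findex _ _ _) => //= m IH; apply: clS.
Qed.

Lemma fconnect_next v a : fconnect n v a -> v != a -> fconnect n (n v) a.
Proof.
move=> /iter_findex; case: (findex _ _ _) => [/= ->|m]; first by rewrite eqxx.
by rewrite iterSr => <- _; apply: fconnect_iter.
Qed.

Lemma root_fconnect u : fconnect n r u -> u = r.
Proof.
move=> ru; apply/set1P; apply: fconnect_closed ru; last by rewrite inE.
by move=> w /set1P ->; rewrite nr inE.
Qed.

Lemma acyclic_closed S : (forall v, v \in S -> n v \in S) -> r \notin S -> S = set0.
Proof.
move=> clS rS; apply/eqP; apply: contraT => S0.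
have [|v vS] := acn S0; last by rewrite clS.
by rewrite disjoint_sym disjoints1.
Qed.

(** The vertices on such a cycle would form a closed set without r. *)
Lemma acyclic_nocycle a : a != r -> ~~ fconnect n (n a) a.
Proof.
move=> ar; apply/negP => ca.
pose S := [set v | fconnect n (n a) v && fconnect n v a].
have : a \in S by rewrite inE ca connect0.
rewrite (@acyclic_closed S) ?inE //; last first.
  by apply: contra ar => /andP[_ /root_fconnect ->].
move=> v; rewrite !inE => /andP[av va].
rewrite (connect_trans av (fconnect1 n v)) /=.
have [->//|va'] := eqVneq v a; exact: fconnect_next.
Qed.

Lemma fconnect_linear z a b : fconnect n z a -> fconnect n z b ->
  fconnect n a b || fconnect n b a.
Proof.
move=> /iter_findex <- /iter_findex <-.
set p := findex _ _ _; set q := findex _ _ _.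
by case/orP: (leq_total p q) => le; rewrite -(subnK le) iterD fconnect_iter ?orbT.
Qed.

End Descend.

(** In colour i the vertices of AS lose their arcs and become roots. Each relay x in
    Rd gets the edge fk x to zf x as its new arc; in the old tree zf x lies below a
    child of x in AS, and without the arc of this child the new arc closes no
    cycle. *)
Section Redirect.
Variables (V E : finType) (s t : E -> V) (k : nat).
Variables (r : V) (o : 'I_k -> V -> E) (hd : 'I_k -> V -> V) (B : {set E}).
Hypotheses (aB : arcs s t (fun=> [set r]) o hd B) (hdr : forall j, hd j r = r).
Variables (i : 'I_k) (AS Rd : {set V}) (fk : V -> E) (zf : V -> V).
Local Notation n := (hd i).
Hypothesis ASr : r \notin AS.
Hypothesis RdP : forall x, x \in Rd -> [/\ x != r, x \notin AS, fk x \notin B,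
   joins s t (fk x) x (zf x) & exists a, [/\ a \in AS, n a = x & fconnect n (zf x) a]].
Hypothesis fkI : {in Rd &, injective fk}.
Implicit Types (X Y W C : {set V}) (v u x a : V) (j : 'I_k).
Local Notation sparse := (sparse s t).
Local Notation tight := (tight s t).
Local Notation inn := (inn s t).
Local Notation ein := (ein s t).
Local Notation cross := (cross s t).

Definition tails := AS :|: Rd.
Definition moved := [set o i x | x in tails].
Definition redir := (B :\: moved) :|: [set fk x | x in Rd].
Definition rho' j := if j == i then r |: AS else [set r].
Definition o' j v := if (j == i) && (v \in Rd) then fk v else o j v.
Definition hd' j v := if (j == i) && (v \in Rd) then zf v else hd j v.

Definition step v u := [exists j, hd j v == u].
(** An exchange with tails T keeps all arcs at these vertices. *)
Definition unreach (T : {set V}) := [set v | ~~ [exists x in T, connect step v x]].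
Local Notation X0 := (unreach tails).

Let acn j : acyclic_to [set r] (hd j).
Proof. exact: (arcs_acyc aB). Qed.

(** Take x in W and Rd with the fewest descendants. The old path from zf x to its
    child a in AS stays in W as long as it meets no relay, and any relay on it would
    have fewer descendants than x. So it reaches a, although W avoids AS. *)
Lemma redirect_free W : (forall v, v \in W -> v \notin r |: AS -> hd' i v \in W) ->
  [disjoint W & AS] -> [disjoint W & Rd].
Proof.
move=> clW dW; rewrite -setI_eq0; apply: contraT => /set0Pn[x1 x1WR].
pose anc x := [set v | fconnect n v x].
have [x xWR minx] := @arg_minnP _ x1 (fun x => x \in W :&: Rd) (fun x => #|anc x|) x1WR.
have /setIP[xW xR] := xWR.
have [xr xAS _ _ [a [aA nax za]]] := RdP xR.
have ar : a != r by apply: contraNneq ASr => <-.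
pose S := W :&: anc a.
suff S0 : S = set0.
  have : zf x \in S; last by rewrite S0 inE.
  rewrite !inE za andbT; have := clW x xW; rewrite /hd' eqxx xR /=; apply.
  by rewrite !inE negb_or xr.
apply: (acyclic_closed (@acn i)); last first.
  rewrite !inE; apply/negP => /andP[_ /(root_fconnect (hdr i)) ar'].
  by rewrite ar' eqxx in ar.
move=> v; rewrite !inE => /andP[vW va].
have vAS : v \notin AS by rewrite (disjointFr dW vW).
have vna : v != a by apply: contraNneq vAS => ->.
have vr : v != r by apply: contraNneq ar => vr; rewrite vr in va; rewrite (root_fconnect (hdr i) va).
have nva := fconnect_next va vna; rewrite nva andbT.
have vR : v \notin Rd.
  apply/negP => vR.
  have vx : fconnect n v x by apply: connect_trans va _; rewrite -nax fconnect1.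
  have sub : anc v \subset anc x.
    by apply/subsetP => w; rewrite !inE => wv; apply: connect_trans wv vx.
  have : anc v == anc x by rewrite eqEcard sub minx // inE vW.
  move/eqP/setP/(_ x); rewrite !inE connect0 => xv.
  have := acyclic_nocycle (@acn i) (hdr i) ar; rewrite nax.
  by rewrite (connect_trans xv va).
have := clW v vW; rewrite /hd' (negbTE vR) andbF; apply.
by rewrite !inE negb_or vr.
Qed.

Lemma redirect_arcs : arcs s t rho' o' hd' redir.
Proof.
have rho_r j v : v \notin rho' j -> v \notin [set r].
  by rewrite /rho'; case: eqP => // _; rewrite !inE negb_or => /andP[].
split.
- move=> j v vr; rewrite /o' /hd'; case: ifP => [/andP[_ /RdP[]]//|_].
  by apply: arcs_joins aB _ _ _; apply: rho_r vr.
- move=> j v j' v' vr vr'; rewrite /o'.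
  case: ifP => [/andP[/eqP ji vR]|nR]; case: ifP => [/andP[/eqP ji' vR']|nR'].
  + by rewrite ji ji' => /fkI ->.
  + have [_ _ fB _ _] := RdP vR.
    by move=> eo; rewrite eo (arcs_mem aB) ?(rho_r j') in fB.
  + have [_ _ fB _ _] := RdP vR'.
    by move=> eo; rewrite -eo (arcs_mem aB) ?(rho_r j) in fB.
  + by apply: arcs_inj aB _ _ _ _ _ _; [apply: rho_r vr|apply: rho_r vr'].
- apply/setP => e; apply/idP/imsetP.
    rewrite in_setU => /orP[|/imsetP[x xR ->]]; last first.
      have [xr xA _ _ _] := RdP xR.
      by exists (i, x); rewrite /= ?inE /rho' /o' ?eqxx ?xR //= !inE negb_or xr.
    rewrite in_setD => /andP[eD eB]; have [j [v [vr eo]]] := arcs_surj aB eB.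
    exists (j, v); rewrite /= ?inE /rho' /o'.
      case: (eqVneq j i) => [ji|_] //; rewrite !inE negb_or -in_set1 vr /=.
      by apply: contra eD => vA; rewrite eo ji; apply/imsetP; exists v; rewrite // inE vA.
    case: ifP => // /andP[/eqP ji vR]; case/imsetP: eD; exists v; rewrite ?eo ?ji //.
    by rewrite inE vR orbT.
  case=> [[j v]]; rewrite !inE /= => vr ->; rewrite /o'; case: ifP => [/andP[_ vR]|nR].
    by apply/orP; right; apply/imsetP; exists v.
  apply/orP; left; rewrite (arcs_mem aB) ?(rho_r j) // andbT.
  apply/negP => /imsetP[x xT eo]; have xr : x \notin [set r].
    move: xT; rewrite !inE => /orP[xA|/RdP[]//]; by apply: contraNneq ASr => <-.
  have [ji vx] := arcs_inj aB (rho_r _ _ vr) xr eo.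
  move: nR vr; rewrite ji eqxx vx /rho' eqxx !inE negb_or /= => xR /andP[_ xA].
  by move: xT; rewrite inE xR (negbTE xA).
- move=> j C C0 dC; have [ji|ji] := eqVneq j i; last first.
    have [|v vC hv] := @acn j C C0; first by move: dC; rewrite /rho' (negbTE ji).
    by exists v; rewrite // /hd' (negbTE ji).
  move: dC; rewrite /rho' ji eqxx => dC.
  have [/existsP[v /andP[vC hv]]|/existsPn H] := boolP [exists v, (v \in C) && (hd' i v \notin C)].
    by exists v.
  have clC v : v \in C -> hd' i v \in C.
    by move=> vC; apply: contraT => hv; move: (H v); rewrite vC hv.
  have rC : r \notin C by apply: contraTN dC => rC; apply/pred0Pn; exists r; rewrite !inE rC eqxx.
  have dA : [disjoint C & AS] by apply: disjointWr dC; apply: subsetUr.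
  have dR : [disjoint C & Rd] by apply: redirect_free => // v vC _; apply: clC.
  case/eqP: C0; apply: (acyclic_closed (@acn i)) => // v vC.
  by have := clC v vC; rewrite /hd' (disjointFr dR vC) andbF.
Qed.

Lemma unreach_closed (T : {set V}) j v : v \in unreach T -> hd j v \in unreach T.
Proof.
rewrite !inE; apply: contra => /existsP[x /andP[xT cx]]; apply/existsP; exists x.
rewrite xT; apply: connect_trans (connect1 _) cx.
by apply/existsP; exists j.
Qed.

Lemma connect_step_closed (S : {set V}) v u : (forall w j, w \in S -> hd j w \in S) ->
  v \in S -> connect step v u -> u \in S.
Proof.
move=> clS vS /connectP[p pth ->]; elim: p v vS pth => //= w p IH v vS.
by case/andP => /existsP[j /eqP <-]; apply: IH; apply: clS.
Qed.

Lemma unreach_root (T : {set V}) : r \notin T -> r \in unreach T.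
Proof.
move=> rT; rewrite inE; apply/existsPn => x; apply/negP => /andP[xT rx].
have : x \in [set r].
  by apply: connect_step_closed rx; rewrite ?inE // => w j /set1P ->; rewrite hdr inE.
by move/set1P => xr; rewrite -xr xT in rT.
Qed.

Lemma unreach_tail (T : {set V}) x : x \in T -> x \notin unreach T.
Proof. by move=> xT; rewrite inE negbK; apply/existsP; exists x; rewrite xT connect0. Qed.

Lemma unreach_anti (T T' : {set V}) : T \subset T' -> unreach T' \subset unreach T.
Proof.
move=> TT; apply/subsetP => v; rewrite !inE; apply: contra => /existsP[x /andP[xT cx]].
by apply/existsP; exists x; rewrite (subsetP TT).
Qed.

Lemma tails_root : r \notin tails.
Proof.
rewrite inE negb_or ASr; apply/negP => rR.
by have [] := RdP rR; rewrite eqxx.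
Qed.

Let rX0 : r \in X0. Proof. exact: unreach_root tails_root. Qed.

Let sum_rho Y : \sum_j maxn 1 #|rho' j :&: Y| + 1 = k + maxn 1 #|(r |: AS) :&: Y|.
Proof.
rewrite (bigD1 i) //= /rho' eqxx addnAC [RHS]addnC -addnA; congr addn.
rewrite (eq_bigr (fun=> 1)) => [|j ji]; last first.
  rewrite (negbTE ji); apply/eqP; rewrite eqn_leq leq_maxl andbT geq_max /=.
  by rewrite -(cards1 r) subset_leq_card // subsetIl.
rewrite sum_nat_const muln1 (eq_card (B := predC1 i)) // cardC1 card_ord add1n.
by apply: prednK; apply: leq_ltn_trans (ltn_ord i).
Qed.

Lemma redir_sparse : sparse k redir.
Proof. exact: arcs_sparse redirect_arcs. Qed.

Lemma redir_count Y : Y != set0 ->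
  #|inn redir Y| + k + maxn 1 #|(r |: AS) :&: Y| <= k * #|Y| + 1.
Proof.
by move=> Y0; have := arcs_count redirect_arcs Y0; have := sum_rho Y; lia.
Qed.

Lemma redir_closed Y j v : k * #|Y| + 1 <= #|inn redir Y| + k + maxn 1 #|(r |: AS) :&: Y| ->
  r \in Y -> v \in Y -> v \notin rho' j -> hd' j v \in Y.
Proof.
move=> eqY rY vY vr; apply: (arcs_closed redirect_arcs _ _ vY vr).
  by have := sum_rho Y; lia.
apply/set0Pn; exists r; rewrite in_setI rY andbT /rho'.
by case: ifP => _; [exact: setU11|exact: set11].
Qed.

Lemma redir_keeps j v : v \in X0 -> v != r -> o j v \in inn redir X0.
Proof.
move=> vX vr; have vr' : v \notin [set r] by rewrite inE.
rewrite in_inn (joins_ein _ (arcs_joins aB vr')) vX unreach_closed // !andbT.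
rewrite in_setU in_setD (arcs_mem aB vr') andbT; apply/orP; left.
apply/negP => /imsetP[x xT eo]; have xr : x \notin [set r].
  by rewrite inE; apply: contraTneq xT => ->; apply: tails_root.
have [_ vx] := arcs_inj aB vr' xr eo.
by move: (unreach_tail xT); rewrite -vx vX.
Qed.

Lemma unreach_tight : tight k redir X0.
Proof.
have X00 : X0 != set0 by apply/set0Pn; exists r.
apply: tightP => //; first exact: redir_sparse.
have : #|[set o p.1 p.2 | p in setX [set: 'I_k] (X0 :\ r)]| <= #|inn redir X0|.
  apply/subset_leq_card/subsetP => e /imsetP[[j v]]; rewrite in_setX in_setD1 /=.
  by case/and3P => _ vr vX ->; apply: redir_keeps.
rewrite card_in_imset; last first.
  move=> [j v] [j' v']; rewrite !in_setX !in_setD1 /= => /and3P[_ vr _] /and3P[_ vr' _].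
  move=> eo; have vn : v \notin [set r] by rewrite inE.
  have vn' : v' \notin [set r] by rewrite inE.
  by have [-> ->] := arcs_inj aB vn vn' eo.
rewrite cardsX cardsT card_ord (cardsD1 r X0) rX0 add1n mulnS.
by clear; lia.
Qed.

Variable f0 : E.
Hypotheses (f0X : cross f0 X0).

(** A tight set W spanning f0 meets X0, which is tight, so one may add X0 to W. Then
    W contains r, hence no other root, and it is closed under all arcs; so it
    reaches no tail and lies in X0, which f0 crosses. *)
Lemma redir_cut : sparse k (f0 |: redir).
Proof.
apply: sparse_add redir_sparse _ => W tW; apply/negP => f0W.
have [x xW xX] : exists2 x, x \in W & x \in X0.
  move: f0X f0W; rewrite /cross /ein => cr /andP[sW tW'].
  case sX: (s f0 \in X0) cr => cr; first by exists (s f0).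
  by exists (t f0); rewrite // -[_ \in X0]negbK; case: (t f0 \in X0) cr.
pose U := W :|: X0.
have tU : tight k redir U := tightU redir_sparse tW unreach_tight xW xX.
have rU : r \in U by rewrite inE rX0 orbT.
have U0 := tight_neq0 tU.
(* As U is tight, r is its only root. *)
have le1 : maxn 1 #|(r |: AS) :&: U| <= 1.
  by move: (redir_count U0) (tightE tU); clear; lia.
have dA : [disjoint U & AS].
  rewrite -setI_eq0; apply: contraT => /set0Pn[a]; rewrite inE => /andP[aU aA].
  have : #|[set a; r]| <= #|(r |: AS) :&: U|.
    apply: subset_leq_card; rewrite subUset !sub1set !(in_setI _ _ U) rU aU.
    by rewrite setU11 in_setU aA orbT.
  rewrite cards2; have -> : a != r by apply: contraNneq ASr => <-.
  by move: le1; rewrite geq_max; clear; lia.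
have clU j v : v \in U -> v \notin rho' j -> hd' j v \in U.
  apply: redir_closed => //; rewrite (tightE tU) leq_add2l; exact: leq_maxl.
have dR : [disjoint U & Rd].
  by apply: redirect_free => // v vU vr; apply: clU; rewrite // /rho' eqxx.
have clU' v j : v \in U -> hd j v \in U.
  move=> vU; have [->|vr] := eqVneq v r; first by rewrite hdr.
  have := clU j v vU; rewrite /hd' (disjointFr dR vU) andbF; apply.
  by rewrite /rho'; case: ifP => _; rewrite !inE ?negb_or vr ?(disjointFr dA vU).
have UX : U \subset X0.
  apply/subsetP => v vU; rewrite inE; apply/existsPn => y; apply/negP => /andP[yT vy].
  have := connect_step_closed clU' vU vy.
  by move: yT; rewrite inE => /orP[] h; rewrite ?(disjointFl dA h) ?(disjointFl dR h).
move: f0X f0W; rewrite /cross /ein => cr /andP[sW tW'].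
by move: cr; rewrite !(subsetP UX) // inE ?sW ?tW'.
Qed.

(** A set misses one edge for every root beyond the first. The edge f0 takes up one
    of these, but if Y spans f0 then r counts as an additional root: if r is not in
    Y, pass to the union with X0. *)
Lemma redir_deficit Y : Y != set0 ->
  #|inn (f0 |: redir) Y| + k + #|AS :&: Y| <= k * #|Y| + 1.
Proof.
move=> Y0; have c0 := redir_count Y0.
have leA Z : #|AS :&: Z| <= #|(r |: AS) :&: Z|.
  by rewrite subset_leq_card // setSI // subsetUr.
have leAr (Z : {set V}) : r \in Z -> #|AS :&: Z| + 1 <= #|(r |: AS) :&: Z|.
  move=> rZ; have -> : (r |: AS) :&: Z = r |: (AS :&: Z).
    by apply/setP => x; rewrite !inE; case: eqP => [->|//]; rewrite rZ.
  by rewrite cardsU1 inE (negbTE ASr) addnC.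
have [f0Y|f0Y] := boolP (ein f0 Y); last first.
  by rewrite (inn_notin _ f0Y); have := leA Y; lia.
have le := inn_U1 s t redir f0 Y; rewrite f0Y in le.
have [rY|rY] := boolP (r \in Y); first by have := leAr Y rY; lia.
have rU : r \in Y :|: X0 by rewrite inE rX0 orbT.
have U0 : Y :|: X0 != set0 by apply/set0Pn; exists r.
have cU := redir_count U0; have := leAr _ rU.
have I0 : Y :&: X0 != set0.
  move: f0X f0Y; rewrite /cross /ein => cr /andP[sY tY]; apply/set0Pn.
  case sX: (s f0 \in X0) cr => cr; first by exists (s f0); rewrite inE sY.
  by exists (t f0); rewrite inE tY; case: (t f0 \in X0) cr.
have cI := sparseP _ _ _ _ redir_sparse _ I0.
have := inn_submod s t redir Y X0; have := tightE unreach_tight.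
have : #|AS :&: Y| <= #|AS :&: (Y :|: X0)| by rewrite subset_leq_card // setIS // subsetUl.
have := card_UI Y X0 => /(congr1 (muln k)); rewrite !mulnDr.
by clear -le cU cI; lia.
Qed.

End Redirect.

(** * Attaching pieces to a forest, and lexicographic codes *)

(** To a forest F1 one attaches, for each a in AS, a piece G a by means of edges D a
    within a |: G a. All pieces and all components of vertices of AS are disjoint,
    so the component of a only grows by G a. *)
Section Attach.
Variables (V E : finType) (s t : E -> V).
Implicit Types (F : {set E}) (X Y : {set V}) (e : E) (a v x y : V).
Local Notation sparse := (sparse s t).
Local Notation tight := (tight s t).
Local Notation ein := (ein s t).
Local Notation cross := (cross s t).
Local Notation block := (block s t 1).
Local Notation joins := (joins s t).

Lemma closed_block F Y v : sparse 1 F -> (forall e, e \in F -> ~~ cross e Y) ->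
  v \in Y -> block F v \subset Y.
Proof.
move=> spF clY vY; apply/subsetP => u ub.
have mY e : e \in F -> (s e \in Y) = (t e \in Y).
  by move=> /clY; rewrite /cross negbK => /eqP.
have := mono_tight (p := fun z => z \in Y) spF mY (block_tight v spF) (block_self v spF) ub.
by rewrite /= vY => <-.
Qed.

Lemma block_kept F F' u : sparse 1 F -> sparse 1 F' ->
  (forall e, e \in F -> ein e (block F u) -> e \in F') ->
  (forall e, e \in F' -> e \notin F -> ~~ cross e (block F u)) ->
  block F' u = block F u.
Proof.
move=> spF sp' keep ncr; apply/eqP; rewrite eqEsubset; apply/andP; split.
  apply: closed_block => // [e eF'|]; last exact: block_self.
  by have [eF|/(ncr e eF')//] := boolP (e \in F); apply: block_edge.
apply: block_sub; last exact: block_self.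
exact: (tight_transfer sp' (block_tight u spF)).
Qed.

Lemma attach_edge F e a b : sparse 1 F -> joins e a b -> b \notin block F a ->
  sparse 1 (e |: F).
Proof.
move=> spF je nb; apply: (@sparse_cross _ _ _ _ _ _ _ a) => //.
rewrite /cross; case/orP: je => /andP[/eqP -> /eqP ->].
  by rewrite block_self // (negbTE nb).
by rewrite block_self // (negbTE nb).
Qed.

Variables (F1 : {set E}) (AS : {set V}) (G : V -> {set V}) (D : V -> {set E}).
Hypotheses (sp1 : sparse 1 F1)
  (D_ends : forall a e, a \in AS -> e \in D a -> ein e (a |: G a))
  (G_disj : forall a a', a \in AS -> a' \in AS -> a != a' -> [disjoint G a & G a'])
  (G_blk : forall a a', a \in AS -> a' \in AS -> [disjoint block F1 a' & G a])
  (AS_sep : forall a a', a \in AS -> a' \in AS -> a' \in block F1 a -> a = a')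
  (G_closed : forall a e, a \in AS -> e \in F1 -> ~~ cross e (G a))
  (D_sparse : forall a F, a \in AS -> sparse 1 F -> F1 \subset F ->
    (forall e, e \in F -> (s e \in G a) || (t e \in G a) -> e \in F1) ->
    [disjoint block F a & G a] -> sparse 1 (F :|: D a)).

Definition attach (S : {set V}) := F1 :|: \bigcup_(a in S) D a.

Let in_attach S e : e \in attach S -> e \in F1 \/ exists2 a, a \in S & e \in D a.
Proof.
rewrite in_setU => /orP[->|/bigcupP[a aS eD]]; first by left.
by right; exists a.
Qed.

Let blk_closed (S : {set V}) v e : S \subset AS -> v \notin S ->
  (forall a, a \in S -> a \notin block F1 v) ->
  (forall a, a \in S -> [disjoint block F1 v & G a]) ->
  e \in attach S -> ~~ cross e (block F1 v).
Proof.
move=> SA vS nv dv /in_attach[eF|[a aS eD]]; first exact: block_edge.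
have /andP[sa ta] := D_ends (subsetP SA _ aS) eD.
have H x : x \in a |: G a -> x \notin block F1 v.
  rewrite !inE => /orP[/eqP ->|xG]; first exact: nv.
  by rewrite (disjointFl (dv a aS) xG).
by rewrite /cross (negbTE (H _ sa)) (negbTE (H _ ta)).
Qed.

Lemma attach_sparse : sparse 1 (attach AS).
Proof.
suff H m : forall S : {set V}, #|S| = m -> S \subset AS -> sparse 1 (attach S) by apply: (H _ AS).
elim: m => [|m IH] S cS SA.
  by rewrite /attach (cards0_eq cS) big_set0 setU0.
have /set0Pn[a aS] : S != set0 by rewrite -card_gt0 cS.
have aA := subsetP SA _ aS.
have SaA : S :\ a \subset AS by apply: subset_trans (subD1set _ _) SA.
have spF : sparse 1 (attach (S :\ a)).
  by apply: IH => //; move: cS; rewrite (cardsD1 a) aS => -[].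
have -> : attach S = attach (S :\ a) :|: D a.
  by rewrite /attach (big_setD1 a aS) /= setUCA setUC.
apply: D_sparse => //; first exact: subsetUl.
  move=> e /in_attach[//|[a']]; rewrite in_setD1 => /andP[a'a a'S] eD.
  have a'A := subsetP SA _ a'S.
  have /andP[sa ta] := D_ends a'A eD.
  have H x : x \in a' |: G a' -> x \notin G a.
    rewrite !inE => /orP[/eqP ->|xG].
      by rewrite (disjointFr (G_blk aA a'A)) // block_self.
    by rewrite (disjointFr (G_disj a'A aA a'a) xG).
  by rewrite (negbTE (H _ sa)) (negbTE (H _ ta)).
have sub : block (attach (S :\ a)) a \subset block F1 a.
  apply: closed_block => //; last exact: block_self.
  move=> e; apply: blk_closed => //; first by rewrite !inE eqxx.
    move=> a'; rewrite in_setD1 => /andP[a'a a'S]; apply: contra a'a => ab.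
    by rewrite (AS_sep aA (subsetP SA _ a'S) ab).
  by move=> a'; rewrite in_setD1 => /andP[a'a a'S]; apply: G_blk => //; apply: (subsetP SA).
exact: disjointWl sub (G_blk aA aA).
Qed.

Lemma attach_in a v : a \in AS -> v \in block F1 a :|: G a ->
  block (attach AS) v \subset block F1 a :|: G a.
Proof.
move=> aA vG; apply: closed_block => //; first exact: attach_sparse.
move=> e /in_attach[eF|[a' a'A eD]].
  have := block_edge a sp1 eF; have := G_closed aA eF.
  by rewrite /cross !in_setU !negbK => /eqP -> /eqP ->.
have /andP[sa ta] := D_ends a'A eD.
have [a'a|a'a] := eqVneq a' a.
  have H x : x \in a |: G a -> x \in block F1 a :|: G a.
    by rewrite !inE => /orP[/eqP->|->]; rewrite ?block_self ?orbT.
  by rewrite -a'a in sa ta H *; rewrite /cross !H.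
have H x : x \in a' |: G a' -> x \notin block F1 a :|: G a.
  rewrite in_setU1 in_setU negb_or => /orP[/eqP ->|xG].
    rewrite (disjointFr (G_blk aA a'A)) ?block_self // andbT.
    by apply: contra a'a => ab; rewrite (AS_sep aA a'A ab).
  by rewrite (disjointFl (G_blk a'A aA) xG) (disjointFr (G_disj a'A aA a'a) xG).
by rewrite /cross (negbTE (H _ sa)) (negbTE (H _ ta)).
Qed.

Lemma attach_out v : (forall a, a \in AS -> v \notin block F1 a :|: G a) ->
  block (attach AS) v \subset block F1 v.
Proof.
move=> nv; apply: closed_block => //; [exact: attach_sparse| |exact: block_self].
have nva a : a \in AS -> a \notin block F1 v.
  move=> aA; apply: contra (nv a aA) => ab.
  by rewrite in_setU (block_eq sp1 ab) block_self.
move=> e; apply: blk_closed => //; first by apply: contraTN (block_self v sp1) => /nva.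
move=> a aA; rewrite -setI_eq0; apply: contraT => /set0Pn[x]; rewrite in_setI => /andP[xv xG].
have sub : block F1 x \subset G a by apply: closed_block => // e' e'F; apply: G_closed.
move: (nv a aA); rewrite in_setU negb_or => /andP[_ /negP[]].
by apply: (subsetP sub); rewrite (block_eq sp1 xv) block_self.
Qed.

End Attach.

Section Lex.
Variable N : nat.
Implicit Types (l : seq nat) (j m : nat).

(** The code of l in base N.+2. A missing entry counts as N.+1, more than any size,
    so that prolonging a list decreases its code. *)
Fixpoint lexcode m l : nat :=
  if m is m'.+1 then head N.+1 l * N.+2 ^ m' + lexcode m' (behead l) else 0.

Lemma lexcode_bound m l : all (fun x => x <= N.+1) l -> lexcode m l < N.+2 ^ m.
Proof.
elim: m l => [|m IH] l al /=; first by rewrite expn0.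
have h : head N.+1 l <= N.+1 by case: l al => //= x l /andP[].
have b : all (fun x => x <= N.+1) (behead l) by case: l al {h} => //= x l /andP[].
have := IH _ b; rewrite expnS => lt.
apply: (@leq_trans (N.+1 * N.+2 ^ m + N.+2 ^ m)); last by rewrite -mulSnr.
by rewrite -addnS leq_add // leq_mul2r h orbT.
Qed.

Lemma lexcode_lt m l l' j : j < m -> j < size l' -> j <= size l ->
  take j l' = take j l -> all (fun x => x <= N.+1) l' ->
  nth N.+1 l' j < nth N.+1 l j -> lexcode m l' < lexcode m l.
Proof.
elim: j m l l' => [|j IH] [|m] l l' //= jm.
  case: l' => //= x l' _ _ _ /andP[xb al'] xl.
  have lt := lexcode_bound m al'.
  have : (x + 1) * N.+2 ^ m <= head N.+1 l * N.+2 ^ m.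
    by rewrite leq_mul2r; apply/orP; right; case: l xl => [|y l] /=; rewrite addn1.
  by rewrite mulnDl mul1n; lia.
case: l' => //= x l' sl; case: l => //= y l sl' [-> tk] /andP[_ al'] lt.
by rewrite ltn_add2l; apply: IH lt.
Qed.

End Lex.

(** * States and explorations *)

Lemma sum_sub_image (I J : finType) (P : {set I}) (Q : {set J}) (g : I -> J) (f : J -> nat) :
  Q \subset g @: P -> \sum_(j in Q) f j <= \sum_(i in P) f (g i).
Proof.
move=> sub; have pick j : j \in Q -> exists i, (i \in P) && (g i == j).
  by move=> /(subsetP sub)/imsetP[i iP ->]; exists i; rewrite iP eqxx.
rewrite [leqRHS](partition_big g predT) //= [leqLHS]big_mkcond /=.
apply: leq_sum => j _; case: ifP => // /pick[i /andP[iP gi]].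
by rewrite (bigD1 i) ?iP ?gi //= (eqP gi) leq_addr.
Qed.

Section States.
Variables (V E : finType) (s t : E -> V) (k d : nat) (A : {set E}) (h : E).
Implicit Types (B F : {set E}) (X Y : {set V}) (e f : E) (a v w x y : V).
Implicit Types (o : 'I_k -> V -> E) (hd : 'I_k -> V -> V) (ws : seq V).
Local Notation sparse := (sparse s t).
Local Notation tight := (tight s t).
Local Notation inn := (inn s t).
Local Notation ein := (ein s t).
Local Notation cross := (cross s t).
Local Notation block := (block s t 1).
Local Notation joins := (joins s t).
Local Notation r := (s h).
Local Notation q := (t h).

Definition good F := forall X, tight 1 F X -> #|X| <= d.+1.

(** A decomposition of A' as required in the theorem, up to splitting B into k
    forests. *)
Definition decomposed A' := exists B F,
  [/\ B :|: F = A', [disjoint B & F], sparse k B, sparse 1 F & good F].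

(** A decomposition of A with B a union of k trees rooted at r. *)
Record state o hd B F : Prop := State {
  st_arcs : arcs s t (fun=> [set r]) o hd B;
  st_root : forall j, hd j r = r;
  st_union : B :|: F = A;
  st_disj : [disjoint B & F];
  st_forest : sparse 1 F;
  st_good : good F
}.

Definition covered F ws := [set v | has (fun w => v \in block F w) ws].

(** The vertices at which the exploration may find a new component. *)
Definition reachable hd (U : {set V}) w :=
  w = r \/ w = q \/ exists i x, x \in U /\ hd i x = w.

Definition legal hd F ws := forall j, j < size ws ->
  let w := nth r ws j in
  w \notin covered F (take j ws) /\ reachable hd (covered F (take j ws)) w.

Definition sizes F ws := [seq #|block F w| | w <- ws].
Definition key F ws := lexcode #|V| #|V| (sizes F ws).

Lemma in_covered F ws v : reflect (exists2 w, w \in ws & v \in block F w) (v \in covered F ws).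
Proof. by rewrite inE; apply: hasP. Qed.

Lemma covered_eq F F' ws : (forall w, w \in ws -> block F' w = block F w) ->
  covered F' ws = covered F ws.
Proof.
by move=> H; apply/setP => v; rewrite !inE; apply: eq_in_has => w /H ->.
Qed.

Lemma covered_sub F ws ws' : {subset ws <= ws'} -> covered F ws \subset covered F ws'.
Proof.
move=> sub; apply/subsetP => v /in_covered[w wW vb]; apply/in_covered.
by exists w; rewrite ?sub.
Qed.

Lemma legal_uniq hd F ws : sparse 1 F -> legal hd F ws -> uniq ws.
Proof.
move=> spF lg; apply/(uniqP r) => i j; rewrite !inE => ilt jlt eij.
have H i' j' : i' < j' -> j' < size ws -> nth r ws i' = nth r ws j' -> False.
  move=> ij' jl' eq; have [/negP[]] := lg j' jl'; apply/in_covered; exists (nth r ws i').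
    by rewrite -(nth_take r ij') mem_nth // size_take jl'.
  by rewrite eq block_self.
by case: (ltngtP i j) => // ij; [case: (H i j)|case: (H j i)].
Qed.

Lemma sizes_bound F ws : all (fun m => m <= #|V|.+1) (sizes F ws).
Proof. by apply/allP => m /mapP[w _ ->]; rewrite leqW // max_card. Qed.

Section Minimal.
Hypotheses (k_gt0 : 0 < k) (d_gt0 : 0 < d) (d_le : d <= 2 * k.+1) (hA : h \notin A)
  (h_noloop : s h != t h).
Hypothesis failure : ~ decomposed (h |: A).
Variables (o : 'I_k -> V -> E) (hd : 'I_k -> V -> V) (B F : {set E}) (ws : seq V).
Hypotheses (st : state o hd B F) (lg : legal hd F ws).
Hypothesis minimal : forall o2 hd2 B2 F2 ws2, state o2 hd2 B2 F2 -> legal hd2 F2 ws2 ->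
  key F ws <= key F2 ws2.

Let aB := st_arcs st.
Let spF := st_forest st.
Let gF := st_good st.
Let hdr := st_root st.

Let ws_uniq : uniq ws. Proof. exact: legal_uniq lg. Qed.

(** The exploration of the old state up to its b-th vertex is legal in the new
    state, and its last size has decreased. *)
Lemma lex_improve o2 hd2 B2 F2 b : state o2 hd2 B2 F2 -> b < size ws ->
  (forall w, w \in take b ws -> block F2 w = block F w) ->
  (forall v i, v \in covered F (take b ws) -> hd2 i v = hd i v) ->
  #|block F2 (nth r ws b)| < #|block F (nth r ws b)| -> False.
Proof.
move=> st2 blt eqb eqh lt; pose ws2 := take b.+1 ws.
have tk j : j <= b -> take j ws2 = take j ws.
  by move=> jb; rewrite /ws2 take_takel // ltnW.
have ceq j : j <= b -> covered F2 (take j ws) = covered F (take j ws).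
  move=> jb; apply: covered_eq => w wj; apply: eqb.
  by rewrite -(take_takel ws jb) in wj; apply: mem_take wj.
have s2 : size ws2 = b.+1 by rewrite size_take_min; apply/minn_idPl.
have lg2 : legal hd2 F2 ws2.
  move=> j; rewrite s2 ltnS => jb; have jlt := leq_ltn_trans jb blt.
  have [nc re] := lg jlt; rewrite /= tk // ceq // nth_take //; split=> //.
  case: re => [|[|[i [x [xU <-]]]]]; first by left.
    by right; left.
  right; right; exists i, x; split=> //; apply: eqh.
  apply: (subsetP (covered_sub _ _)) xU => w wj.
  by rewrite -(take_takel ws jb) in wj; apply: mem_take wj.
have := minimal st2 lg2; rewrite leqNgt => /negP[].
have bN : b < #|V|.
  by apply: leq_trans blt _; rewrite -(card_uniqP ws_uniq) max_card.
apply: (@lexcode_lt _ _ _ _ b) => //.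
- by rewrite size_map s2.
- by rewrite size_map ltnW.
- rewrite -!map_take tk //; apply/eq_in_map => w wb.
  by rewrite eqb.
- exact: sizes_bound.
by rewrite !(nth_map r) ?s2 // nth_take.
Qed.

(** Otherwise the exploration could be continued, which decreases its code. *)
Lemma closed_end w : reachable hd (covered F ws) w -> w \in covered F ws.
Proof.
move=> re; apply: contraT => nw.
have lg2 : legal hd F (rcons ws w).
  move=> j; rewrite size_rcons ltnS leq_eqVlt => /orP[/eqP ->|jlt] /=.
    by rewrite nth_rcons ltnn eqxx -cats1 take_size_cat.
  rewrite nth_rcons jlt -cats1 takel_cat 1?ltnW //; exact: lg.
have := minimal st lg2; rewrite leqNgt => /negP[].
have un := legal_uniq spF lg2.
have sN : size ws < #|V| by rewrite -ltnS -(size_rcons ws w) ltnS -(card_uniqP un) max_card.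
apply: (@lexcode_lt _ _ _ _ (size ws)) => //.
- by rewrite size_map size_rcons.
- by rewrite size_map.
- by rewrite -!map_take -cats1 take_size_cat // take_size.
- exact: sizes_bound.
rewrite (nth_map r) ?size_rcons // nth_rcons ltnn eqxx nth_default ?size_map //.
by rewrite ltnS max_card.
Qed.

Lemma card_B : #|B| + k = k * #|V|.
Proof.
have V0 : [set: V] != set0 by apply/set0Pn; exists r.
have eqin : inn B setT = B by apply/setP => e; rewrite in_inn /ein !in_setT !andbT.
have cl : forall Y, Y = [set: V] -> #|inn B Y| + k = k * #|Y|.
  move=> Y ->; rewrite eqin.
  have -> : #|B| = #|[set p : 'I_k * V | p.2 \notin [set r]]|.
    rewrite (arcs_im aB) card_in_imset // => [[j v] [j' v']].
    by rewrite !inE -!in_set1 /= => vr vr' /(arcs_inj aB vr vr')[-> ->].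
  have -> : [set p : 'I_k * V | p.2 \notin [set r]] = setX [set: 'I_k] (~: [set r]).
    by apply/setP => p; rewrite !inE.
  rewrite cardsX !cardsT card_ord cardsCs setCK cards1 mulnBr muln1 subnK //.
  by rewrite leq_pmulr // -cardsT card_gt0.
by have := cl _ erefl; rewrite eqin cardsT.
Qed.

(** Rebuild the trees outside X0. The exploration before b only uses arcs from X0,
    which do not change. *)
Lemma improve B2 F2 X0 b : sparse k B2 -> #|B2| + k = k * #|V| ->
  B2 :|: F2 = A -> [disjoint B2 & F2] -> sparse 1 F2 -> good F2 ->
  r \in X0 -> (forall j v, v \in X0 -> hd j v \in X0) ->
  (forall j v, v \in X0 -> v != r -> o j v \in B2) ->
  b < size ws -> covered F (take b ws) \subset X0 ->
  (forall w, w \in take b ws -> block F2 w = block F w) ->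
  #|block F2 (nth r ws b)| < #|block F (nth r ws b)| -> False.
Proof.
move=> spB2 cB2 U2 D2 sp2 g2 rX clX keep blt UX eqb lt.
have [||| o2 [hd2 [a2 agree]]] := @extend_arcs V E s t k h B2 X0 r o hd k_gt0 spB2 cB2 rX.
- move=> j v; rewrite in_setD1 => /andP[vr vX]; split; [exact: keep| |exact: clX].
  by apply: (arcs_joins aB); rewrite inE.
- move=> j v j' v'; rewrite !in_setD1 => /andP[vr _] /andP[vr' _].
  by apply: (arcs_inj aB); rewrite inE.
- move=> j C C0 CX; apply: (arcs_acyc aB) => //.
  rewrite disjoint_sym disjoints1; apply/negP => rC.
  by move: (subsetP CX r rC); rewrite !inE eqxx.
pose hd3 (j : 'I_k) v := if v == r then r else hd2 j v.
have st3 : state o2 hd3 B2 F2.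
  split=> //; last by move=> j; rewrite /hd3 eqxx.
  case: a2 => [a21 a22 a23 a24]; split=> //.
    by move=> j v vr; have := a21 j v vr; rewrite /hd3; move: vr; rewrite inE => /negbTE ->.
  move=> j C C0 dC; have [v vC hv] := a24 j C C0 dC; exists v => //.
  by rewrite /hd3; case: eqP => // vr; rewrite disjoint_sym disjoints1 -vr vC in dC.
apply: (lex_improve st3 blt eqb _ lt) => v i vU; rewrite /hd3.
case: eqP => [->|/eqP vr]; first by rewrite hdr.
have vX : v \in X0 :\ r by rewrite in_setD1 vr (subsetP UX).
by have [_ ->] := agree i v vX.
Qed.

Definition pos v := find (fun w => v \in block F w) ws.
Local Notation H := (covered F ws).

Lemma pos_lt v : (pos v < size ws) = (v \in H).
Proof. by rewrite -has_find inE. Qed.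

Lemma pos_block v : v \in H -> block F (nth r ws (pos v)) = block F v.
Proof.
rewrite inE => vH; apply/esym/block_eq => //.
exact: (nth_find r vH).
Qed.

Lemma pos_eq u v : u \in block F v -> pos u = pos v.
Proof.
move=> uv; apply: eq_find => w.
have e : block F u = block F v by apply: block_eq.
apply/idP/idP => hw.
  by rewrite -(block_eq spF hw) e block_self.
by rewrite -(block_eq spF hw) -e block_self.
Qed.

Lemma covered_take v j : v \in H -> (v \in covered F (take j ws)) = (pos v < j).
Proof. by rewrite !inE => vH; apply: has_take. Qed.

Lemma covered_takeH v j : v \in covered F (take j ws) -> v \in H.
Proof. by apply: (subsetP (covered_sub _ _)) => w; apply: mem_take. Qed.

Lemma blockH u v : v \in H -> u \in block F v -> u \in H.
Proof.
move=> /in_covered[w ww vb] uv; apply/in_covered; exists w => //.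
by rewrite -(block_eq spF vb).
Qed.

Lemma ws_H w : w \in ws -> w \in H.
Proof. by move=> ww; apply/in_covered; exists w; rewrite ?block_self. Qed.

Lemma pos_ws w : w \in ws -> pos w = index w ws.
Proof.
move=> ww; have wH := ws_H ww.
have lt : index w ws < size ws by rewrite index_mem.
apply/eqP; rewrite eqn_leq; apply/andP; split.
  rewrite leqNgt; apply/negP => lt'.
  have := before_find r lt'; rewrite nth_index // block_self //.
rewrite leqNgt -covered_take //.
by have [] := lg lt; rewrite nth_index.
Qed.

Lemma hd_H v i : v \in H -> hd i v \in H.
Proof. by move=> vH; apply: closed_end; right; right; exists i, v. Qed.

Lemma root_H : r \in H. Proof. by apply: closed_end; left. Qed.
Lemma end_H : q \in H. Proof. by apply: closed_end; right; left. Qed.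

(** * Parents, leaves and movable arcs *)

(** An arc (vertex and colour) by which w has been found. *)
Definition parent w : option (V * 'I_k) :=
  [pick p : V * 'I_k | [&& p.1 \in covered F (take (index w ws) ws), p.1 != r & hd p.2 p.1 == w]].
(** Choosing one parent for each explored vertex makes the arcs that are charged for
    different components different. *)
Definition parent_arc a i := (hd i a \in ws) && (parent (hd i a) == Some (a, i)).

Lemma parent_arcP a i : parent_arc a i -> [/\ hd i a \in ws, a \in H, a != r & pos a < pos (hd i a)].
Proof.
case/andP => ww; rewrite /parent; case: pickP => // p /and3P[aU ar /eqP hp] /eqP[Ep].
rewrite Ep /= in aU ar; split=> //; first exact: covered_takeH aU.
by rewrite [pos (hd i a)]pos_ws // -covered_take // (covered_takeH aU).
Qed.

Lemma parent_arc_inj a i a' i' : parent_arc a i -> parent_arc a' i' -> hd i a = hd i' a' -> a = a' /\ i = i'.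
Proof. by move=> /andP[_ /eqP p1] /andP[_ /eqP p2] e; move: p1; rewrite e p2 => -[-> ->]. Qed.

Lemma parent_some w : w \in ws -> w != r -> w != q -> exists a i, parent_arc a i /\ hd i a = w.
Proof.
move=> ww wr wq; have lt : index w ws < size ws by rewrite index_mem.
have [_ re] := lg lt; rewrite /= nth_index // in re.
have [i [x [xU hx]]] : exists i x, x \in covered F (take (index w ws) ws) /\ hd i x = w.
  by case: re => [e|[e|//]]; [rewrite e eqxx in wr|rewrite e eqxx in wq].
have xr : x != r by apply: contraNneq wr => xr; rewrite -hx xr hdr.
case Ep : (parent w) => [[a j]|].
  exists a, j; move: (Ep); rewrite /parent; case: pickP => // p /and3P[_ _ /eqP hp] [e].
  by rewrite e /= in hp; rewrite /parent_arc hp ww Ep eqxx.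
by move: Ep; rewrite /parent; case: pickP => // /(_ (x, i)); rewrite /= xU xr hx eqxx.
Qed.

Lemma ws_disj w w' : w \in ws -> w' \in ws -> w != w' -> [disjoint block F w & block F w'].
Proof.
move=> ww ww' ne; rewrite disjoint_sym; apply: block_disj => //; apply/negP => h1.
case/eqP: ne; have := pos_eq h1; rewrite !pos_ws //.
exact: index_inj.
Qed.

Definition inc e v := (s e == v) || (t e == v).
(** If x is a leaf of F, this is its pendant edge, whose other end is [leaf_end x];
    the value h stands for a missing edge. *)
Definition leaf_edge x := odflt h [pick e in F | inc e x].
Definition leaf_end x := if s (leaf_edge x) == x then t (leaf_edge x) else s (leaf_edge x).
Definition leaf x := [forall e in F, inc e x ==> (e == leaf_edge x)].

Lemma block1_edge x e : #|block F x| <= 1 -> e \in F -> ~~ inc e x.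
Proof.
move=> c1 eF; apply/negP => ie; have := forest_noloop spF eF.
have eb := edge_block x spF eF.
have xb := block_self x spF.
have both : (s e \in block F x) && (t e \in block F x).
  move: eb; case/orP: ie => /eqP ->; rewrite xb; first by move=> <-.
  by move=> ->.
case/andP: both => sb tb.
by move/card_le1_eqP: c1 => /(_ _ _ sb tb) ->; rewrite eqxx.
Qed.

Lemma leaf_edgeP x : 1 < #|block F x| -> leaf_edge x \in F /\ joins (leaf_edge x) x (leaf_end x).
Proof.
move=> c2; have tb := block_tight x spF; have xb := block_self x spF.
have [e [eF _ ex]] : exists e, [/\ e \in F, ein e (block F x) & cross e [set x]].
  apply: (tight_cross _ spF tb) => //; apply/set0Pn; first by exists x; rewrite inE xb set11.
  by apply/set0Pn; rewrite setD_eq0; apply: contraL c2 => /subset_leq_card; rewrite cards1 -leqNgt.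
have ie : inc e x.
  by move: ex; rewrite /cross /inc !inE; case: (s e == x); case: (t e == x).
rewrite /leaf_end /leaf_edge; case: pickP => [f /andP[fF fx] | /(_ e)]; last by rewrite eF ie.
split=> //=; move: fx; rewrite /inc /joins.
by case: (eqVneq (s f) x) => [_ _|_ /= ->]; rewrite !eqxx ?orbT.
Qed.

Lemma leafP x e : leaf x -> e \in F -> inc e x -> e = leaf_edge x.
Proof. by move=> /forallP/(_ e)/implyP h1 /h1/implyP h2 /h2/eqP. Qed.

Lemma joins_inc e x y : joins e x y -> inc e x && inc e y.
Proof. by rewrite /joins /inc => /orP[] /andP[-> ->]; rewrite ?orbT. Qed.

(** Two leaves with the same pendant edge form a component. *)
Lemma leaf_inj x x' : 2 < #|block F x| -> 2 < #|block F x'| -> leaf x -> leaf x' ->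
  leaf_edge x = leaf_edge x' -> x = x'.
Proof.
move=> c3 c3' lx lx' e; apply/eqP; apply: contraT => ne.
have [fF jf] := leaf_edgeP (ltnW c3); have [f'F jf'] := leaf_edgeP (ltnW c3').
have /andP[fx _] := joins_inc jf; have /andP[fx' _] := joins_inc jf'; rewrite -e in fx'.
have sub : block F x \subset [set x; x'].
  apply: closed_block => //; last by rewrite !inE eqxx.
  move=> g gIF; apply/negP => cg; have gf : g = leaf_edge x.
    have : inc g x || inc g x'.
      by move: cg; rewrite /cross /inc !inE; case: (s g == x); case: (s g == x'); case: (t g == x); case: (t g == x').
    by case/orP => ig; [apply: leafP|rewrite e; apply: leafP].
  move: cg; rewrite gf /cross !inE.
  case/orP: fx => /eqP ex; case/orP: fx' => /eqP ex'.
  - by rewrite -ex ex' eqxx in ne.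
  - by rewrite ex ex' !eqxx ?orbT.
  - by rewrite ex ex' !eqxx ?orbT.
  - by rewrite -ex ex' eqxx in ne.
by move: (subset_leq_card sub); rewrite cards2 ne leqNgt c3.
Qed.

(** The arcs that may be moved to F. With [arc1] and [arc2] the component attached
    to that of a has one or two vertices. With [relay_arc] the head x of the arc is
    a leaf of a component with d + 1 vertices and has itself an arc to an isolated
    vertex: after deleting the pendant edge of x, the vertex x and this isolated
    vertex are attached to a. The last condition makes the pendant edge a substitute
    for the arc of x. *)
Definition arc1 a i := parent_arc a i && (#|block F (hd i a)| == 1).
Definition arc2 a i := [&& parent_arc a i, #|block F (hd i a)| == 2 & k.+1 < d].
Definition relay_arc a i := let x := hd i a in
  [&& a != r, arc1 x i, leaf x, #|block F x| == d.+1, k.+1 < d & fconnect (hd i) (leaf_end x) a].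
Definition item a i := [|| arc1 a i, arc2 a i | relay_arc a i].
Definition weight a i := if arc1 a i then 1 else 2.
Definition gadget a i := if relay_arc a i then [set hd i a; hd i (hd i a)] else block F (hd i a).

Lemma arc1_parent a i : arc1 a i -> parent_arc a i. Proof. by case/andP. Qed.

Lemma relay_not_arc1 a i : relay_arc a i -> arc1 a i = false.
Proof.
case/and5P => _ _ _ /eqP c1 /andP[kd _]; rewrite /arc1 c1; apply/negbTE/negP => /andP[_ /eqP].
by clear -d_gt0; lia.
Qed.

Lemma item_parent a i : item a i -> ~~ relay_arc a i -> parent_arc a i.
Proof. by case/or3P => [/andP[]//|/and3P[]//|->]. Qed.

Lemma relay_arcP a i : relay_arc a i -> [/\ parent_arc (hd i a) i, #|block F (hd i (hd i a))| = 1,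
   leaf (hd i a), #|block F (hd i a)| = d.+1 & 2 < d].
Proof. by case/and5P => _ /andP[-> /eqP ->] -> /eqP -> /andP[kd _]; split=> //; clear -kd k_gt0; lia. Qed.

Lemma item_root a i : item a i -> a != r.
Proof. by case/or3P => [/andP[/parent_arcP[]]|/and3P[/parent_arcP[]]|/andP[]]. Qed.

Lemma acyc_hd i : acyclic_to [set r] (hd i).
Proof. exact: (arcs_acyc aB). Qed.

(** Both vertices lie on the path from the end of the pendant edge to x. *)
Lemma relay_uniq a a' i : relay_arc a i -> relay_arc a' i -> hd i a = hd i a' -> a = a'.
Proof.
case/and5P => ar _ _ _ /andP[_ za] /and5P[ar' _ _ _ /andP[_ za']] e.
rewrite -e in za'; have := fconnect_linear za za'.
have aux b b' : b != r -> b' != r -> hd i b = hd i b' -> fconnect (hd i) b b' -> b = b'.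
  move=> br br' eb bb; apply/eqP; apply: contraT => ne.
  have := acyclic_nocycle (acyc_hd i) (hdr i) br'.
  by rewrite -eb (fconnect_next bb ne).
by case/orP => [|h1]; [apply: aux|apply/esym; apply: aux].
Qed.

Lemma card_gadget a i : item a i -> #|gadget a i| <= weight a i.
Proof.
move=> it; rewrite /gadget /weight; case: ifP => [v|nv].
  by rewrite (relay_not_arc1 v) cards2; case: (_ != _).
case: ifP => [/andP[_ /eqP->]//|r1].
by move: it; rewrite /item r1 nv orbF /= => /and3P[_ /eqP ->].
Qed.

(** * Pivots *)

(** The first explored component that is not contained in the set of vertices unable
    to reach T. *)
Definition pivot (T : {set V}) b := [/\ b < size ws, covered F (take b ws) \subset unreach hd T,
  nth r ws b \in unreach hd T & ~~ (block F (nth r ws b) \subset unreach hd T)].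

Lemma pivot_exists (T : {set V}) j : r \notin T -> j < size ws ->
  ~~ (block F (nth r ws j) \subset unreach hd T) -> q \in unreach hd T ->
  exists2 b, b <= j & pivot T b.
Proof.
move=> rT jlt pj qX; set X := unreach hd T in qX pj *.
have rX : r \in X := unreach_root hdr rT.
have ex : exists j, ~~ (block F (nth r ws j) \subset X) by exists j.
case: (ex_minnP ex) => b nb minb; exists b; first exact: minb.
have blt : b < size ws by apply: leq_ltn_trans (minb _ pj) _.
have cX : covered F (take b ws) \subset X.
  apply/subsetP => v vb; have vH := covered_takeH vb.
  rewrite covered_take // in vb.
  have sub : block F (nth r ws (pos v)) \subset X.
    by apply: contraT => /minb; rewrite leqNgt vb.
  by apply: (subsetP sub); rewrite pos_block // block_self.
split=> //; have [_ [->//|[->//|[i [x [xU <-]]]]]] := lg blt.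
by apply: unreach_closed; apply: (subsetP cX).
Qed.

Lemma pos_nth b : b < size ws -> pos (nth r ws b) = b.
Proof. by move=> blt; rewrite pos_ws ?mem_nth // index_uniq. Qed.

(** The crossing edge f0 with which an exchange with tails T starts can be chosen
    outside of the component of q0. *)
Definition shallow (T : {set V}) q0 := exists f0 b, cross f0 (unreach hd T) /\
  (f0 = h \/ [/\ pivot T b, f0 \in F, ein f0 (block F (nth r ws b)) & b < pos q0]).
Definition deep (T : {set V}) q0 := q \in unreach hd T /\ pivot T (pos q0).

Lemma pivot_cross (T : {set V}) b : pivot T b ->
  exists f0, [/\ f0 \in F, ein f0 (block F (nth r ws b)) & cross f0 (unreach hd T)].
Proof.
case=> _ _ wX /subsetPn[v vb vX].
apply: (tight_cross _ spF (block_tight _ spF)) => //; apply/set0Pn.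
  by exists (nth r ws b); rewrite inE block_self.
by exists v; rewrite in_setD vX.
Qed.

Lemma cross_h (T : {set V}) : r \notin T -> q \notin unreach hd T -> cross h (unreach hd T).
Proof. by move=> rT qX; rewrite /cross (unreach_root hdr rT) (negbTE qX). Qed.

Lemma shallow_or_deep (T : {set V}) a q0 : r \notin T -> a \in T -> a \in block F q0 ->
  q0 \in H -> shallow T q0 \/ deep T q0.
Proof.
move=> rT aT aq q0H.
have [qX|qX] := boolP (q \in unreach hd T); last first.
  by left; exists h, 0; split; [exact: cross_h|left].
have [|||b] := @pivot_exists T (pos q0) rT => //; first by rewrite pos_lt.
  by apply/subsetPn; exists a; rewrite ?pos_block // unreach_tail.
rewrite leq_eqVlt => /orP[/eqP -> pv|lt pv]; first by right.
by left; have [f0 [f0F f0b f0X]] := pivot_cross pv; exists f0, b; split=> //; right.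
Qed.

(** More tails can only make the pivot occur earlier. *)
Lemma shallow_sub (T T' : {set V}) q0 q1 : T \subset T' -> r \notin T' ->
  q1 \in block F q0 -> shallow T q0 -> shallow T' q1.
Proof.
move=> TT rT' q1b [f0 [b [f0X cs]]].
have anti := unreach_anti hd TT.
have rT : r \notin T by apply: contra rT'; apply: (subsetP TT).
have [qX|qX] := boolP (q \in unreach hd T'); last first.
  by exists h, 0; split; [exact: cross_h|left].
case: cs => [e|[[blt _ _ nX] f0F f0b lt]].
  by move: f0X; rewrite e /cross (unreach_root hdr rT) (subsetP anti _ qX).
have nX' : ~~ (block F (nth r ws b) \subset unreach hd T').
  by apply: contra nX => sub; apply: subset_trans sub anti.
have [b' le pv'] := pivot_exists rT' blt nX' qX.
have [f1 [f1F f1b f1X]] := pivot_cross pv'; exists f1, b'; split=> //; right.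
by split=> //; rewrite (pos_eq q1b); apply: leq_ltn_trans le lt.
Qed.

(** * Exchanges *)

(** The arcs of colour i at the vertices of AS, which lie in one component of F, are
    moved to F; [noself] excludes that a relay is at the same time one of these
    vertices. *)
Section Exchange.
Variables (i : 'I_k) (AS : {set V}) (q0 : V).
Hypotheses (ASitem : forall a, a \in AS -> item a i)
  (ASq : AS \subset block F q0) (q0H : q0 \in H)
  (noself : forall a, a \in AS -> relay_arc a i -> hd i a \notin AS).

Definition relays := [set hd i a | a in [set a in AS | relay_arc a i]].
Local Notation Rd := relays.
Local Notation T := (tails AS Rd).
Local Notation X0 := (unreach hd T).

Lemma AS_root : r \notin AS.
Proof. by apply/negP => /ASitem/item_root; rewrite eqxx. Qed.

Lemma AS_H a : a \in AS -> a \in H.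
Proof. by move=> /(subsetP ASq); apply: blockH. Qed.

Lemma relayP x : x \in Rd -> exists2 a, a \in AS & relay_arc a i /\ x = hd i a.
Proof. by case/imsetP => a; rewrite inE => /andP[aA va] ->; exists a. Qed.

Lemma relay_ok x : x \in Rd -> [/\ x != r, x \notin AS, leaf_edge x \notin B,
   joins (leaf_edge x) x (leaf_end x) & exists a, [/\ a \in AS, hd i a = x & fconnect (hd i) (leaf_end x) a]].
Proof.
case/relayP => a aA [va ->]; have [rx _ _ c1 d2] := relay_arcP va.
have [|fF jf] := @leaf_edgeP (hd i a); first by rewrite c1 ltnS d_gt0.
have [_ _ xr _] := parent_arcP rx; split=> //; first exact: noself.
  by apply/negP => fB; have := disjointFr (st_disj st) fB; rewrite fF.
by exists a; split=> //; case/and5P: va => _ _ _ _ /andP[].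
Qed.

Lemma relay_edgeP x : x \in Rd -> leaf_edge x \in F /\ inc (leaf_edge x) x.
Proof.
case/relayP => a aA [va ->]; have [rx _ _ c1 d2] := relay_arcP va.
have [|fF jf] := @leaf_edgeP (hd i a); first by rewrite c1 ltnS d_gt0.
by split=> //; case/andP: (joins_inc jf).
Qed.

Lemma relay_inj : {in Rd &, injective leaf_edge}.
Proof.
move=> x x' /relayP[a _ [va ->]] /relayP[a' _ [va' ->]].
have [_ _ l c d2] := relay_arcP va; have [_ _ l' c' _] := relay_arcP va'.
by apply: leaf_inj; rewrite ?c ?c' // ltnW.
Qed.

Lemma relay_H x : x \in Rd -> x \in H.
Proof. by case/relayP => a aA [_ ->]; apply: hd_H; apply: AS_H. Qed.

Lemma T_H x : x \in T -> x \in H.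
Proof. by rewrite inE => /orP[/AS_H|/relay_H]. Qed.

Lemma T_root : r \notin T.
Proof. exact: (tails_root AS_root relay_ok). Qed.

Definition newedges a := if relay_arc a i then [set o i a; o i (hd i a)] else [set o i a].

Lemma moved_new : moved o i AS Rd = \bigcup_(a in AS) newedges a.
Proof.
apply/setP => e; apply/imsetP/bigcupP.
  case=> x; rewrite inE => /orP[xA|/relayP[a aA [va ->]]] ->.
    by exists x => //; rewrite /newedges; case: ifP; rewrite !inE eqxx.
  by exists a => //; rewrite /newedges va !inE eqxx orbT.
case=> a aA; rewrite /newedges; case: ifP => [va|_].
  rewrite in_set2 => /orP[] /eqP ->; first by exists a; rewrite // inE aA.
  exists (hd i a) => //; rewrite inE; apply/orP; right; apply/imsetP.
  by exists a; rewrite // inE aA va.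
by rewrite in_set1 => /eqP ->; exists a; rewrite // inE aA.
Qed.

Lemma joins_o j v : v != r -> joins (o j v) v (hd j v).
Proof. by move=> vr; apply: (arcs_joins aB); rewrite inE. Qed.

(** So no component before the pivot is affected: no tail lies in one, and relays
    are tails. *)
Lemma gadget_pos a x : a \in AS -> x \in gadget a i -> x \in H /\
  (relay_arc a i /\ x = hd i a \/ (exists2 y, y \in T & pos y < pos x)).
Proof.
move=> aA; have it := ASitem aA; rewrite /gadget; case: ifP => [va|/negbT nv].
  have [rx c1 _ _ _] := relay_arcP va; have [yw xH _ lt] := parent_arcP rx.
  rewrite in_set2 => /orP[] /eqP ->; first by split=> //; left.
  split; first exact: ws_H.
  right; exists (hd i a) => //; rewrite inE; apply/orP; right; apply/imsetP.
  by exists a; rewrite // inE aA va.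
have [yw aH _ lt] := parent_arcP (item_parent it nv) => xb; split; first by apply: blockH xb; apply: ws_H.
by right; exists a; [rewrite inE aA|rewrite (pos_eq xb)].
Qed.

Section Forest.
Variable K : {set E}.
Hypotheses (fkK : forall x, x \in Rd -> leaf_edge x \in K).
Let F1 := F :\: K.
Hypotheses (sep : forall a a', a \in AS -> a' \in AS -> a' \in block F1 a -> a = a')
  (small : forall a, a \in AS -> #|block F1 a| + weight a i <= d.+1).
(** The new forest when the edges of K are given up. *)
Definition newF := F1 :|: moved o i AS Rd.

Let spF1 : sparse 1 F1. Proof. exact: sparseD. Qed.
Let F1F e : e \in F1 -> e \in F. Proof. by rewrite in_setD => /andP[]. Qed.

Let blk1 v : block F1 v \subset block F v.
Proof. exact: block_mono (subsetDl F K) spF. Qed.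

Let relay_iso x : x \in Rd -> forall e, e \in F1 -> ~~ inc e x.
Proof.
move=> xR e eF; apply/negP => ie; case/relayP: (xR) => a aA [va ex].
have [_ _ l _ _] := relay_arcP va; rewrite -ex in l.
have ee := leafP l (F1F eF) ie.
by move: eF; rewrite ee in_setD fkK.
Qed.

Let head_iso a : a \in AS -> relay_arc a i -> forall e, e \in F1 -> ~~ inc e (hd i (hd i a)).
Proof.
move=> aA va e eF; have [_ c1 _ _ _] := relay_arcP va.
by apply: block1_edge (F1F eF); rewrite c1.
Qed.

Let iso_block F' x : sparse 1 F' -> (forall e, e \in F' -> ~~ inc e x) -> block F' x = [set x].
Proof.
move=> sp' ni; apply/eqP; rewrite eqEsubset sub1set block_self // andbT.
apply: closed_block => //; last by rewrite inE.
by move=> e /ni; rewrite /inc /cross !inE negb_or => /andP[/negbTE -> /negbTE ->].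
Qed.

Let D_ends a e : a \in AS -> e \in newedges a -> ein e (a |: gadget a i).
Proof.
move=> aA; have it := ASitem aA; have ar := item_root it.
have ja := joins_o i ar; rewrite /newedges /gadget; case: ifP => [va|nv].
  have [rx _ _ _ _] := relay_arcP va; have [_ _ xr _] := parent_arcP rx.
  rewrite in_set2 => /orP[] /eqP ->.
    by rewrite (joins_ein _ ja) !inE !eqxx !orbT.
  by rewrite (joins_ein _ (joins_o i xr)) !inE !eqxx !orbT.
by rewrite in_set1 => /eqP ->; rewrite (joins_ein _ ja) !inE eqxx block_self ?orbT.
Qed.

Let sizes_gad a : a \in AS -> ~~ relay_arc a i -> #|block F (hd i a)| <= 2.
Proof.
move=> /ASitem it nv; move: it; rewrite /item (negbTE nv) orbF.
by case/orP => [/andP[_ /eqP->]|/and3P[_ /eqP->]].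
Qed.

Let G_disj a a' : a \in AS -> a' \in AS -> a != a' -> [disjoint gadget a i & gadget a' i].
Proof.
have base b b' : b \in AS -> b' \in AS -> b != b' -> ~~ relay_arc b i ->
    [disjoint gadget b i & gadget b' i].
  move=> bA b'A ne nv; rewrite /gadget (negbTE nv).
  have rb := item_parent (ASitem bA) nv; have [bw _ _ _] := parent_arcP rb.
  case: ifP => [v'|/negbT nv'].
    have [rx c1 _ c2 d2] := relay_arcP v'; have [yw _ _ _] := parent_arcP rx.
    rewrite disjoint_sym -setI_eq0; apply: contraT => /set0Pn[x]; rewrite in_setI in_set2.
    case/andP => /orP[/eqP ->|/eqP ->] xb.
      have := sizes_gad bA nv; rewrite -(block_eq spF xb) c2 leqNgt => /negP[].
      by apply: ltnW.
    have [e|ne'] := eqVneq (hd i b) (hd i (hd i b')).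
      have [bx _] := parent_arc_inj rb rx e.
      by move: (noself b'A v'); rewrite -bx bA.
    by have := ws_disj bw yw ne' => /disjointFr/(_ xb); rewrite block_self.
  have rb' := item_parent (ASitem b'A) nv'; have [bw' _ _ _] := parent_arcP rb'.
  by apply: ws_disj => //; apply: contra ne => /eqP/(parent_arc_inj rb rb')[-> _].
move=> aA a'A ne; have [va|nv] := boolP (relay_arc a i); last exact: base.
have [va'|nv'] := boolP (relay_arc a' i); last by rewrite disjoint_sym base // eq_sym.
rewrite /gadget va va'; have [rx c1 _ c2 d2] := relay_arcP va; have [rx' c1' _ c2' _] := relay_arcP va'.
have nx : hd i a != hd i a' by apply: contra ne => /eqP/(relay_uniq va va')/eqP.
have ny : hd i (hd i a) != hd i (hd i a').
  by apply: contra nx => /eqP/(parent_arc_inj rx rx')[-> _].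
have nxy u v : #|block F u| = 1 -> #|block F v| = d.+1 -> u != v.
  by move=> cu cv; apply/eqP => e; move: cv; rewrite -e cu => -[e0]; have := d_gt0; rewrite -e0.
rewrite -setI_eq0; apply: contraT => /set0Pn[x]; rewrite in_setI !in_set2.
case/andP => /orP[/eqP->|/eqP->] /orP[/eqP e|/eqP e].
- by rewrite e eqxx in nx.
- by have := nxy _ _ c1' c2; rewrite e eqxx.
- by have := nxy _ _ c1 c2'; rewrite e eqxx.
- by rewrite e eqxx in ny.
Qed.

Let same_block a a' : a \in AS -> a' \in AS -> block F a = block F a'.
Proof. by move=> /(subsetP ASq) aq /(subsetP ASq) aq'; rewrite !(block_eq spF _ (x := q0)). Qed.

Let G_blk a a' : a \in AS -> a' \in AS -> [disjoint block F1 a' & gadget a i].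
Proof.
move=> aA a'A; rewrite /gadget; case: ifP => [va|/negbT nv].
  have xR : hd i a \in Rd by apply/imsetP; exists a; rewrite // inE aA va.
  rewrite disjoint_sym -setI_eq0; apply: contraT => /set0Pn[x]; rewrite in_setI in_set2.
  case/andP => /orP[/eqP->|/eqP->] xb.
    have ex := iso_block spF1 (relay_iso xR).
    have := block_self a' spF1; rewrite -(block_eq spF1 xb) ex inE => /eqP ea.
    by move: (noself aA va); rewrite -ea a'A.
  have [_ c1 _ _ _] := relay_arcP va.
  have aa : a \in block F (hd i (hd i a)).
    rewrite (block_eq spF (subsetP (blk1 a') _ xb)) -(same_block aA a'A).
    exact: block_self.
  have /card_le1_eqP : #|block F (hd i (hd i a))| <= 1 by rewrite c1.
  move/(_ _ _ aa (block_self _ spF)) => ea.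
  have := acyclic_nocycle (acyc_hd i) (hdr i) (item_root (ASitem aA)).
  by have := fconnect1 (hd i) (hd i a); rewrite ea => ->.
have [yw aH _ lt] := parent_arcP (item_parent (ASitem aA) nv).
apply: disjointWl (blk1 a') _; apply: block_disj => //; apply/negP => yb.
have ea : a \in block F a' by rewrite (same_block a'A aA) block_self.
by move: lt; rewrite (pos_eq yb) (pos_eq ea) ltnn.
Qed.

Let G_closed a e : a \in AS -> e \in F1 -> ~~ cross e (gadget a i).
Proof.
move=> aA eF; rewrite /gadget; case: ifP => [va|_]; last exact: block_edge (F1F eF).
have xR : hd i a \in Rd by apply/imsetP; exists a; rewrite // inE aA va.
have := relay_iso xR eF; have := head_iso aA va eF.
rewrite /inc /cross !in_set2 !negb_or.
by move=> /andP[/negbTE -> /negbTE ->] /andP[/negbTE -> /negbTE ->].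
Qed.

Let D_sparse a F' : a \in AS -> sparse 1 F' -> F1 \subset F' ->
  (forall e, e \in F' -> (s e \in gadget a i) || (t e \in gadget a i) -> e \in F1) ->
  [disjoint block F' a & gadget a i] -> sparse 1 (F' :|: newedges a).
Proof.
move=> aA sp' _ touch dj; have ar := item_root (ASitem aA).
have ja := joins_o i ar.
have ng : hd i a \notin block F' a.
  rewrite (disjointFl dj) // /gadget; case: ifP => _; first by rewrite !inE eqxx.
  exact: block_self.
have sp1' : sparse 1 (o i a |: F') := attach_edge sp' ja ng.
rewrite /newedges; case: ifP => [va|_]; last by rewrite setUC.
have [rx _ _ _ _] := relay_arcP va; have [_ _ xr _] := parent_arcP rx.
have jx := joins_o i xr.
have -> : F' :|: [set o i a; o i (hd i a)] = o i (hd i a) |: (o i a |: F').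
  by apply/setP => e; rewrite !inE orbC; case: (e == o i a); rewrite ?orbT.
rewrite joinsC in jx; apply: (attach_edge sp1' jx).
have gE : gadget a i = [set hd i a; hd i (hd i a)] by rewrite /gadget va.
have xy : hd i a != hd i (hd i a).
  apply/eqP => e; have := acyclic_nocycle (acyc_hd i) (hdr i) xr.
  by rewrite -e connect0.
have ay : a != hd i (hd i a).
  apply/eqP => e; have := acyclic_nocycle (acyc_hd i) (hdr i) ar.
  by have := fconnect1 (hd i) (hd i a); rewrite -e => ->.
rewrite (iso_block sp1') ?inE //.
move=> e; rewrite in_setU1 => /orP[/eqP ->|eF'].
  by case/orP: ja => /andP[/eqP sa /eqP ta]; rewrite /inc sa ta negb_or ?xy ?ay.
apply/negP => ie; have eF1 : e \in F1.
  by apply: touch eF' _; rewrite gE !in_set2; case/orP: ie => ->; rewrite ?orbT.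
by have := head_iso aA va eF1; rewrite ie.
Qed.

Let newF_attach : newF = attach F1 newedges AS.
Proof. by rewrite /newF /attach moved_new. Qed.

Lemma newF_sparse : sparse 1 newF.
Proof. rewrite newF_attach; exact: (attach_sparse spF1 D_ends G_disj G_blk sep D_sparse). Qed.

Lemma newF_out v : (forall a, a \in AS -> v \notin block F1 a :|: gadget a i) ->
  block newF v \subset block F1 v.
Proof. rewrite newF_attach; exact: (attach_out spF1 D_ends G_disj G_blk sep G_closed D_sparse). Qed.

Lemma newF_in a v : a \in AS -> v \in block F1 a :|: gadget a i ->
  block newF v \subset block F1 a :|: gadget a i.
Proof. rewrite newF_attach; exact: (attach_in spF1 D_ends G_disj G_blk sep G_closed D_sparse). Qed.

Lemma newF_good : good newF.
Proof.
move=> X tX; have /set0Pn[v vX] := tight_neq0 tX.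
apply: leq_trans (subset_leq_card (block_sub tX vX)) _.
have [/existsP[a /andP[aA va]]|/existsPn nv] :=
  boolP [exists a, (a \in AS) && (v \in block F1 a :|: gadget a i)].
  apply: leq_trans (subset_leq_card (newF_in aA va)) _.
  rewrite cardsU; apply: leq_trans (leq_subr _ _) _.
  by apply: leq_trans (small aA); rewrite leq_add2l card_gadget ?ASitem.
have /newF_out sub : forall a, a \in AS -> v \notin block F1 a :|: gadget a i.
  by move=> a aA; have := nv a; rewrite aA.
apply: leq_trans (subset_leq_card (subset_trans sub (blk1 v))) _.
by apply: gF; apply: block_tight.
Qed.

End Forest.

Let B0 := redir o B i AS Rd leaf_edge.

Lemma moved_B : moved o i AS Rd \subset B.
Proof.
apply/subsetP => e /imsetP[x xT ->]; apply: (arcs_mem aB); rewrite inE.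
by apply: contraTneq xT => ->; apply: T_root.
Qed.

Lemma card_redir : #|B0| + #|AS| = #|B|.
Proof.
have c1 : #|moved o i AS Rd| = #|AS| + #|Rd|.
  rewrite card_in_imset; last first.
    move=> x y xT yT; have nr z : z \in T -> z \notin [set r].
      by move=> zT; rewrite inE; apply: contraTneq zT => ->; apply: T_root.
    by move/(arcs_inj aB (nr _ xT) (nr _ yT)) => [].
  rewrite cardsU (_ : AS :&: Rd = set0) ?cards0 ?subn0 //.
  apply/setP => x; rewrite in_setI inE; apply/negP => /andP[xA /relay_ok[_]].
  by rewrite xA.
have c2 : #|[set leaf_edge x | x in Rd]| = #|Rd| by rewrite card_in_imset //; apply: relay_inj.
have c3 : #|B0| = #|B :\: moved o i AS Rd| + #|Rd|.
  rewrite cardsU c2 (_ : _ :&: _ = set0) ?cards0 ?subn0 //.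
  apply/setP => e; rewrite in_setI in_set0; apply/negP => /andP[eB /imsetP[x /relay_ok[_ _ xB _ _] ex]].
  by move: eB; rewrite ex in_setD (negbTE xB) andbF.
have := cardsID (moved o i AS Rd) B; rewrite (setIidPr moved_B) c1 c3.
by clear; lia.
Qed.

Lemma gadget_covered b a u : pivot T b -> a \in AS -> u \in a |: gadget a i ->
  u \notin covered F (take b ws).
Proof.
move=> [_ cX _ _] aA; have posT y : y \in T -> b <= pos y.
  move=> yT; rewrite leqNgt -covered_take ?T_H //; apply/negP => /(subsetP cX).
  by apply/negP; apply: unreach_tail.
have TX y : y \in T -> y \notin covered F (take b ws).
  by move=> yT; rewrite covered_take ?T_H // -leqNgt posT.
rewrite in_setU1 => /orP[/eqP ->|ug]; first by apply: TX; rewrite inE aA.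
have [uH [[va ->]|[y yT lt]]] := gadget_pos aA ug.
  by apply: TX; rewrite inE; apply/orP; right; apply/imsetP; exists a; rewrite // inE aA va.
by rewrite covered_take // -leqNgt; apply: leq_trans (posT y yT) (ltnW lt).
Qed.

(** Move the arcs of AS and of the relays to F, and f0, the pendant edges of the
    relays and C to B. If f0 is h this decomposes h |: A. Otherwise the component of
    the pivot has lost an edge and gained nothing, and the components before it are
    unchanged. *)
Lemma exchange f0 b (C : {set E}) :
  let K := f0 |: ([set leaf_edge x | x in Rd] :|: C) in
  let w := nth r ws b in
  cross f0 X0 -> C \subset F -> #|C|.+1 = #|AS| -> f0 \notin C ->
  (forall e, e \in C -> e \notin [set leaf_edge x | x in Rd] /\ s e \in block F q0) ->
  sparse k (C :|: (f0 |: B0)) ->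
  (forall a a', a \in AS -> a' \in AS -> a' \in block (F :\: K) a -> a = a') ->
  (forall a, a \in AS -> #|block (F :\: K) a| + weight a i <= d.+1) ->
  f0 = h \/ [/\ pivot T b, f0 \in F, ein f0 (block F w)
     & forall a, a \in AS -> w \notin block (F :\: K) a] -> False.
Proof.
move=> K w f0X CF cC f0C CP spC sep small cs.
have fkK x : x \in Rd -> leaf_edge x \in K.
  by move=> xR; rewrite !inE (imset_f leaf_edge xR) orbT.
pose F' := newF K; pose B' := C :|: (f0 |: B0).
have sp' : sparse 1 F' := newF_sparse fkK sep.
have good' : good F' := newF_good fkK sep small.
have f0A : f0 = h \/ f0 \in F by case: cs => [->|[]]; [left|right].
have FB e : e \in F -> e \notin B by move=> eF; rewrite (disjointFl (st_disj st) eF).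
have BA e : e \in B -> e \in A by move=> eB; rewrite -(st_union st) inE eB.
have FA e : e \in F -> e \in A by move=> eF; rewrite -(st_union st) inE eF orbT.
have hB : h \notin B by apply: contra hA; apply: BA.
have hF : h \notin F by apply: contra hA; apply: FA.
have f0B : f0 \notin B by case: f0A => [->//|/FB].
(* Both ends of the pendant edge of a relay can reach a tail. *)
have f0fk : f0 \notin [set leaf_edge x | x in Rd].
  apply/imsetP => -[x xR e]; case/relayP: (xR) => a aA [va ex].
  have [_ _ _ jx [a' [a'A _ za]]] := relay_ok xR.
  have xT : x \in T by rewrite inE xR orbT.
  have xX : x \notin X0 := unreach_tail hd xT.
  have zX : leaf_end x \notin X0.
    rewrite inE negbK; apply/existsP; exists a'; rewrite inE a'A /=.
    apply: connect_sub za => u v /eqP <-; apply: connect1.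
    by apply/existsP; exists i.
  move: f0X; rewrite e /cross; case/orP: jx => /andP[/eqP -> /eqP ->];
    by rewrite (negbTE xX) (negbTE zX).
have CB e : e \in C -> e \notin f0 |: B0.
  move=> eC; have eF := subsetP CF e eC; have [nfk _] := CP e eC.
  rewrite !in_setU1 negb_or in_setU in_setD negb_or (negbTE (FB _ eF)) andbF nfk /=.
  by rewrite andbT; apply: contraNneq f0C => <-.
have f0B0 : f0 \notin B0 by rewrite in_setU in_setD (negbTE f0B) andbF.
have cB' : #|B'| + k = k * #|V|.
  rewrite cardsU (_ : _ :&: _ = set0) ?cards0 ?subn0; last first.
    by apply/setP => e; rewrite in_setI in_set0; apply/negP => /andP[/CB/negP].
  rewrite cardsU1 f0B0 /= -card_B; have := card_redir; rewrite -cC.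
  by clear; lia.
have mB := subsetP moved_B.
have dB : [disjoint B' & F'].
  rewrite -setI_eq0; apply/eqP/setP => e; rewrite in_setI in_set0; apply/negP => /andP[].
  rewrite /B' /F' /newF in_setU => eB; rewrite in_setU in_setD => /orP[/andP[eK eF]|em].
    move: eK; rewrite !in_setU1 in_setU !negb_or => /and3P[e0 efk eC].
    move: eB; rewrite (negbTE eC) in_setU1 (negbTE e0) in_setU in_setD (negbTE efk).
    by rewrite (negbTE (FB _ eF)) andbF.
  have eB' := mB e em; have eF : e \notin F by apply: contraL eB'; apply: FB.
  case/orP: eB => [eC|]; first by rewrite (subsetP CF e eC) in eF.
  rewrite in_setU1 in_setU in_setD em /= => /orP[/eqP e0|/imsetP[x xR ex]].
    by rewrite -e0 eB' in f0B.
  by have [] := relay_edgeP xR; rewrite -ex (negbTE eF).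
have uB e : (e \in B' :|: F') = (e \in f0 |: A).
  apply/idP/idP.
    rewrite /B' /F' /newF in_setU => /orP[].
      rewrite in_setU => /orP[/(subsetP CF)/FA eA|]; first by rewrite in_setU1 eA orbT.
      rewrite !in_setU1 => /orP[->//|]; rewrite in_setU in_setD => /orP[/andP[_ /BA->]|].
        by rewrite orbT.
      by case/imsetP => x xR ->; have [/FA -> _] := relay_edgeP xR; rewrite orbT.
    rewrite in_setU in_setD in_setU1 => /orP[/andP[_ /FA ->]|/mB/BA ->]; exact: orbT.
  rewrite in_setU1 /B' /F' /newF /K !(in_setU, in_setD, in_set1).
  case: (e == f0) => /=; first by rewrite !orbT.
  rewrite -(st_union st) in_setU; case: (e \in C) => //=.
  by case: (e \in moved _ _ _ _); case: (e \in [set leaf_edge x | x in Rd]);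
    case: (e \in B); case: (e \in F).
case: cs => [f0h|[pv f0F f0w wb]].
  apply: failure; exists B', F'; split=> //.
  by apply/setP => e; rewrite uB f0h.
have UA : B' :|: F' = A.
  apply/setP => e; rewrite uB in_setU1; case: eqP => [->|//]; by rewrite FA.
have [blt cX wX nX] := pv.
have wH : w \in H by apply: ws_H; rewrite mem_nth.
have pw : pos w = b by rewrite pos_ws ?mem_nth // index_uniq.
(* Every edge that is given up has an end outside the components explored before
   b. *)
have cut_out e : e \in K -> s e \notin covered F (take b ws) \/ t e \notin covered F (take b ws).
  have hit u : u \notin X0 -> u \notin covered F (take b ws) by apply: contra; apply: (subsetP cX).
  rewrite in_setU1 in_setU => /or3P[/eqP ->|/imsetP[x xR ->]|eC].
  - left; have sH : s f0 \in H by apply: blockH wH _; case/andP: f0w.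
    by rewrite covered_take // -leqNgt -pw leq_eqVlt (pos_eq (v := w)) ?eqxx //; case/andP: f0w.
  - have xX : x \notin X0 by apply: unreach_tail; rewrite inE xR orbT.
    have [_ /orP[] /eqP ex] := relay_edgeP xR; [left|right]; rewrite ex; exact: hit.
  left; have [_ sq] := CP e eC; have /card_gt0P[a aA] : 0 < #|AS| by rewrite -cC.
  have aT : a \in T by rewrite inE aA.
  have := hit a (unreach_tail hd aT); rewrite covered_take ?T_H // (pos_eq (subsetP ASq a aA)).
  by rewrite -(pos_eq sq) -covered_take // (blockH q0H).
apply: (improve (B2 := B') (F2 := F') (X0 := X0) (b := b)) => //.
- exact: (unreach_root hdr T_root).
- by move=> j v; apply: unreach_closed.
- move=> j v vX vr; rewrite in_setU in_setU1.
  by have := redir_keeps aB AS_root relay_ok j vX vr; rewrite in_inn => /andP[-> _]; rewrite !orbT.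
- move=> u ub; have uw : u \in ws := mem_take ub.
  have uc x : x \in block F u -> x \in covered F (take b ws).
    by move=> xu; apply/in_covered; exists u.
  apply: block_kept => // [e eF ie|e].
    rewrite in_setU in_setD eF andbT.
    apply/orP; left; apply/negP => /cut_out; case/andP: ie => /uc -> /uc ->; by case.
  rewrite /F' /newF in_setU in_setD => /orP[/andP[_ ->]//|]; rewrite moved_new => /bigcupP[a aA ea] _.
  have /andP[sa ta] : ein e (a |: gadget a i).
    have ar := item_root (ASitem aA); have ja := joins_o i ar.
    move: ea; rewrite /newedges /gadget; case: ifP => [va|nv].
      have [rx _ _ _ _] := relay_arcP va; have [_ _ xr _] := parent_arcP rx.
      rewrite in_set2 => /orP[] /eqP ->; first by rewrite (joins_ein _ ja) !inE !eqxx !orbT.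
      by rewrite (joins_ein _ (joins_o i xr)) !inE !eqxx !orbT.
    by rewrite in_set1 => /eqP ->; rewrite (joins_ein _ ja) !inE eqxx block_self ?orbT.
  have nb x : x \in a |: gadget a i -> x \notin block F u.
    by move=> xg; apply: contra (gadget_covered pv aA xg); apply: uc.
  by rewrite /cross (negbTE (nb _ sa)) (negbTE (nb _ ta)).
have wg a : a \in AS -> w \notin block (F :\: K) a :|: gadget a i.
  move=> aA; rewrite in_setU negb_or wb //=; apply/negP => wg.
  have [_ [[va wa]|[y yT lt]]] := gadget_pos aA wg.
    have wT : w \in T by rewrite inE wa; apply/orP; right; apply/imsetP; exists a; rewrite // inE aA va.
    by move: (unreach_tail hd wT); rewrite wX.
  have yX := unreach_tail hd yT; move: lt; rewrite pw => lt.
  have : y \in covered F (take b ws) by rewrite covered_take ?T_H.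
  by move/(subsetP cX); apply/negP.
have spK : sparse 1 (F :\: K) by exact: sparseD.
apply: leq_ltn_trans (subset_leq_card (newF_out fkK sep wg)) _.
apply: proper_card; rewrite properEneq (block_mono w (subsetDl F K) spF) andbT.
apply/eqP => e; have tw := block_tight w spK; rewrite e in tw.
have tw' : tight 1 (F :\ f0) (block F w).
  apply: tight_sub tw; last exact: sparseD1.
  by apply: setDS; rewrite sub1set !inE eqxx.
by have := tight_setD1 f0F spF tw'; rewrite f0w.
Qed.

Variable f0 : E.
Definition cutF := F :\: (f0 |: [set leaf_edge x | x in Rd]).
Hypotheses (f0X : cross f0 X0).

Lemma cutF_sub : cutF \subset F. Proof. exact: subsetDl. Qed.
Lemma cutF_sparse : sparse 1 cutF. Proof. exact: sparse_sub cutF_sub spF. Qed.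

Lemma cutF_block v : block cutF v \subset block F v.
Proof. exact: block_mono cutF_sub spF. Qed.

Lemma F_notin_B e : e \in F -> e \notin B.
Proof. by move=> eF; rewrite (disjointFl (st_disj st) eF). Qed.

Lemma cutF_notin e : e \in cutF -> e \notin f0 |: B0.
Proof.
rewrite in_setD in_setU1 negb_or => /andP[/andP[e0 efk] eF].
by rewrite in_setU1 negb_or e0 in_setU in_setD (negbTE (F_notin_B eF)) andbF (negbTE efk).
Qed.

Lemma apart a1 : a1 \in AS -> AS \subset block cutF a1 -> #|AS| <= 3 ->
  exists C : {set E}, [/\ C \subset inn cutF (block cutF a1), #|C|.+1 = #|AS|,
    sparse k (C :|: (f0 |: B0)) & forall a a', a \in AS -> a' \in AS ->
      a' \in block (cutF :\: C) a -> a = a'].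
Proof.
move=> a1A ASb; have spC := cutF_sparse.
have sp0 := redir_cut aB hdr AS_root relay_ok relay_inj f0X.
have def := redir_deficit aB hdr AS_root relay_ok relay_inj f0X.
have tb C a : tight 1 (cutF :\: C) (block (cutF :\: C) a).
  by apply: block_tight; apply: sparse_sub spC; rewrite subsetDl.
have bs C a : a \in block (cutF :\: C) a.
  by apply: block_self; apply: sparse_sub spC; rewrite subsetDl.
have cA := cardsD1 a1 AS; rewrite a1A in cA; rewrite cA.
have inA a : a \in AS :\ a1 -> a \in AS /\ a1 != a.
  by rewrite in_setD1 eq_sym => /andP[].
case E1 : #|AS :\ a1| => [|[|[|//]]] _.
- exists set0; rewrite sub0set cards0 set0U; split=> // a a' aA a'A _.
  have only x : x \in AS -> x = a1.
    move=> xA; apply/eqP; apply: contraT => ne; have : x \in AS :\ a1 by rewrite in_setD1 ne.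
    by rewrite (cards0_eq E1) inE.
  by rewrite (only a) // (only a').
- have /cards1P[a2 A2] : #|AS :\ a1| == 1 by rewrite E1.
  have [a2A n12] : a2 \in AS /\ a1 != a2 by apply: inA; rewrite A2 inE.
  have AE x : x \in AS -> x = a1 \/ x = a2.
    move=> xA; have [->|ne] := eqVneq x a1; first by left.
    by right; apply/set1P; rewrite -A2 in_setD1 ne.
  have [f [fF fQ sp sep]] := @cut2 V E s t k _ AS cutF a1 sp0 spC def ASb a1 a2 a1A a2A n12.
  have sep' x y : x != y -> x \in AS -> y \in AS -> y \notin block (cutF :\: [set f]) x.
    move=> ne xA yA; apply/negP => yb.
    have := sep _ (tb [set f] x); case: (AE x xA) (AE y yA) ne yb (bs [set f] x) => -> [] ->;
      rewrite ?eqxx //= => _ h1 h2.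
      by move=> /(_ h2); rewrite h1.
    by move=> /(_ h1); rewrite h2.
  exists [set f]; split=> //.
  + by rewrite sub1set in_inn fF.
  + by rewrite cards1.
  move=> a a' aA a'A ab; apply/eqP; apply: contraT => ne.
  by have := sep' _ _ ne aA a'A; rewrite ab.
have /cards2P[a2 [a3 [n23 A2]]] : #|AS :\ a1| == 2 by rewrite E1.
have [a2A n12] : a2 \in AS /\ a1 != a2 by apply: inA; rewrite A2 !inE eqxx.
have [a3A n13] : a3 \in AS /\ a1 != a3 by apply: inA; rewrite A2 !inE eqxx orbT.
have AE x : x \in AS -> [\/ x = a1, x = a2 | x = a3].
  move=> xA; have [->|ne] := eqVneq x a1; first by apply: Or31.
  have : x \in AS :\ a1 by rewrite in_setD1 ne.
  by rewrite A2 in_set2 => /orP[] /eqP ->; [apply: Or32|apply: Or33].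
have [f [g [fI gI nfg sp sep]]] := @cut3 V E s t k _ AS cutF a1 sp0 spC def cutF_notin ASb a1 a2 a3
   a1A a2A a3A n12 n13 n23.
exists [set f; g]; split=> //.
- by rewrite subUset !sub1set fI gI.
- by rewrite cards2 nfg.
- by apply: sparse_sub sp; apply/subsetP => e; rewrite !inE -!orbA.
move=> a a' aA a'A ab; have /and3P[s12 s13 s23] := sep _ (tb [set f; g] a).
move: ab (bs [set f; g] a) s12 s13 s23.
by case: (AE a aA) (AE a' a'A) => -> [] -> // -> ->.
Qed.

(** The sizes only need to be checked for cuts that separate the vertices of AS. *)
Lemma exchange_apart b a1 : let w := nth r ws b in
  a1 \in AS -> AS \subset block cutF a1 -> #|AS| <= 3 ->
  f0 = h \/ [/\ pivot T b, f0 \in F, ein f0 (block F w) & w \notin block cutF a1] ->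
  (forall C : {set E}, C \subset cutF -> #|C|.+1 = #|AS| ->
    (forall a a', a \in AS -> a' \in AS -> a' \in block (cutF :\: C) a -> a = a') ->
    forall a, a \in AS -> #|block (cutF :\: C) a| + weight a i <= d.+1) -> False.
Proof.
move=> w a1A ASb c3 cs small.
have [C [CI cC spC sep]] := apart a1A ASb c3.
have Ccut : C \subset cutF by apply: subset_trans CI _; apply/subsetP => e; rewrite in_inn => /andP[].
have FE : cutF :\: C = F :\: (f0 |: ([set leaf_edge x | x in Rd] :|: C)).
  by rewrite /cutF setDDl setUA.
have sC a : block (cutF :\: C) a \subset block cutF a := block_mono a (subsetDl _ C) cutF_sparse.
apply: (@exchange f0 b C) => //.
- exact: subset_trans Ccut cutF_sub.
- by apply/negP => /(subsetP Ccut); rewrite !inE eqxx.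
- move=> e eC; have := subsetP CI e eC; rewrite in_inn => /andP[eF /andP[se _]].
  split; first by move: eF; rewrite in_setD in_setU1 negb_or => /andP[/andP[]].
  have := subsetP (cutF_block a1) _ se.
  by rewrite (block_eq spF (subsetP ASq _ a1A)).
- by rewrite -FE.
- by rewrite -FE; apply: small.
case: cs => [->|[pv f0F f0w nw]]; first by left.
right; split=> // a aA; rewrite -FE; apply: contra nw => /(subsetP (sC a)).
by rewrite (block_eq cutF_sparse (subsetP ASb a aA)).
Qed.

(** The component of a in a tree that has been cut apart misses the other vertices
    of AS. *)
Lemma sep_size C a1 a : a1 \in AS -> AS \subset block cutF a1 ->
  (forall a a', a \in AS -> a' \in AS -> a' \in block (cutF :\: C) a -> a = a') ->
  a \in AS -> #|block (cutF :\: C) a| + #|AS| <= #|block cutF a1| + 1.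
Proof.
move=> a1A ASb sep aA.
have spD : sparse 1 (cutF :\: C) := sparseD C cutF_sparse.
have sC : block (cutF :\: C) a \subset block cutF a1.
  rewrite -(block_eq cutF_sparse (subsetP ASb a aA)).
  exact: block_mono (subsetDl _ C) cutF_sparse.
rewrite (cardsD1 a AS) aA addnCA addnC leq_add2r.
have <- : #|block (cutF :\: C) a :|: (AS :\ a)| = #|block (cutF :\: C) a| + #|AS :\ a|.
  rewrite cardsU (_ : _ :&: _ = set0) ?cards0 ?subn0 //.
  apply/setP => x; rewrite in_setI in_set0 in_setD1; apply/negP => /and3P[xb xa xA].
  by move: xa; rewrite (sep a x aA xA xb) eqxx.
apply: subset_leq_card; rewrite subUset sC /=.
by apply: subset_trans ASb; apply: subD1set.
Qed.

Lemma exchange_size b a1 : let w := nth r ws b in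
  a1 \in AS -> AS \subset block cutF a1 -> #|AS| <= 3 ->
  f0 = h \/ [/\ pivot T b, f0 \in F, ein f0 (block F w) & w \notin block cutF a1] ->
  (forall a, a \in AS -> #|block cutF a1| + weight a i <= d + #|AS|) -> False.
Proof.
move=> w a1A ASb c3 cs small; apply: (exchange_apart a1A ASb c3 cs) => C _ _ sep a aA.
have := sep_size a1A ASb sep aA; have := small a aA.
by clear; lia.
Qed.

End Exchange.

(** * Excluded configurations *)

Definition exchangeable i (AS : {set V}) q0 := [/\ forall a, a \in AS -> item a i,
  AS \subset block F q0, q0 \in H & forall a, a \in AS -> relay_arc a i -> hd i a \notin AS].
Definition all_tails i (AS : {set V}) := tails AS (relays i AS).
Definition relay_edges i (AS : {set V}) := [set leaf_edge x | x in relays i AS].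

Lemma relays_sub i (AS AS' : {set V}) : AS \subset AS' -> relays i AS \subset relays i AS'.
Proof.
move=> sub; apply: imsetS; apply/subsetP => a; rewrite !inE => /andP[aA ->].
by rewrite (subsetP sub).
Qed.

Lemma all_tails_sub i (AS AS' : {set V}) : AS \subset AS' -> all_tails i AS \subset all_tails i AS'.
Proof. by move=> sub; apply: setUSS => //; apply: relays_sub. Qed.

Lemma all_tails_root i AS q0 : exchangeable i AS q0 -> r \notin all_tails i AS.
Proof. by case=> it sq qH ns; apply: (@T_root i AS it ns). Qed.

Lemma in_all_tails i (AS : {set V}) a : a \in AS -> a \in all_tails i AS.
Proof. by move=> aA; rewrite inE aA. Qed.

Lemma ein_block x v e : e \in F -> inc e x -> x \notin block F v -> ~~ ein e (block F v).
Proof.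
move=> eF ie; apply: contra => /andP[sb tb].
by case/orP: ie => /eqP <-.
Qed.

Lemma inc_block x v e : e \in F -> inc e x -> x \in block F v -> ein e (block F v).
Proof.
move=> eF ie xb; have := edge_block v spF eF; rewrite /ein.
case/orP: ie => /eqP ->; rewrite xb; first by move=> <-.
by move=> ->.
Qed.

Lemma relay_free_tight i AS q0 : exchangeable i AS q0 ->
  (forall x, x \in relays i AS -> x \notin block F q0) ->
  tight 1 (F :\: relay_edges i AS) (block F q0).
Proof.
move=> [it sq qH ns] nr; have tq := block_tight q0 spF.
have spD : sparse 1 (F :\: relay_edges i AS) by exact: sparseD.
apply: (tight_transfer spD tq) => e eF eq; rewrite in_setD eF andbT.
apply/imsetP => -[x xR ex]; have [fF ix] := relay_edgeP xR.
by have := ein_block fF ix (nr x xR); rewrite -ex eq.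
Qed.

(** Deleting the pendant edge of a leaf leaves the rest of the tree connected. *)
Lemma relay_one_tight i AS q0 x : exchangeable i AS q0 -> x \in relays i AS -> x \in block F q0 ->
  (forall y, y \in relays i AS -> y \in block F q0 -> y = x) ->
  tight 1 (F :\: relay_edges i AS) (block F q0 :\ x).
Proof.
move=> [it sq qH ns] xR xq uni; have tq := block_tight q0 spF.
have [a aA [va ex]] := relayP xR; have [_ _ lx cx d2] := relay_arcP va; rewrite -ex in lx cx.
have spD : sparse 1 (F :\: relay_edges i AS) by exact: sparseD.
have cQ : #|block F q0| = d.+1 by rewrite -cx (block_eq spF xq).
have cq : d.+1 = #|block F q0 :\ x|.+1 by rewrite -cQ (cardsD1 x (block F q0)) xq.
have [fF ix] := relay_edgeP xR.
apply: (tightP spD); first by rewrite -card_gt0; case: cq => <-.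
rewrite mul1n.
have : #|inn F (block F q0) :\ leaf_edge x| <= #|inn (F :\: relay_edges i AS) (block F q0 :\ x)|.
  apply/subset_leq_card/subsetP => e; rewrite in_setD1 !in_inn in_setD => /and3P[efx eF eq].
  have nx : ~~ inc e x by apply: contra efx => ie; rewrite (leafP lx eF ie).
  have -> : e \notin relay_edges i AS.
    apply/imsetP => -[y yR ey]; have [fyF iy] := relay_edgeP yR.
    have yq : y \in block F q0.
      by apply: contraT => nyq; have := ein_block fyF iy nyq; rewrite -ey eq.
    by rewrite ey (uni y yR yq) eqxx in efx.
  rewrite eF /=; move: nx eq; rewrite /inc /ein !in_setD1 negb_or.
  by move=> /andP[-> ->] /andP[-> ->].
have := cardsD1 (leaf_edge x) (inn F (block F q0)); rewrite in_inn fF (inc_block fF ix xq).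
have := tightE tq; rewrite mul1n cQ; have := cq.
by clear; lia.
Qed.

Lemma shallow_exchange i AS q0 (Y : {set V}) a1 : exchangeable i AS q0 -> shallow (all_tails i AS) q0 ->
  AS \subset Y -> Y \subset block F q0 -> tight 1 (F :\: relay_edges i AS) Y -> a1 \in AS ->
  exists f0 b, [/\ cross f0 (unreach hd (all_tails i AS)),
     AS \subset block (cutF i AS f0) a1,
     f0 = h \/ [/\ pivot (all_tails i AS) b, f0 \in F, ein f0 (block F (nth r ws b))
        & nth r ws b \notin block (cutF i AS f0) a1]
     & forall e, e \in F -> ein e (block F q0) -> e != f0].
Proof.
move=> ok [f0 [b [f0X cs]]] AY YQ tY a1A; have [it sq qH ns] := ok; exists f0, b.
have hF : h \notin F by apply: contra hA => hF; rewrite -(st_union st) inE hF orbT.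
have nq : f0 = h \/ nth r ws b \notin block F q0.
  case: cs => [->|[[blt _ _ _] _ _ lt]]; first by left.
  right; apply/negP => wq.
  by move: lt; rewrite -(pos_eq wq) pos_nth // ltnn.
have ne e : e \in F -> ein e (block F q0) -> e != f0.
  move=> eF eq; apply/eqP => ef; case: cs => [f0h|[_ _ f0w _]].
    by rewrite -f0h -ef eF in hF.
  case: nq => [f0h|/negP[]]; first by rewrite -f0h -ef eF in hF.
  case/andP: f0w => sw _; case/andP: eq => sq0 _; rewrite ef in sq0.
  by rewrite -(block_eq spF sq0) (block_eq spF sw) block_self.
have spC := cutF_sparse i AS f0.
split=> //.
  have tYc : tight 1 (cutF i AS f0) Y.
    apply: (tight_transfer spC tY) => e eF eY.
    move: eF; rewrite !in_setD in_setU1 negb_or => /andP[-> eF]; rewrite eF !andbT.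
    by apply: ne => //; case/andP: eY => ? ?; rewrite /ein !(subsetP YQ).
  apply: (subset_trans AY); apply: block_sub => //; exact: (subsetP AY).
case: cs => [->|[pv f0F f0w lt]]; first by left.
right; split=> //; case: nq => [f0h|nq]; first by rewrite -f0h f0F in hF.
apply: contra nq => /(subsetP (cutF_block i AS f0 a1)).
by rewrite (block_eq spF (subsetP sq _ a1A)).
Qed.

Lemma no_shallow i AS q0 (Y : {set V}) a1 N : exchangeable i AS q0 -> shallow (all_tails i AS) q0 ->
  AS \subset Y -> Y \subset block F q0 -> tight 1 (F :\: relay_edges i AS) Y -> a1 \in AS ->
  #|AS| <= 3 -> (forall f0, #|block (cutF i AS f0) a1| <= N) ->
  (forall a, a \in AS -> N + weight a i <= d + #|AS|) -> False.
Proof.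
move=> ok sh AY YQ tY a1A c3 bN sz; have [it sq qH ns] := ok.
have [f0 [b [f0X ASb cs _]]] := shallow_exchange ok sh AY YQ tY a1A.
apply: (exchange_size it sq qH ns f0X a1A ASb c3 cs) => a aA.
by apply: leq_trans (sz a aA); rewrite leq_add2r.
Qed.

Lemma block_bound i AS q0 f0 a1 : exchangeable i AS q0 -> a1 \in AS ->
  #|block (cutF i AS f0) a1| <= #|block F q0|.
Proof.
move=> [_ sq _ _] a1A; rewrite -(block_eq spF (subsetP sq _ a1A)).
by rewrite subset_leq_card // cutF_block.
Qed.

Lemma good_block v : #|block F v| <= d.+1.
Proof. by apply: gF; apply: block_tight. Qed.

(** With the pivot elsewhere, the component of q0 has to be shared among the
    vertices of AS; the bound says that there is room for all attached pieces. *)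
Lemma no_shallow_free i AS q0 a1 : exchangeable i AS q0 -> shallow (all_tails i AS) q0 ->
  (forall x, x \in relays i AS -> x \notin block F q0) -> a1 \in AS -> #|AS| <= 3 ->
  (forall a, a \in AS -> #|block F q0| + weight a i <= d + #|AS|) -> False.
Proof.
move=> ok sh nr a1A c3 sz; have [_ sq _ _] := ok.
apply: (no_shallow ok sh sq (subxx _) (relay_free_tight ok nr) a1A c3 _ sz) => f0.
exact: block_bound.
Qed.

Lemma weight_le2 a i : 0 < weight a i <= 2. Proof. by rewrite /weight; case: ifP. Qed.

Lemma hd_neq i a : a != r -> hd i a != a.
Proof.
move=> ar; apply/eqP => e; have := acyclic_nocycle (acyc_hd i) (hdr i) ar.
by rewrite e connect0.
Qed.

Lemma exchangeable1 a i : item a i -> a \in H -> exchangeable i [set a] a.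
Proof.
move=> it aH; split=> [x|||x].
- by rewrite inE => /eqP ->.
- by rewrite sub1set block_self.
- by [].
- by rewrite inE => /eqP -> va; rewrite inE hd_neq // (item_root it).
Qed.

(** Here the pivot is the component of a itself. An edge on the path from the first
    explored vertex w of this component to a joins a vertex that can reach the tails
    to one that cannot; the exchange with it makes the component of w smaller, so it
    must fail because the component of a becomes too large. *)
Lemma deep_single a i : item a i -> a \in H -> deep (all_tails i [set a]) a ->
  exists f0, [/\ f0 \in F, ein f0 (block F a), cross f0 (unreach hd (all_tails i [set a])),
    nth r ws (pos a) \notin block (cutF i [set a] f0) a &
    d.+1 < #|block (cutF i [set a] f0) a| + weight a i].
Proof.
move=> it aH [qX pv]; have ok := exchangeable1 it aH; have [its sq _ ns] := ok.
have [plt _ wX _] := pv; set w := nth r ws (pos a) in wX *.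
have aX : a \notin unreach hd (all_tails i [set a]) by apply: unreach_tail; apply: in_all_tails; rewrite inE.
have bw : block F w = block F a := pos_block aH.
have aw : a \in block F w by rewrite bw block_self.
have [f0 [f0F f0w f0X sep]] := path_cross spF (block_tight w spF) (block_self w spF) aw wX aX.
have spC := cutF_sparse i [set a] f0.
have wn : w \notin block (cutF i [set a] f0) a.
  apply/negP => wb; have tb : tight 1 (F :\ f0) (block (cutF i [set a] f0) a).
    apply: tight_sub (block_tight a spC); last exact: sparseD1.
    by apply: setDS; rewrite sub1set !inE eqxx.
  by have := sep _ tb wb; rewrite block_self.
exists f0; split=> //; first by rewrite -bw.
rewrite ltnNge; apply/negP => le.
have aA : a \in [set a] by rewrite inE.
apply: (@exchange_size i [set a] a its sq aH ns f0 f0X (pos a) a aA) => //.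
- by rewrite sub1set block_self.
- by rewrite cards1.
- by right; split.
by move=> x; rewrite inE => /eqP ->; rewrite cards1 addn1.
Qed.

Lemma relays_arc1 a i : arc1 a i -> relays i [set a] = set0.
Proof.
move=> r1; apply/setP => x; rewrite inE; apply/imsetP => -[y].
rewrite !inE => /andP[/eqP -> va] _.
by rewrite relay_not_arc1 in r1.
Qed.

Lemma arc1_item a i : arc1 a i -> item a i. Proof. by rewrite /item => ->. Qed.
Lemma arc1_H a i : arc1 a i -> a \in H. Proof. by move=> /arc1_parent/parent_arcP[]. Qed.

Lemma cutF_bound i AS f0 a w : w \in block F a -> w \notin block (cutF i AS f0) a ->
  #|block (cutF i AS f0) a| < #|block F a|.
Proof.
move=> wa wn; apply: proper_card; apply/properP; split; first exact: cutF_block.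
by exists w.
Qed.

(** If the pivot were the component of a, cutting it between w and a would make room
    for the isolated vertex; the same holds if the component has at most d
    vertices. *)
Lemma arc1_shallow a i : arc1 a i -> #|block F a| = d.+1 /\ shallow (all_tails i [set a]) a.
Proof.
move=> r1; have it := arc1_item r1; have aH := arc1_H r1; have ok := exchangeable1 it aH.
have aA : a \in [set a] by rewrite inE.
have sh : shallow (all_tails i [set a]) a.
  case: (shallow_or_deep (all_tails_root ok) (in_all_tails i aA) (block_self a spF) aH) => // dp.
  have [f0 [_ _ _ wn]] := deep_single it aH dp.
  have wa : nth r ws (pos a) \in block F a by rewrite -(pos_block aH) block_self.
  have := cutF_bound wa wn; have := good_block a; rewrite /weight r1.
  by clear; lia.
split=> //; apply/eqP; rewrite eqn_leq good_block ltnNge; apply/negP => le.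
apply: (no_shallow_free ok sh _ aA); rewrite ?cards1 //.
  by move=> x; rewrite relays_arc1 // inE.
by move=> x; rewrite inE => /eqP ->; rewrite /weight r1 leq_add2r.
Qed.

Lemma exchangeable_items i (AS : {set V}) q0 : (forall a, a \in AS -> item a i) ->
  AS \subset block F q0 -> q0 \in H ->
  (forall a, a \in AS -> relay_arc a i -> hd i a \in AS -> False) -> exchangeable i AS q0.
Proof. by move=> it sq qH ns; split=> // a aA va; apply/negP; apply: ns. Qed.

Lemma relay_head_arc1 a i : relay_arc a i -> arc1 (hd i a) i.
Proof. by case/and5P. Qed.

Lemma relay_arc1 i (AS : {set V}) x : x \in relays i AS -> [/\ arc1 x i, leaf x & #|block F x| = d.+1].
Proof.
by case/relayP => a aA [va ->]; have [_ _ l c _] := relay_arcP va; split=> //; apply: relay_head_arc1.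
Qed.

Lemma shallow_mem i AS q0 x : exchangeable i AS q0 -> arc1 x i -> x \in all_tails i AS -> x \in block F q0 ->
  shallow (all_tails i AS) q0.
Proof.
move=> ok r1 xT xq; have [_ sh] := arc1_shallow r1.
apply: shallow_sub sh; [|exact: all_tails_root ok|by rewrite (block_eq spF xq) block_self].
by rewrite /all_tails /tails relays_arc1 // setU0 sub1set.
Qed.

Lemma shallow_ext i AS q0 a : exchangeable i AS q0 -> a \in AS -> shallow (all_tails i [set a]) a ->
  shallow (all_tails i AS) q0.
Proof.
move=> ok aA sh; have [_ sq _ _] := ok.
apply: shallow_sub sh; [by rewrite all_tails_sub // sub1set|exact: all_tails_root ok|].
by rewrite (block_eq spF (subsetP sq _ aA)) block_self.
Qed.

(** The two isolated vertices fit into the two parts of a component with d + 1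
    vertices, each part having at most d vertices. *)
Lemma arc1_uniq a1 a2 i : arc1 a1 i -> arc1 a2 i -> a2 \in block F a1 -> a1 = a2.
Proof.
move=> r1 r2 ab; apply/eqP; apply: contraT => ne.
have r12 x : x \in [set a1; a2] -> arc1 x i by rewrite in_set2 => /orP[] /eqP ->.
have ok : exchangeable i [set a1; a2] a1.
  apply: exchangeable_items => [x /r12/arc1_item//|||x /r12 rx va]; last by rewrite (relay_not_arc1 va) in rx.
    by rewrite subUset !sub1set block_self.
  exact: arc1_H r1.
have sh : shallow (all_tails i [set a1; a2]) a1.
  by apply: (shallow_ext ok (a := a1)); [rewrite set21|case: (arc1_shallow r1)].
have nr x : x \in relays i [set a1; a2] -> x \notin block F a1.
  by case/relayP => a /r12 ra [va _]; rewrite relay_not_arc1 in ra.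
have [c1 _] := arc1_shallow r1.
apply: False_ind; apply: (no_shallow_free ok sh nr (a1 := a1)); rewrite ?set21 ?cards2 ?ne //.
by move=> a /r12 ra; rewrite c1 /weight ra; clear; lia.
Qed.

(** The arcs whose attached piece has two vertices. *)
Definition heavy a i := item a i && ~~ arc1 a i.

Lemma heavyP a i : heavy a i -> [/\ item a i, weight a i = 2 & k.+1 < d].
Proof.
case/andP => it n1; rewrite /weight (negbTE n1); split=> //.
by move: it; rewrite /item (negbTE n1) /= => /orP[/and3P[]//|/and5P[_ _ _ _ /andP[]]].
Qed.

Lemma relay_out i AS q0 x : #|block F q0| != d.+1 -> x \in relays i AS -> x \notin block F q0.
Proof.
move=> cq /relay_arc1[_ _ cx]; apply: contra cq => xq.
by rewrite -(block_eq spF xq) cx.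
Qed.

Lemma block_top a : a \in H -> nth r ws (pos a) \in block F a.
Proof. by move=> aH; rewrite -(pos_block aH) block_self. Qed.

Lemma heavy_ge a i : heavy a i -> a \in H -> d <= #|block F a|.
Proof.
move=> w2a aH; have [it ew kd] := heavyP w2a; have ok := exchangeable1 it aH.
have aA : a \in [set a] by rewrite inE.
rewrite leqNgt; apply/negP => lt.
case: (shallow_or_deep (all_tails_root ok) (in_all_tails i aA) (block_self a spF) aH) => [sh|dp].
  apply: (no_shallow_free ok sh _ aA); rewrite ?cards1 //.
    by move=> x; apply: relay_out; apply: contraTneq lt => ->; rewrite -leqNgt ltnW.
  by move=> x; rewrite inE => /eqP ->; rewrite ew; clear -lt; lia.
have [f0 [_ _ _ wn]] := deep_single it aH dp.
have := cutF_bound (block_top aH) wn; rewrite ew.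
by clear -lt; lia.
Qed.

Lemma heavy_shallow a i : heavy a i -> a \in H -> #|block F a| = d -> shallow (all_tails i [set a]) a.
Proof.
move=> w2a aH c; have [it ew kd] := heavyP w2a; have ok := exchangeable1 it aH.
have aA : a \in [set a] by rewrite inE.
case: (shallow_or_deep (all_tails_root ok) (in_all_tails i aA) (block_self a spF) aH) => // dp.
have [f0 [_ _ _ wn]] := deep_single it aH dp.
have := cutF_bound (block_top aH) wn; rewrite ew c.
by clear; lia.
Qed.

Lemma exchangeable_heavy i (AS : {set V}) q0 : (forall a, a \in AS -> heavy a i) -> AS \subset block F q0 ->
  q0 \in H -> exchangeable i AS q0.
Proof.
move=> all2 sq qH; apply: exchangeable_items => // [a /all2/heavyP[]//|a aA va xA].
by have /andP[_] := all2 _ xA; rewrite relay_head_arc1.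
Qed.

Lemma heavy_pair_d a1 a2 i : heavy a1 i -> heavy a2 i -> a1 \in H -> a2 \in block F a1 ->
  #|block F a1| = d -> a1 = a2.
Proof.
move=> h1 h2 aH ab c; apply/eqP; apply: contraT => ne.
have h12 x : x \in [set a1; a2] -> heavy x i by rewrite in_set2 => /orP[] /eqP ->.
have ok : exchangeable i [set a1; a2] a1.
  by apply: exchangeable_heavy => //; rewrite subUset !sub1set block_self.
have sh : shallow (all_tails i [set a1; a2]) a1.
  by apply: (shallow_ext ok (a := a1)); [rewrite set21|apply: heavy_shallow].
apply: False_ind; apply: (no_shallow_free ok sh _ (a1 := a1)); rewrite ?set21 ?cards2 ?ne //.
  by move=> x; apply: relay_out; rewrite c; clear; lia.
by move=> a /h12/heavyP[_ -> _]; rewrite c.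
Qed.

(** Suppose that the pivot is their own component Q. By [deep_single] some crossing
    edge f0 cuts off w from a1 although no two vertices more fit in afterwards, so
    f0 cuts off w alone. After this cut the d remaining vertices of Q can be shared
    by a1 and a2. *)
Lemma heavy_pair_shallow a1 a2 i : heavy a1 i -> heavy a2 i -> a1 \in H -> a2 \in block F a1 ->
  a1 != a2 -> shallow (all_tails i [set a1; a2]) a1.
Proof.
move=> h1 h2 aH ab ne; set AS := [set a1; a2].
have h12 x : x \in AS -> heavy x i by rewrite in_set2 => /orP[] /eqP ->.
have a1A : a1 \in AS by rewrite set21.
have a2A : a2 \in AS by rewrite set22.
have ok : exchangeable i AS a1 by apply: exchangeable_heavy => //; rewrite subUset !sub1set block_self.
have [ai sq _ ns] := ok.
have [/existsP[x /andP[xR xq]]|/existsPn nr] :=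
    boolP [exists x, (x \in relays i AS) && (x \in block F a1)].
  have [r1 _ _] := relay_arc1 xR; apply: (shallow_mem ok r1) => //.
  by rewrite inE xR orbT.
have {}nr x : x \in relays i AS -> x \notin block F a1.
  by move=> xR; have := nr x; rewrite xR.
case: (shallow_or_deep (all_tails_root ok) (in_all_tails i a1A) (block_self a1 spF) aH) => // -[qX pv].
have [it1 e1 _] := heavyP h1; have ok1 := exchangeable1 it1 aH.
have a1S : a1 \in [set a1] by rewrite inE.
case: (shallow_or_deep (all_tails_root ok1) (in_all_tails i a1S) (block_self a1 spF) aH) => [|dp].
  exact: shallow_ext.
apply: False_ind.
have [f0 [f0F f0q f0X wn]] := deep_single it1 aH dp; rewrite e1 => big.
set blk1 := block _ a1 in wn big; set w := nth r ws (pos a1) in wn.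
have [_ _ wX1 _] := dp.2; have [_ _ wX _] := pv; rewrite -/w in wX wX1.
have wq : w \in block F a1 := block_top aH.
have sub1 : blk1 \subset block F a1 :\ w.
  apply/subsetP => x xb; rewrite in_setD1 (subsetP (cutF_block i [set a1] f0 a1) _ xb) andbT.
  by apply: contraNneq wn => <-.
have cQ := good_block a1; have cw := cardsD1 w (block F a1); rewrite wq in cw.
have eqb : blk1 = block F a1 :\ w.
  by apply/eqP; rewrite eqEcard sub1; clear -cQ cw big; lia.
have sp1 := cutF_sparse i [set a1] f0; have tb1 : tight 1 (cutF i [set a1] f0) blk1 := block_tight a1 sp1.
have anti : unreach hd (all_tails i AS) \subset unreach hd (all_tails i [set a1]).
  by apply: unreach_anti; apply: all_tails_sub; rewrite sub1set.
(* The part of a1 is everything but w, so f0 joins w to a vertex that can reach a1;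
   hence f0 crosses the smaller set as well. *)
have f0X' : cross f0 (unreach hd (all_tails i AS)).
  have nin : ~~ ein f0 blk1.
    have tb' : tight 1 (F :\ f0) blk1.
      apply: tight_sub tb1; last exact: sparseD1.
      by apply: setDS; rewrite sub1set !inE eqxx.
    exact: tight_setD1 tb'.
  move: nin f0X f0q; rewrite eqb /ein /cross !in_setD1 => nin cr /andP[sq' tq'].
  move: nin; rewrite sq' tq' !andbT negb_and !negbK.
  case/orP => /eqP ee; move: cr; rewrite ee wX wX1; last by rewrite eq_sym; case X: (_ \in _) => //; rewrite (contraFF (subsetP anti _) X).
  by case X: (_ \in _) => //; rewrite (contraFF (subsetP anti _) X).
have spA := cutF_sparse i AS f0.
have tA : tight 1 (cutF i AS f0) blk1.
  apply: (tight_transfer spA tb1) => e eF eb.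
  move: eF; rewrite !in_setD !in_setU1 !negb_or => /andP[/andP[-> _] eF]; rewrite eF andbT /=.
  apply/imsetP => -[x xR ex]; have [fxF ix] := relay_edgeP xR.
  have := ein_block fxF ix (nr x xR); rewrite -ex; case/andP: eb => sb tb.
  case/negP; move: (subsetP sub1 _ sb) (subsetP sub1 _ tb).
  by rewrite !in_setD1 /ein => /andP[_ ->] /andP[_ ->].
have bsub : block (cutF i AS f0) a1 \subset blk1.
  apply: block_mono => //.
  by apply: setDS; apply: setUS; apply: imsetS; apply: relays_sub; rewrite sub1set.
have ASb : AS \subset block (cutF i AS f0) a1.
  have a1b : a1 \in blk1 by apply: block_self.
  have sb := block_sub tA a1b.
  rewrite subUset !sub1set block_self //=; apply: (subsetP sb).
  rewrite eqb in_setD1 ab andbT; apply: contraTneq wX => <-.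
  by apply: unreach_tail; apply: in_all_tails.
apply: (exchange_size ai sq aH ns f0X' a1A ASb (b := pos a1)).
- by rewrite cards2 ne.
- right; split=> //; first by rewrite (pos_block aH).
  by apply: contra wn; apply: (subsetP bsub).
move=> a /h12/heavyP[_ -> _]; rewrite cards2 ne.
have := subset_leq_card bsub; have := subset_leq_card sub1; clear -cw cQ; lia.
Qed.

(** The part of a1 has at least two vertices after one cut since a1 is not a leaf;
    so the part of a2 has at most d - 1 vertices, and two more fit in. *)
Lemma arc1_nonleaf a1 a2 i : arc1 a1 i -> ~~ leaf a1 -> heavy a2 i -> a2 \in block F a1 -> False.
Proof.
move=> r1 nl h2 ab; have [c1 sh1] := arc1_shallow r1; have aH := arc1_H r1.
have [it2 e2 kd] := heavyP h2.
have ne : a1 != a2 by apply: contraTneq h2 => <-; rewrite /heavy r1 andbF.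
set AS := [set a1; a2]; have a1A : a1 \in AS by rewrite set21.
have sq : AS \subset block F a1 by rewrite subUset !sub1set block_self.
have leaf1 x : arc1 x i -> leaf x -> x \notin block F a1.
  by move=> rx lx; apply/negP => /(arc1_uniq r1 rx) e; rewrite e lx in nl.
have ok : exchangeable i AS a1.
  apply: exchangeable_items => // [x|a aA va xA].
    by rewrite in_set2 => /orP[] /eqP -> //; apply: arc1_item.
  have [_ _ lx _ _] := relay_arcP va; have := leaf1 _ (relay_head_arc1 va) lx.
  by rewrite (subsetP sq).
have nr x : x \in relays i AS -> x \notin block F a1.
  by case/relay_arc1 => rx lx _; apply: leaf1.
have [it _ _ ns] := ok.
have sh : shallow (all_tails i AS) a1 := shallow_ext ok a1A sh1.
have [f0 [b [f0X ASb cs nf0]]] :=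
  shallow_exchange ok sh sq (subxx _) (relay_free_tight ok nr) a1A.
apply: (exchange_apart it sq aH ns f0X a1A ASb _ cs); rewrite cards2 ne //.
move=> C CF [] /eqP/cards1P[f1 Cf1] sep a aA.
have spC : sparse 1 (cutF i AS f0 :\: C) := sparseD C (cutF_sparse i AS f0).
have bC := sep_size a1A ASb sep aA; rewrite cards2 ne in bC.
have cC := block_bound f0 ok a1A; rewrite c1 in cC.
have [ea|na] := eqVneq a a1.
  by rewrite {2}ea /weight r1; clear -bC cC; lia.
have ea : a = a2 by move: aA; rewrite in_set2 (negbTE na) => /eqP.
rewrite ea e2; rewrite ea in bC.
set F1 := _ :\: C in sep spC bC *.
(* Of two edges at a1 at most one is cut. *)
have big : 1 < #|block F1 a1|.
  have [fF jf] : leaf_edge a1 \in F /\ joins (leaf_edge a1) a1 (leaf_end a1) by apply: leaf_edgeP; rewrite c1.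
  have /andP[ifk _] := joins_inc jf.
  have [e [eF ie efk]] : exists e, [/\ e \in F, inc e a1 & e != leaf_edge a1].
    by move: nl; rewrite negb_forall => /existsP[e]; rewrite !negb_imply => /and3P[? ? ?]; exists e.
  have [g [gIF ig g1]] : exists g, [/\ g \in F, inc g a1 & g != f1].
    have [e1|] := eqVneq e f1; last by exists e.
    by exists (leaf_edge a1); split=> //; rewrite eq_sym -e1.
  have gq := inc_block gIF ig (block_self a1 spF).
  have gF1 : g \in F1.
    rewrite /F1 Cf1 in_setD in_set1 g1 in_setD gIF andbT in_setU1 negb_or nf0 //=.
    apply/imsetP => -[x xR ex]; have [fxF ix] := relay_edgeP xR.
    by have := ein_block fxF ix (nr x xR); rewrite -ex gq.
  have ag : a1 \in [set s g; t g].
    by case/orP: ig => /eqP <-; rewrite !inE eqxx ?orbT.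
  have := subset_leq_card (block_sub (edge_tight spC gF1) ag).
  by rewrite cards2 (forest_noloop spC gF1).
have sb x : x \in AS -> block F1 x \subset block (cutF i AS f0) a1.
  move=> xA; rewrite -(block_eq (cutF_sparse i AS f0) (subsetP ASb x xA)).
  exact: block_mono (subsetDl _ C) (cutF_sparse i AS f0).
have a2A : a2 \in AS by rewrite set22.
have dj : [disjoint block F1 a1 & block F1 a2].
  apply: block_disj => //; apply/negP => h1; have := sep _ _ a1A a2A h1.
  by move/eqP; rewrite (negbTE ne).
have : #|block F1 a1 :|: block F1 a2| <= d.+1.
  by apply: leq_trans cC; apply: subset_leq_card; rewrite subUset !sb.
rewrite cardsU (disjoint_setI0 dj) cards0 subn0.
by clear -big; lia.
Qed.

(** Three parts of a component with d + 1 vertices have at most d - 1 vertices each.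
    If a1 is a relay for a2 or a3, these two share the d vertices other than a1
    instead. *)
Lemma leaf_heavy_heavy a1 a2 a3 i : arc1 a1 i -> leaf a1 -> heavy a2 i -> heavy a3 i ->
  a2 \in block F a1 -> a3 \in block F a1 -> a2 != a3 -> False.
Proof.
move=> r1 l1 h2 h3 ab2 ab3 ne; have [c1 sh1] := arc1_shallow r1; have aH := arc1_H r1.
have [it2 e2 _] := heavyP h2; have [it3 e3 _] := heavyP h3.
have nw a : heavy a i -> a1 != a by move=> h1; apply: contraTneq h1 => <-; rewrite /heavy r1 andbF.
set P := [set a2; a3].
have hP x : x \in P -> heavy x i by rewrite in_set2 => /orP[] /eqP ->.
have bP : P \subset block F a1 by rewrite subUset !sub1set ab2.
have a2P : a2 \in P by rewrite set21.
have okP : exchangeable i P a1 by apply: exchangeable_heavy.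
have own x : x \in relays i P -> x \in block F a1 -> x = a1.
  by move=> /relay_arc1[rx _ _] xq; rewrite (arc1_uniq r1 rx xq).
have [xR|xR] := boolP (a1 \in relays i P).
  have a1q : a1 \in block F a1 by rewrite block_self.
  have sh : shallow (all_tails i P) a1.
    by apply: (shallow_mem okP r1) => //; rewrite inE xR orbT.
  have tY := relay_one_tight okP xR a1q own.
  have bnd f0 : #|block (cutF i P f0) a2| <= d.
    have spC := cutF_sparse i P f0.
    rewrite -ltnS -c1 -(block_eq spF ab2).
    apply: (@cutF_bound i P f0 a2 a1); first by rewrite (block_eq spF ab2).
    apply/negP => ab; have sub : block (cutF i P f0) a1 \subset [set a1].
      apply: closed_block => //; last by rewrite inE.
      move=> e eC; have eF := subsetP (cutF_sub i P f0) e eC.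
      have ni : ~~ inc e a1.
        apply/negP => ie; move: eC; rewrite (leafP l1 eF ie) in_setD in_setU1.
        by rewrite (imset_f leaf_edge xR) orbT.
      by move: ni; rewrite /inc /cross !inE negb_or => /andP[/negbTE -> /negbTE ->].
    have := block_self a2 spC; rewrite -(block_eq spC ab) => /(subsetP sub).
    by rewrite inE eq_sym (negbTE (nw _ h2)).
  have PY : P \subset block F a1 :\ a1.
    by apply/subsetP => x xP; rewrite in_setD1 eq_sym nw ?hP // (subsetP bP).
  apply: (no_shallow okP sh PY (subsetDl _ _) tY a2P _ bnd); rewrite cards2 ne //.
  by move=> a /hP/heavyP[_ -> _].
set AS := a1 |: P.
have a1A : a1 \in AS by rewrite setU11.
have rel x : x \in relays i AS -> x \in relays i P.
  case/relayP => a; rewrite in_setU1 => /orP[/eqP ->|aP] [va ->].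
    by rewrite relay_not_arc1 in r1.
  by apply/imsetP; exists a; rewrite // inE aP va.
have nr x : x \in relays i AS -> x \notin block F a1.
  move=> /rel xP; apply/negP => xq; have ex := own x xP xq.
  by rewrite -ex xP in xR.
have sq : AS \subset block F a1 by rewrite subUset sub1set block_self.
have ok : exchangeable i AS a1.
  apply: exchangeable_items => // [x|a aA va xA].
    by rewrite in_setU1 => /orP[/eqP ->|/hP/heavyP[]//]; apply: arc1_item.
  have xR' : hd i a \in relays i AS by apply/imsetP; exists a; rewrite // inE aA va.
  by have := nr _ xR'; rewrite (subsetP sq).
have cA : #|AS| = 3.
  by rewrite cardsU1 cards2 ne in_set2 negb_or !nw.
apply: (no_shallow_free ok (shallow_ext ok a1A sh1) nr a1A); rewrite cA //.
by move=> a aA; have /andP[_] := weight_le2 a i; rewrite c1; clear; lia.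
Qed.

Lemma heavy_triple a1 a2 a3 i : heavy a1 i -> heavy a2 i -> heavy a3 i -> a1 \in H ->
  a2 \in block F a1 -> a3 \in block F a1 -> a1 != a2 -> a1 != a3 -> a2 != a3 -> False.
Proof.
move=> h1 h2 h3 aH ab2 ab3 n12 n13 n23; set AS := a1 |: [set a2; a3].
have wA x : x \in AS -> heavy x i.
  by rewrite in_setU1 in_set2 => /or3P[] /eqP ->.
have a1A : a1 \in AS by rewrite setU11.
have sq : AS \subset block F a1 by rewrite !subUset !sub1set block_self ?ab2.
have ok : exchangeable i AS a1 by apply: exchangeable_heavy.
have cA : #|AS| = 3 by rewrite cardsU1 cards2 n23 in_set2 negb_or n12 n13.
have [/existsP[x /andP[xR xq]]|/existsPn nr] :=
    boolP [exists x, (x \in relays i AS) && (x \in block F a1)].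
  have [rx lx _] := relay_arc1 xR.
  apply: (leaf_heavy_heavy rx lx h1 h2 _ _ n12); rewrite (block_eq spF xq) //.
  exact: block_self.
have sh : shallow (all_tails i AS) a1.
  apply: shallow_sub (heavy_pair_shallow h1 h2 aH ab2 n12).
  - by apply: all_tails_sub; rewrite /AS setUA subsetUl.
  - exact: all_tails_root ok.
  - by rewrite block_self.
apply: (no_shallow_free ok sh _ a1A); rewrite ?cA //.
  by move=> x xR; have := nr x; rewrite xR.
by move=> a /wA/heavyP[_ -> _]; have := good_block a1; clear; lia.
Qed.

(** If the end z of the pendant edge is not below x, the arc of x can be replaced by
    this edge in its tree. Then {x, y} and the rest of the component of x are
    smaller than this component. Otherwise the relay arc starts from the child of x
    above z. *)
Lemma leaf_relay x i : arc1 x i -> leaf x -> k.+1 < d -> exists a, relay_arc a i /\ hd i a = x.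
Proof.
move=> r1 lx kd; have [cx _] := arc1_shallow r1; have [yw xH xr ltp] := parent_arcP (arc1_parent r1).
have [fF jf] : leaf_edge x \in F /\ joins (leaf_edge x) x (leaf_end x) by apply: leaf_edgeP; rewrite cx.
set y := hd i x in yw ltp; have cy : #|block F y| = 1 by case/andP: r1 => _ /eqP.
have xz : x != leaf_end x.
  apply: contraNneq (forest_noloop spF fF) => e.
  by case/orP: jf => /andP[/eqP -> /eqP ->]; rewrite -e.
suff zx : fconnect (hd i) (leaf_end x) x.
  have := iter_findex zx; case: (findex _ _ _) => [/= e|p pe]; first by rewrite e eqxx in xz.
  exists (iter p (hd i) (leaf_end x)); split; last exact: pe.
  have e : hd i (iter p (hd i) (leaf_end x)) = x := pe.
  rewrite /relay_arc e r1 lx cx eqxx kd fconnect_iter /= !andbT.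
  by apply: contraNneq xr => e0; rewrite -e e0 hdr.
apply: contraT => nzx; apply: False_ind.
have fB : leaf_edge x \notin B := F_notin_B fF.
(* The arc of x is replaced by its pendant edge. *)
pose o2 j v := if (j == i) && (v == x) then leaf_edge x else o j v.
pose hd2 j v := if (j == i) && (v == x) then leaf_end x else hd j v.
pose B2 := leaf_edge x |: (B :\ o i x).
pose F2 := o i x |: (F :\ leaf_edge x).
have jo := joins_o i xr; rewrite -/y in jo.
have xr' : x \notin [set r] by rewrite inE.
have oB : o i x \in B by apply: (arcs_mem aB).
have oF : o i x \notin F by rewrite (disjointFr (st_disj st) oB).
have a2 : arcs s t (fun=> [set r]) o2 hd2 B2.
  split.
  - move=> j v vr; rewrite /o2 /hd2; case: ifP => [/andP[_ /eqP ->]//|_].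
    exact: (arcs_joins aB).
  - move=> j v j' v' vr vr'; rewrite /o2.
    case: ifP => [/andP[/eqP -> /eqP ->]|_]; case: ifP => [/andP[/eqP -> /eqP ->]|_] //.
    + by move=> e; rewrite e (arcs_mem aB) in fB.
    + by move=> e; rewrite -e (arcs_mem aB) in fB.
    + exact: (arcs_inj aB).
  - apply/setP => e; apply/idP/imsetP.
      rewrite in_setU1 in_setD1 => /orP[/eqP ->|/andP[ne eB]].
        by exists (i, x); rewrite ?inE //= /o2 !eqxx.
      have [j [v [vr ev]]] := arcs_surj aB eB; exists (j, v); rewrite ?inE -?in_set1 //= /o2.
      case: ifP => // /andP[/eqP ji /eqP vx]; by rewrite ev ji vx eqxx in ne.
    case=> -[j v]; rewrite inE /= => vr ->; rewrite /o2; case: ifP => [_|nx].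
      by rewrite setU11.
    rewrite in_setU1 in_setD1 (arcs_mem aB) // andbT; apply/orP; right.
    apply/eqP => eo; have [ji vx] := arcs_inj aB vr xr' eo.
    by rewrite ji vx !eqxx in nx.
  - move=> j C C0 dC; have rC : r \notin C by rewrite disjoint_sym disjoints1 in dC.
    have [/existsP[v /andP[vC hv]]|/existsPn nv] :=
      boolP [exists v, (v \in C) && (hd2 j v \notin C)]; first by exists v.
    have clC v : v \in C -> hd2 j v \in C.
      by move=> vC; apply: contraT => hv; have := nv v; rewrite vC hv.
    case/eqP: C0; have [ji|ji] := eqVneq j i; last first.
      apply: (acyclic_closed (acyc_hd j)) => // v /clC.
      by rewrite /hd2 (negbTE ji).
    have [xC|xC] := boolP (x \in C); last first.
      apply: (acyclic_closed (acyc_hd j)) => // v vC; have := clC v vC.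
      have vx : v != x by apply: contraNneq xC => <-.
      by rewrite /hd2 (negbTE vx) andbF.
    have zC : leaf_end x \in C by have := clC x xC; rewrite /hd2 ji !eqxx.
    pose S := C :&: [set v | fconnect (hd i) (leaf_end x) v].
    have S0 : S = set0.
      apply: (acyclic_closed (acyc_hd i)); last by rewrite inE (negbTE rC).
      move=> v; rewrite !inE => /andP[vC zv].
      have vx : v != x by apply/eqP => vx; rewrite vx in zv; rewrite zv in nzx.
      have := clC v vC; rewrite /hd2 (negbTE vx) andbF ji => ->.
      exact: connect_trans zv (fconnect1 _ _).
    have : leaf_end x \in S by rewrite !inE zC connect0.
    by rewrite S0 inE.
have spF' : sparse 1 (F :\ leaf_edge x) by exact: sparseD1.
have F'x e : e \in F :\ leaf_edge x -> ~~ inc e x.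
  rewrite in_setD1 => /andP[ne eF]; apply: contra ne => ie.
  by rewrite (leafP lx eF ie).
have F'y e : e \in F :\ leaf_edge x -> ~~ inc e y.
  by rewrite in_setD1 => /andP[ne eF]; apply: block1_edge; rewrite ?cy.
have ny v : pos v <= pos x -> v != y.
  by move=> le; apply: contraTneq ltp => <-; rewrite -leqNgt.
have xy := ny x (leqnn _).
have sp2 : sparse 1 F2.
  apply: (attach_edge spF' jo); apply/negP => yb.
  have : block (F :\ leaf_edge x) x \subset [set x].
    apply: closed_block => //; last by rewrite inE.
    by move=> e /F'x; rewrite /inc /cross !inE negb_or => /andP[/negbTE -> /negbTE ->].
  by move/subsetP/(_ y yb); rewrite inE eq_sym (negbTE xy).
have cl2 e : e \in F2 -> ~~ cross e [set x; y].
  rewrite in_setU1 => /orP[/eqP ->|eF].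
    by rewrite /cross; case/orP: jo => /andP[/eqP -> /eqP ->]; rewrite !inE !eqxx ?orbT.
  have := F'x e eF; have := F'y e eF; rewrite /inc /cross !in_set2 !negb_or.
  by move=> /andP[/negbTE -> /negbTE ->] /andP[/negbTE -> /negbTE ->].
have bxy v : v \in [set x; y] -> block F2 v \subset [set x; y].
  by move=> vxy; apply: closed_block.
have good2 : good F2.
  move=> X tX; have /set0Pn[v vX] := tight_neq0 tX.
  have Xb := block_sub tX vX.
  have [vxy|vxy] := boolP (v \in [set x; y]).
    apply: leq_trans (subset_leq_card (subset_trans Xb (bxy v vxy))) _.
    by rewrite cards2; case: (_ != _).
  apply: gF; apply: (tight_transfer spF tX) => e eF eX.
  move: eF; rewrite in_setU1 in_setD1 => /orP[/eqP eo|/andP[_ ->]//].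
  case/negP: vxy; move: eX; rewrite eo (joins_ein _ jo) => /andP[xX _].
  have bx := block_sub tX xX; apply: (subsetP (bxy x _)); first by rewrite set21.
  exact: (subsetP bx).
have st2 : state o2 hd2 B2 F2.
  split=> //.
  - by move=> j; rewrite /hd2 [r == x]eq_sym (negbTE xr) andbF.
  - apply/setP => e; rewrite -(st_union st) !in_setU !in_setD1 !in_set1.
    have [->|_] := eqVneq e (leaf_edge x); first by rewrite fF orbT.
    have [->|_] := eqVneq e (o i x); first by rewrite oB orbT.
    by [].
  - rewrite -setI_eq0; apply/eqP/setP => e; rewrite in_setI !in_setU1 !in_setD1 in_set0.
    have [->|_] := eqVneq e (leaf_edge x).
      by rewrite /= orbF; apply: contraNF fB => /eqP ->.
    have [->|_] := eqVneq e (o i x); first by rewrite (negbTE oF) /= ?andbF.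
    by apply/negP => /= /andP[eB /F_notin_B]; rewrite eB.
have plt : pos x < size ws by rewrite pos_lt.
have xt : x \notin covered F (take (pos x) ws) by rewrite covered_take // ltnn.
have yt : y \notin covered F (take (pos x) ws).
  by rewrite covered_take ?hd_H // -leqNgt ltnW.
set w := nth r ws (pos x); have bw : block F w = block F x := pos_block xH.
apply: (lex_improve st2 plt).
- move=> u ub; have uc v : v \in block F u -> v \in covered F (take (pos x) ws).
    by move=> vu; apply/in_covered; exists u.
  have nx : x \notin block F u by apply: contra xt; apply: uc.
  have nyu : y \notin block F u by apply: contra yt; apply: uc.
  apply: block_kept => // [e eF eu|e].
    rewrite in_setU1 in_setD1 eF andbT; apply/orP; right; apply: contraTneq eu => ->.
    have ix : inc (leaf_edge x) x by case/andP: (joins_inc jf).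
    exact: (ein_block fF ix).
  rewrite in_setU1 in_setD1 => /orP[/eqP -> _|/andP[_ ->]//].
  by case/orP: jo => /andP[/eqP sE /eqP tE]; rewrite /cross sE tE (negbTE nx) (negbTE nyu).
- move=> v j vc; rewrite /hd2; case: ifP => // /andP[_ /eqP vx].
  by rewrite vx in vc; rewrite vc in xt.
rewrite -/w bw cx.
have [wx|wx] := eqVneq w x.
  rewrite wx; apply: leq_ltn_trans (subset_leq_card (bxy x _)) _; first by rewrite set21.
  by rewrite cards2 xy; clear -kd; lia.
have sub : block F2 w \subset block F x :\ x.
  apply: closed_block => //; last by rewrite in_setD1 wx block_top.
  move=> e; rewrite in_setU1 => /orP[/eqP ->|eF].
    have yx : y \notin block F x by apply/negP => /pos_eq e1; rewrite e1 ltnn in ltp.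
    by case/orP: jo => /andP[/eqP sE /eqP tE]; rewrite /cross sE tE !in_setD1 eqxx /= (negbTE yx) ?andbF.
  have := F'x e eF; have := block_edge x spF (subsetP (subD1set _ _) _ eF).
  by rewrite /inc /cross !in_setD1 negb_or => h1 /andP[-> ->].
have := subset_leq_card sub; have := cardsD1 x (block F x).
by rewrite block_self // cx; clear; lia.
Qed.

(** * Discharging *)

(** What the component of w lacks to contribute d. It vanishes for three or more
    vertices. *)
Definition need w := d - k.+1 * (#|block F w| - 1).
(** For an isolated vertex attached at a. If a is a leaf, a part of the cost is
    passed to the relay arc that exists by [leaf_relay]. *)
Definition charge1 a := if leaf a && (k.+1 < d) then k.+1 else d.
Definition charge a i := arc1 a i * charge1 a + heavy a i * (d - k.+1).
(** What a component with m vertices can pay in each colour. *)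
Definition capacity m := if m == d.+1 then d else if m == d then d - k.+1 else 0.

Lemma sum_le1 (X : {set V}) (P : pred V) (f : V -> nat) m :
  (forall a, a \in X -> P a -> f a <= m) ->
  (forall a b, a \in X -> b \in X -> P a -> P b -> a = b) ->
  \sum_(a in X) P a * f a <= m.
Proof.
move=> fm uni; have [/existsP[a /andP[aX Pa]]|/existsPn no] := boolP [exists a, (a \in X) && P a].
  rewrite (bigD1 a) //= Pa mul1n big1 ?addn0; first exact: fm.
  move=> b /andP[bX ba]; case Pb: (P b) => //.
  by rewrite (uni b a bX aX Pb Pa) eqxx in ba.
rewrite big1 // => a aX; case Pa: (P a) => //.
by have := no a; rewrite aX Pa.
Qed.

Lemma sum_heavy (X : {set V}) i m : \sum_(a in X) heavy a i * m = #|[set a in X | heavy a i]| * m.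
Proof.
rewrite -big_distrl /=; congr muln; rewrite -sum1_card big_mkcond [RHS]big_mkcond /=.
by apply: eq_bigr => a _; rewrite inE; case: (a \in X) => //; case: (heavy a i).
Qed.

(** By the excluded configurations, a component with d + 1 vertices has at most one
    arc to an isolated vertex, alone or, at a leaf, with one heavy arc; or else two
    heavy arcs, and 2 (d - (k + 1)) <= d. *)
Lemma charge_block w i : w \in H ->
  \sum_(a in block F w) charge a i <= capacity #|block F w|.
Proof.
move=> wH; set Q := block F w; have QE a : a \in Q -> block F a = Q by move=> aQ; apply: block_eq.
have QH a : a \in Q -> a \in H := blockH wH.
rewrite big_split /= sum_heavy; set S2 := [set a in Q | heavy a i].
have S2P a : a \in S2 -> a \in Q /\ heavy a i by rewrite inE => /andP[].
have uni a b : a \in Q -> b \in Q -> arc1 a i -> arc1 b i -> a = b.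
  by move=> aQ bQ ra rb; apply: arc1_uniq ra rb _; rewrite QE.
rewrite /capacity; case: eqP => [cQ|/eqP cQ].
  have [/existsP[a1 /andP[aQ r1]]|/existsPn no] := boolP [exists a, (a \in Q) && arc1 a i].
    have others : \sum_(a in Q) arc1 a i * charge1 a <= charge1 a1.
      apply: sum_le1 => // a aX ra; by rewrite (uni a a1).
    have [kd|kd] := ltnP k.+1 d; last first.
      have -> : d - k.+1 = 0 by apply/eqP; rewrite subn_eq0.
      by rewrite muln0 addn0; apply: leq_trans others _; rewrite /charge1 ltnNge kd andbF.
    have [l1|nl] := boolP (leaf a1).
      have c2 : #|S2| <= 1.
        apply/card_le1_eqP => x y /S2P[xQ hx] /S2P[yQ hy]; apply/eqP.
        rewrite eq_sym; apply: contraT => ne.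
        have xq : x \in block F a1 by rewrite QE.
        have yq : y \in block F a1 by rewrite QE.
        by case: (leaf_heavy_heavy r1 l1 hx hy xq yq ne).
      have := leq_mul c2 (leqnn (d - k.+1)); move: others; rewrite /charge1 l1 kd mul1n /=.
      by clear -kd; lia.
    have -> : S2 = set0.
      apply/setP => x; rewrite in_set0; apply/negP => /S2P[xQ hx].
      by apply: (arc1_nonleaf r1 nl hx); rewrite QE.
    by rewrite cards0 mul0n addn0; apply: leq_trans others _; rewrite /charge1 (negbTE nl).
  rewrite big1 => [|a aQ]; last by have := no a; rewrite aQ; case: (arc1 a i).
  rewrite add0n; have c2 : #|S2| <= 2.
    rewrite leqNgt; apply/negP => /card_gt2P[x [y [z [[/S2P[xQ hx] /S2P[yQ hy] /S2P[zQ hz]] [xy yz zx]]]]].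
    apply: (heavy_triple hx hy hz); rewrite ?QE ?QH //.
    by rewrite eq_sym.
  by have := leq_mul c2 (leqnn (d - k.+1)); clear -d_le; lia.
rewrite big1 => [|a aQ]; last first.
  case ra: (arc1 a i) => //; have [ca _] := arc1_shallow ra.
  by rewrite QE // in ca; rewrite ca eqxx in cQ.
rewrite add0n; case: eqP => [cQd|/eqP cQd].
  have c2 : #|S2| <= 1.
    apply/card_le1_eqP => x y /S2P[xQ hx] /S2P[yQ hy].
    by apply/esym/(heavy_pair_d hx hy); rewrite ?QE ?QH.
  by have := leq_mul c2 (leqnn (d - k.+1)); rewrite mul1n.
have -> : S2 = set0; last by rewrite cards0.
apply/setP => x; rewrite in_set0; apply/negP => /S2P[xQ hx].
have := heavy_ge hx (QH x xQ); have := good_block x; rewrite QE // -/Q.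
by move: cQ cQd; clear; lia.
Qed.

Lemma capacity_ok w : d + k * capacity #|block F w| <= k.+1 * (#|block F w| - 1) + need w.
Proof.
rewrite /need /capacity; case: eqP => [->|_]; first by rewrite subn1 /= mulSn; clear; lia.
case: eqP => [->|_]; last by rewrite muln0; clear; lia.
have [kd|kd] := ltnP k.+1 d; last by rewrite (eqP (_ : d - k.+1 == 0)) ?subn_eq0 // muln0; clear; lia.
have [c ec] : exists c, d = k.+1 + c by exists (d - k.+1); clear -kd; lia.
rewrite ec; have -> : k.+1 + c - k.+1 = c by clear; lia.
have -> : k.+1 + c - 1 = k + c by clear; lia.
rewrite mulSn mulnDr; have := k_gt0; have : k <= k * k by rewrite leq_pmulr.
by clear; lia.
Qed.

(** For a relay arc, a is reached from the end of a pendant edge of an explored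
    component, and the explored set is closed under arcs. *)
Lemma item_H a i : item a i -> a \in H.
Proof.
case/or3P => [/arc1_H//|/and3P[/parent_arcP[]]//|va].
have [rx _ _ cx d2] := relay_arcP va; have [_ xH _ _] := parent_arcP rx.
have [fF jf] : leaf_edge (hd i a) \in F /\ joins (leaf_edge (hd i a)) (hd i a) (leaf_end (hd i a)).
  by apply: leaf_edgeP; rewrite cx.
have zb : leaf_end (hd i a) \in block F (hd i a).
  have /andP[ix _] := joins_inc jf.
  by have := inc_block fF ix (block_self _ spF); rewrite (joins_ein _ jf) => /andP[].
case/and5P: va => _ _ _ _ /andP[_ za].
by apply: fconnect_closed za; [move=> u; apply: hd_H|apply: blockH zb].
Qed.

Lemma charge_H a i : a \notin H -> charge a i = 0.
Proof.
move=> aH; rewrite /charge; case ra: (arc1 a i); first by rewrite (arc1_H ra) in aH.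
by case ha: (heavy a i) => //; case/heavyP: ha => /item_H ah; rewrite ah in aH.
Qed.

Lemma sum_blocks (f : V -> nat) :
  \sum_(w in ws) \sum_(a in block F w) f a = \sum_(a in H) f a.
Proof.
rewrite (exchange_big_dep (mem H)) /=; last first.
  by move=> w a ww ab; apply: blockH ab; apply: ws_H.
apply: eq_bigr => a aH; have plt : pos a < size ws by rewrite pos_lt.
rewrite (bigD1 (nth r ws (pos a))) /=; last first.
  by rewrite mem_nth // pos_block // block_self.
rewrite big1 ?addn0 // => w /andP[/andP[ww ab] ne].
by move: ne; rewrite (pos_eq ab) pos_ws // nth_index // eqxx.
Qed.

Lemma sum_charge : \sum_i \sum_a charge a i <= \sum_(w in ws) k * capacity #|block F w|.
Proof.
have -> : \sum_i \sum_a charge a i = \sum_i \sum_(w in ws) \sum_(a in block F w) charge a i.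
  apply: eq_bigr => i _; rewrite sum_blocks [RHS]big_mkcond /=.
  by apply: eq_bigr => a _; case: ifP => // /negbT /charge_H ->.
rewrite exchange_big /=; apply: leq_sum => w ww.
rewrite -[k in leqRHS]card_ord -sum_nat_const; apply: leq_sum => i _.
by apply: charge_block; apply: ws_H.
Qed.

Definition parented := [set p : V * 'I_k | parent_arc p.1 p.2].

(** Each leaf with an arc to an isolated vertex is the head of a relay arc, so there
    are at least as many relay arcs as such leaves. *)
Lemma need_charge : \sum_(p in parented) need (hd p.2 p.1) <= \sum_i \sum_a charge a i.
Proof.
pose L := [set p : V * 'I_k | [&& arc1 p.1 p.2, leaf p.1 & k.+1 < d]].
pose VT := [set p : V * 'I_k | relay_arc p.1 p.2].
have cLV : #|L| <= #|VT|.
  apply: leq_trans (leq_imset_card (fun p : V * 'I_k => (hd p.2 p.1, p.2)) VT).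
  apply/subset_leq_card/subsetP => -[x i]; rewrite inE /= => /and3P[r1 lx kd].
  have [a [va ex]] := leaf_relay r1 lx kd; apply/imsetP; exists (a, i); rewrite ?inE //=.
  by rewrite ex.
set s0 := d - k.+1.
have le1 : \sum_(p in parented) need (hd p.2 p.1) <=
    \sum_(p : V * 'I_k) (arc1 p.1 p.2 * charge1 p.1 + arc2 p.1 p.2 * s0 + (p \in L) * s0).
  rewrite big_mkcond /=; apply: leq_sum => -[a i] _ /=; rewrite inE /=; case: ifP => // ra.
  rewrite /need /arc2 /arc1 ra /= inE /= /arc1 ra /charge1 -/s0.
  set m := #|block F (hd i a)|; have m0 : 0 < m.
    by apply/card_gt0P; exists (hd i a); apply: block_self.
  case: m m0 => [//|[|[|m]]] _ /=.
  - rewrite muln0 subn0 !mul1n mul0n addn0.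
    by case: (leaf a) => //=; case: ltnP => //= kd; rewrite /s0 ?mul1n; clear -kd; lia.
  - rewrite muln1 !mul0n add0n addn0 -/s0.
    by have [kd|kd] := ltnP k.+1 d; rewrite ?mul1n //= /s0 leqn0 subn_eq0.
  by rewrite (eqP (_ : d - _ == 0)) // subn_eq0; clear -d_le; nia.
apply: leq_trans le1 _.
have -> : \sum_i \sum_a charge a i = \sum_(p : V * 'I_k) charge p.1 p.2.
  by rewrite exchange_big pair_bigA.
rewrite big_split /= -big_distrl /=.
have -> : \sum_(p : V * 'I_k) (p \in L) = #|L|.
  by rewrite -sum1_card [RHS]big_mkcond; apply: eq_bigr => p _; case: (p \in L).
apply: (@leq_trans (\sum_(p : V * 'I_k) (arc1 p.1 p.2 * charge1 p.1 + arc2 p.1 p.2 * s0) + #|VT| * s0)).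
  by rewrite leq_add2l leq_mul2r cLV orbT.
have -> : #|VT| = \sum_(p : V * 'I_k) (p \in VT).
  by rewrite -sum1_card big_mkcond; apply: eq_bigr => p _; case: (p \in VT).
rewrite big_distrl -big_split /=; apply: leq_sum => -[a i] _ /=.
rewrite inE /= /charge -addnA leq_add2l -mulnDl leq_mul2r; apply/orP; right.
rewrite /heavy; have [va|nv] := boolP (relay_arc a i).
  rewrite /item va !orbT (relay_not_arc1 va) /=; have [_ _ _ c d2] := relay_arcP va.
  have -> // : arc2 a i = false.
  by apply/negP => /and3P[_ /eqP c2 _]; move: c; rewrite c2; clear -d2; lia.
rewrite /item (negbTE nv) addn0 orbF; have [r2|//] := boolP (arc2 a i).
by rewrite orbT /arc1; case/and3P: r2 => _ /eqP ->; rewrite andbF.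
Qed.

(** Only the components found at the ends of h have no parent. *)
Lemma sum_need : \sum_(w in ws) need w <= \sum_(p in parented) need (hd p.2 p.1) + 2 * d.
Proof.
pose W := [set w in ws | (w != r) && (w != q)].
apply: (@leq_trans (\sum_(w in W) need w + 2 * d)).
  have e : forall w, w \in W = (w \in ws) && ((w != r) && (w != q)) by move=> w; rewrite inE.
  rewrite (bigID (fun w => (w != r) && (w != q))) /= (eq_bigl _ _ e) leq_add2l.
  apply: (@leq_trans (\sum_(w in [set r; q]) d)).
    rewrite big_mkcond [leqRHS]big_mkcond /=; apply: leq_sum => w _.
    case: ifP => // /andP[_]; rewrite negb_and !negbK in_set2 => ->.
    exact: leq_subr.
  by rewrite sum_nat_const leq_mul2r cards2; case: (_ != _); rewrite ?orbT.
rewrite leq_add2r; apply: sum_sub_image.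
apply/subsetP => w; rewrite inE => /and3P[ww wr wq].
have [a [i [ra ha]]] := parent_some ww wr wq.
by apply/imsetP; exists (a, i); rewrite ?inE.
Qed.

Lemma discharging : d * size ws <= \sum_(w in ws) k.+1 * (#|block F w| - 1) + 2 * d.
Proof.
have h1 := sum_need; have h2 := need_charge; have h3 := sum_charge.
have h4 : \sum_(w in ws) (d + k * capacity #|block F w|) <=
    \sum_(w in ws) (k.+1 * (#|block F w| - 1) + need w).
  by apply: leq_sum => w _; apply: capacity_ok.
have e1 : \sum_(w in ws) (d + k * capacity #|block F w|)
    = d * size ws + \sum_(w in ws) k * capacity #|block F w|.
  by rewrite big_split sum_nat_const (card_uniqP ws_uniq) mulnC.
have e2 : \sum_(w in ws) (k.+1 * (#|block F w| - 1) + need w)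
    = \sum_(w in ws) k.+1 * (#|block F w| - 1) + \sum_(w in ws) need w by rewrite big_split.
rewrite e1 e2 in h4.
by clear -h1 h2 h3 h4; lia.
Qed.

Lemma card_H : #|H| = \sum_(w in ws) #|block F w|.
Proof.
rewrite -sum1_card -sum_blocks; apply: eq_bigr => w _.
by rewrite sum1_card.
Qed.

Lemma inn_F_H : \sum_(w in ws) (#|block F w| - 1) <= #|inn F H|.
Proof.
have -> : #|inn F H| = \sum_(e in inn F H) 1 by rewrite sum1_card.
rewrite (partition_big (fun e => nth r ws (pos (s e))) (mem ws)) /=; last first.
  by move=> e; rewrite in_inn => /and3P[_ sH _]; rewrite mem_nth // pos_lt.
apply: leq_sum => w ww; rewrite sum1dep_card.
have := tightE (block_tight w spF); rewrite mul1n => <-; rewrite addnK.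
apply/subset_leq_card/subsetP => e; rewrite inE !in_inn => /andP[eF /andP[sw tw]].
rewrite eF /= (pos_eq sw) pos_ws // nth_index // eqxx andbT /ein.
by rewrite !(blockH (ws_H ww)).
Qed.

Lemma inn_B_H : k * #|H| <= #|inn B H| + k.
Proof.
have : #|[set o p.1 p.2 | p in setX [set: 'I_k] (H :\ r)]| <= #|inn B H|.
  apply/subset_leq_card/subsetP => e /imsetP[[j v]]; rewrite in_setX in_setD1 /=.
  case/and3P => _ vr vH ->; rewrite in_inn (joins_ein _ (joins_o j vr)) vH hd_H // !andbT.
  by apply: (arcs_mem aB); rewrite inE.
rewrite card_in_imset; last first.
  move=> [j v] [j' v']; rewrite !in_setX !in_setD1 /= => /and3P[_ vr _] /and3P[_ vr' _] eo.
  have vn : v \notin [set r] by rewrite inE.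
  have vn' : v' \notin [set r] by rewrite inE.
  by have [-> ->] := arcs_inj aB vn vn' eo.
rewrite cardsX cardsT card_ord (cardsD1 r H) root_H add1n mulnS.
by clear; lia.
Qed.

Lemma inn_split_H : #|inn B H| + #|inn F H| + 1 <= #|inn (h |: A) H|.
Proof.
have eH : ein h H by rewrite /ein root_H end_H.
rewrite (inn_in hA eH) addn1 ltnS.
have <- : #|inn B H :|: inn F H| = #|inn B H| + #|inn F H|.
  rewrite cardsU (_ : _ :&: _ = set0) ?cards0 ?subn0 //.
  apply/setP => e; rewrite in_setI !in_inn in_set0; apply/negP => /andP[/andP[eB _] /andP[eF _]].
  by move: (F_notin_B eF); rewrite eB.
apply/subset_leq_card/subsetP => e; rewrite in_setU !in_inn -(st_union st) in_setU.
by case/orP => /andP[-> ->]; rewrite ?orbT.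
Qed.

(** H is closed under arcs, so it spans k trees of B, the explored components of F,
    and h. *)
Lemma density_contradiction :
  (forall X : {set V}, 1 < #|X| ->
     (d + k.+1) * #|inn (h |: A) X| <= (k * (d + k.+1) + d) * (#|X| - 1)) -> False.
Proof.
move=> dens; have cH : 1 < #|H|.
  have : #|[set r; q]| <= #|H|.
    by apply: subset_leq_card; rewrite subUset !sub1set root_H end_H.
  by rewrite cards2 h_noloop.
have := dens H cH; have := inn_split_H; have := inn_B_H; have := inn_F_H; have := discharging.
have := card_H; rewrite -big_distrr /=.
set S1 := \sum_(w in ws) (#|block F w| - 1); set S2 := \sum_(w in ws) #|block F w|.
have e12 : S2 = S1 + size ws.
  rewrite -(card_uniqP ws_uniq) -sum1_card -big_split /=; apply: eq_bigr => w _.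
  by rewrite subnK // card_gt0; apply/set0Pn; exists w; apply: block_self.
move=> eH hd1 hF hB hU.
have hE : 1 + k * (#|H| - 1) + S1 <= #|inn (h |: A) H|.
  apply: leq_trans hU; rewrite mulnBr muln1; move: hF hB; clear; lia.
have cm := leq_mul (leqnn (d + k.+1)) hE.
move=> hden; have fin := leq_trans cm hden.
have [m em] : exists m, #|H| = m.+1 by exists #|H|.-1; rewrite prednK // ltnW.
rewrite em subn1 /= in fin; rewrite em e12 in eH.
move: fin hd1 eH; clear; move: (size ws) S1 => T S fin hd1 eH.
have e2 : d * m + d = d * S + d * T by rewrite -mulnDr -eH mulnS addnC.
by move: fin hd1 e2; clear; lia.
Qed.

End Minimal.
End States.

(** * Induction on the number of edges *)

Section Spanning.
Variables (V E : finType) (s t : E -> V) (k d : nat).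
Hypotheses (k_gt0 : 0 < k) (d_gt0 : 0 < d) (d_le : d <= 2 * k.+1).
Implicit Types (A B F : {set E}) (X : {set V}) (h e : E).

Definition goodb F := [forall X : {set V}, tight s t 1 F X ==> (#|X| <= d.+1)].

Lemma goodP F : reflect (good s t d F) (goodb F).
Proof.
apply: (iffP forallP) => [H X tX|H X]; first by have := H X; rewrite tX.
by apply/implyP; apply: H.
Qed.

Definition decomposition A (p : {set E} * {set E}) :=
  [&& p.1 :|: p.2 == A, [disjoint p.1 & p.2], sparse s t k p.1, sparse s t 1 p.2 & goodb p.2].

Lemma decomposedP A : reflect (decomposed s t k d A) [exists p, decomposition A p].
Proof.
apply: (iffP existsP) => [[[B F] /and5P[/eqP U D sB sF /goodP g]]|[B [F [U D sB sF g]]]].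
  by exists B, F.
by exists (B, F); rewrite /decomposition U eqxx D sB sF; apply/goodP.
Qed.

(** Descent on the code of an exploration. *)
Lemma state_contradiction A h : h \notin A -> s h != t h ->
  (forall X, 1 < #|X| ->
     (d + k.+1) * #|inn s t (h |: A) X| <= (k * (d + k.+1) + d) * (#|X| - 1)) ->
  ~ decomposed s t k d (h |: A) ->
  forall (o : 'I_k -> V -> E) (hd : 'I_k -> V -> V) B F ws, state s t d A h o hd B F -> legal s t h hd F ws -> False.
Proof.
move=> hA nl dens fail.
suff H n : forall (o : 'I_k -> V -> E) (hd : 'I_k -> V -> V) B F ws, key s t F ws < n ->
    state s t d A h o hd B F -> legal s t h hd F ws -> False.
  by move=> o hd B F ws; apply: H (leqnn _).
elim: n => // n IH o hd B F ws lt st lg.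
apply: (density_contradiction k_gt0 d_gt0 d_le hA nl fail st lg _ dens).
move=> o2 hd2 B2 F2 ws2 st2 lg2; rewrite leqNgt; apply/negP => lt2.
by apply: (IH o2 hd2 B2 F2 ws2 _ st2 lg2); apply: leq_trans lt2 _.
Qed.

(** A set B with k (|V| - 1) edges splits into k spanning trees, which give a first
    state with the empty exploration. *)
Lemma spanning_step A h B F : h \notin A -> s h != t h ->
  (forall X, 1 < #|X| ->
     (d + k.+1) * #|inn s t (h |: A) X| <= (k * (d + k.+1) + d) * (#|X| - 1)) ->
  B :|: F = A -> [disjoint B & F] -> sparse s t k B -> sparse s t 1 F -> good s t d F ->
  #|B| + k = k * #|V| -> decomposed s t k d (h |: A).
Proof.
move=> hA nl dens U D sB sF g cB; apply/decomposedP.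
apply: contraT => /decomposedP fail; set r := s h.
have no v : v \in [set r] :\ r -> False by rewrite !inE; case: eqP.
have [||| o [hd [aB _]]] :=
  @extend_arcs V E s t k h B [set r] r (fun _ _ => h) (fun _ v => v) k_gt0 sB cB (set11 r).
- by move=> j v /no.
- by move=> j v j' v' /no.
- by move=> j C /set0Pn[v vC] /subsetP/(_ v vC)/no.
pose hd' (j : 'I_k) v := if v == r then r else hd j v.
have st : state s t d A h o hd' B F.
  split=> //; last by move=> j; rewrite /hd' eqxx.
  case: aB => [a1 a2 a3 a4]; split=> //.
    by move=> j v vr; have := a1 j v vr; rewrite /hd'; move: vr; rewrite inE => /negbTE ->.
  move=> j C C0 dC; have [v vC hv] := a4 j C C0 dC; exists v => //.
  rewrite /hd'; case: eqP => // vr.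
  by rewrite disjoint_sym disjoints1 -/r -vr vC in dC.
by case: (state_contradiction hA nl dens fail st (ws := [::])).
Qed.

End Spanning.

(** Passing to the vertices of W while keeping the type of edges: edges outside W
    get arbitrary ends, and only edges inside W are considered. *)
Section Restrict.
Variables (V E : finType) (s t : E -> V) (W : {set V}) (w0 : V) (w0W : w0 \in W).
Implicit Types (A : {set E}) (X : {set V}) (e : E).
Local Notation T := {x : V | x \in W}.
Definition proj (v : V) : T := insubd (Sub w0 w0W : T) v.
Definition rs e := proj (s e).
Definition rt e := proj (t e).

Lemma val_proj v : v \in W -> val (proj v) = v.
Proof. by move=> vW; rewrite /proj insubdK. Qed.

Lemma ein_restrict e (Y : {set T}) : ein s t e W -> ein rs rt e Y = ein s t e (val @: Y).
Proof.
case/andP => sW tW; have H v : v \in W -> (proj v \in Y) = (v \in val @: Y).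
  by move=> vW; rewrite -{2}(val_proj vW) mem_imset //; apply: val_inj.
by rewrite /ein !H.
Qed.

Lemma inn_restrict A (Y : {set T}) : (forall e, e \in A -> ein s t e W) ->
  inn rs rt A Y = inn s t A (val @: Y).
Proof.
move=> AW; apply/setP => e; rewrite !in_inn; case eA: (e \in A) => //=.
by rewrite ein_restrict // AW.
Qed.

Lemma card_restrict (Y : {set T}) : #|val @: Y| = #|Y|.
Proof. by rewrite card_imset //; apply: val_inj. Qed.

Lemma val_sub (Y : {set T}) : val @: Y \subset W.
Proof. by apply/subsetP => v /imsetP[y _ ->]; apply: valP. Qed.

Lemma val_preim (X : {set V}) : X \subset W -> val @: (val @^-1: X : {set T}) = X.
Proof.
move=> XW; apply/setP => v; apply/imsetP/idP => [[y]|vX].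
  by rewrite inE => yX ->.
by exists (proj v); rewrite ?inE ?val_proj // (subsetP XW).
Qed.

Lemma sparse_restrict m A : (forall e, e \in A -> ein s t e W) ->
  sparse s t m A -> sparse rs rt m A.
Proof.
move=> AW /sparseP sp; apply/sparseP => Y Y0; rewrite inn_restrict // -card_restrict.
by apply: sp; rewrite imset_eq0.
Qed.

Lemma sparse_in m A X : (forall e, e \in A -> ein s t e W) -> sparse rs rt m A ->
  X \subset W -> X != set0 -> #|inn s t A X| + m <= m * #|X|.
Proof.
move=> AW /sparseP sp XW X0; rewrite -{1 2}(val_preim XW) card_restrict -inn_restrict //.
by apply: sp; rewrite -(imset_eq0 val) val_preim.
Qed.

Lemma tight_restrict m A X : (forall e, e \in A -> ein s t e W) -> X \subset W ->
  tight s t m A X -> tight rs rt m A (val @^-1: X).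
Proof.
move=> AW XW; rewrite !tight_def inn_restrict // val_preim // -(imset_eq0 val) val_preim //.
by rewrite -card_restrict val_preim.
Qed.

End Restrict.

Section Outer.
Variables (V E : finType) (s t : E -> V) (k d : nat).
Hypotheses (k_gt0 : 0 < k) (d_gt0 : 0 < d) (d_le : d <= 2 * k.+1).
Hypothesis noloop : forall e, s e != t e.
Hypothesis density : forall X : {set V}, 1 < #|X| ->
  (d + k.+1) * #|inn s t [set: E] X| <= (k * (d + k.+1) + d) * (#|X| - 1).
Implicit Types (A B F : {set E}) (X : {set V}) (h e : E).

(** By submodularity with the tight set W, a set X spans at most k (|X| - |X :&: W|)
    edges that are not inside W. *)
Lemma glue_sparse B B1 W : sparse s t k B -> tight s t k B W ->
  (forall e, e \in B1 -> ein s t e W) ->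
  (forall X, X \subset W -> X != set0 -> #|inn s t B1 X| + k <= k * #|X|) ->
  sparse s t k ((B :\: inn s t B W) :|: B1).
Proof.
move=> spB tW B1W sp1; apply/sparseP => X X0.
have [I0|I0] := eqVneq (X :&: W) set0.
  apply: leq_trans (sparseP _ _ _ _ spB X X0); rewrite leq_add2r subset_leq_card //.
  apply/subsetP => e; rewrite !in_inn in_setU in_setD => /andP[/orP[/andP[_ ->]//|/B1W eW] eX].
  case/andP: eX eW => sX _ /andP[sW _].
  by move/setP/(_ (s e)): I0; rewrite !inE sX sW.
have U0 : X :|: W != set0.
  by case/set0Pn: X0 => x xX; apply/set0Pn; exists x; rewrite inE xX.
have h1 : #|inn s t ((B :\: inn s t B W) :|: B1) X| <=
    #|inn s t B X :\: inn s t B (X :&: W)| + #|inn s t B1 (X :&: W)|.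
  rewrite -cardsUI -[X in X <= _]addn0 leq_add // subset_leq_card //.
  apply/subsetP => e; rewrite !(in_setU, in_setD, in_inn) /ein !in_setI.
  case/andP => /orP[/andP[nW eB]|eB] /andP[-> ->]; last first.
    by have /andP[-> ->] := B1W e eB; rewrite eB; apply: orbT.
  by move: nW; rewrite eB /= => ->.
have h2 : #|inn s t B X :\: inn s t B (X :&: W)| + #|inn s t B (X :&: W)| = #|inn s t B X|.
  have sub : inn s t B (X :&: W) \subset inn s t B X.
    by apply/subsetP => e; rewrite !in_inn /ein !in_setI => /and3P[-> /andP[-> _] /andP[-> _]].
  by rewrite -[in RHS](cardsID (inn s t B (X :&: W))) (setIidPr sub) addnC.
have h3 := inn_submod s t B X W; have h4 := sp1 _ (subsetIr X W) I0.
have h5 := sparseP _ _ _ _ spB _ U0; have h6 := tightE tW.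
have := card_UI X W => /(congr1 (muln k)); rewrite !mulnDr.
by move: h1 h2 h3 h4 h5 h6; clear; lia.
Qed.

Lemma glue_forest F F1 W : sparse s t 1 F ->
  (forall e, e \in F -> ~~ cross s t e W) ->
  (forall e, e \in F1 -> ein s t e W) ->
  (forall X, X \subset W -> X != set0 -> #|inn s t F1 X| + 1 <= 1 * #|X|) ->
  sparse s t 1 ((F :\: inn s t F W) :|: F1).
Proof.
move=> spF ncr F1W sp1; apply/sparseP => X X0; set F' := _ :|: F1.
have ncr' e : e \in F' -> ~~ cross s t e W.
  by rewrite in_setU in_setD => /orP[/andP[_ /ncr]//|/F1W/andP[sW tW]]; rewrite /cross sW tW.
have h1 : #|inn s t F' X| <= #|inn s t F' (X :&: W)| + #|inn s t F' (X :\: W)|.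
  by apply: inn_split => e /ncr'.
have inn0 : inn s t F' set0 = set0.
  by apply/setP => e; rewrite in_inn /ein !in_set0 !andbF.
have h2 : #|inn s t F' (X :&: W)| + (X :&: W != set0) <= #|X :&: W|.
  have [->|I0] := eqVneq (X :&: W) set0.
    by rewrite inn0 !cards0.
  rewrite -[#|X :&: W|]mul1n; apply: leq_trans (sp1 _ (subsetIr X W) I0).
  rewrite leq_add2r subset_leq_card //; apply/subsetP => e.
  rewrite !in_inn in_setU in_setD => /andP[/orP[/andP[nW eF]|->//] eX].
  case/negP: nW; rewrite in_inn eF; move: eX; rewrite /ein !in_setI.
  by move=> /andP[/andP[_ ->] /andP[_ ->]].
have h3 : #|inn s t F' (X :\: W)| + (X :\: W != set0) <= #|X :\: W|.
  have [->|I0] := eqVneq (X :\: W) set0.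
    by rewrite inn0 !cards0.
  rewrite -[#|X :\: W|]mul1n; apply: leq_trans (sparseP _ _ _ _ spF _ I0).
  rewrite leq_add2r subset_leq_card //; apply/subsetP => e.
  rewrite !in_inn in_setU in_setD => /andP[/orP[/andP[_ ->]//|/F1W/andP[sW _]]].
  by rewrite /ein !in_setD sW.
have h4 := cardsID W X; have : 0 < (X :&: W != set0) + (X :\: W != set0).
  case/set0Pn: X0 => x xX; have [xW|xW] := boolP (x \in W).
    by have -> : X :&: W != set0 by apply/set0Pn; exists x; rewrite inE xX.
  by have -> : X :\: W != set0 by [apply/set0Pn; exists x; rewrite inE xX xW]; rewrite addn1.
by move: h1 h2 h3 h4; clear; lia.
Qed.

(** Choose B as large as possible. If h cannot be added to B, then neither can the
    edges of F, so none of them crosses the block W of B around h. Inside W, B is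
    tight and [spanning_step] applies; outside nothing changes. *)
Lemma outer_step A h : h \notin A -> decomposed s t k d A -> decomposed s t k d (h |: A).
Proof.
move=> hA /decomposedP/existsP[p0 dp0].
have [[B F] dp maxB] := @arg_maxnP _ p0 (decomposition s t k d A) (fun p => #|p.1|) dp0.
have /and5P[/eqP/= U D spB spF /goodP gF] := dp; rewrite /= in U D spB spF gF maxB.
have FB e : e \in F -> e \notin B by move=> eF; rewrite (disjointFl D eF).
have AE e : (e \in A) = (e \in B) || (e \in F) by rewrite -U in_setU.
have [sph|nsp] := boolP (sparse s t k (h |: B)).
  exists (h |: B), F; split=> //; first by rewrite -setUA U.
  rewrite -setI_eq0; apply/eqP/setP => e; rewrite in_setI in_setU1 in_set0.
  apply/negP => /andP[/orP[/eqP ->|eB] eF]; first by rewrite AE eF orbT in hA.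
  by have := FB e eF; rewrite eB.
(* Otherwise e could be moved to B, which is as large as possible. *)
have stuck e : e \in F -> ~~ sparse s t k (e |: B).
  move=> eF; apply/negP => spe.
  have dp' : decomposition s t k d A (e |: B, F :\ e).
    apply/and5P; split=> //=.
    - apply/eqP/setP => x; rewrite -U !inE; case: eqP => [->|//]; by rewrite eF orbT.
    - rewrite -setI_eq0; apply/eqP/setP => x; rewrite !inE; case: eqP => //= _.
      by apply/negP => /andP[xB /FB]; rewrite xB.
    - exact: sparseD1.
    apply/goodP => X tX; apply: gF; apply: tight_sub tX => //; exact: subD1set.
  have := maxB _ dp'; rewrite /= cardsU1 (FB e eF); clear; lia.
have [X tX /andP[sX tX']] := sparse_addN spB nsp.
pose W := block s t k B (s h).
have tW : tight s t k B W := block_tight _ spB.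
have XW : X \subset W := block_sub tX sX.
have sW : s h \in W := subsetP XW _ sX.
have hW : ein s t h W by rewrite /ein sW (subsetP XW).
(* The block of s h contains h, as it contains X. *)
have ncr e : e \in F -> ~~ cross s t e W.
  by move=> eF; apply: contra (stuck e eF) => cr; apply: sparse_cross cr.
pose s' := rs s sW; pose t' := rt t sW.
have innW A' e : e \in inn s t A' W -> ein s t e W by rewrite in_inn => /andP[].
have hAW e : e \in h |: inn s t A W -> ein s t e W.
  by rewrite in_setU1 => /orP[/eqP ->//|/innW].
have [|||||||||B1 [F1 [U1 D1 sp1 spF1 g1]]] := @spanning_step _ _ s' t' k d k_gt0 d_gt0 d_le
    (inn s t A W) h (inn s t B W) (inn s t F W).
- by rewrite in_inn (negbTE hA).
- apply: contra (noloop h) => /eqP/(congr1 val); rewrite /s' /t' /rs /rt !val_proj //.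
    by move=> ->.
  by case/andP: hW.
- move=> Y cY; rewrite (inn_restrict sW _ hAW) -(card_restrict Y).
  rewrite -(card_restrict Y) in cY; apply: leq_trans (density cY).
  by rewrite leq_mul2l subset_leq_card ?orbT // inn_sub // subsetT.
- by apply/setP => e; rewrite in_setU !in_inn AE andb_orl.
- apply: disjointW D; by apply/subsetP => e; rewrite in_inn => /andP[].
- apply: sparse_restrict; first exact: innW.
  by apply: sparse_sub spB; apply/subsetP => e; rewrite in_inn => /andP[].
- apply: sparse_restrict; first exact: innW.
  by apply: sparse_sub spF; apply/subsetP => e; rewrite in_inn => /andP[].
- move=> Y tY; rewrite -(card_restrict Y); apply: gF.
  have spI : sparse s t 1 (inn s t F W).
    by apply: sparse_sub spF; apply/subsetP => e; rewrite in_inn => /andP[].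
  move: tY; rewrite !tight_def (inn_restrict sW Y (@innW F)) -card_restrict -(imset_eq0 val).
  have -> // : inn s t (inn s t F W) (val @: Y) = inn s t F (val @: Y).
  apply/setP => e; rewrite !in_inn; case: (e \in F) => //=; rewrite andbC.
  case ee: (ein s t e (val @: Y)) => //=; case/andP: ee => /(subsetP (val_sub Y)) a1 /(subsetP (val_sub Y)) a2.
  by rewrite /ein a1 a2.
- by rewrite (tightE tW) card_sig; congr muln; apply: eq_card.
have B1W e : e \in B1 -> ein s t e W by move=> eB; apply: hAW; rewrite -U1 inE eB.
have F1W e : e \in F1 -> ein s t e W by move=> eF; apply: hAW; rewrite -U1 inE eF orbT.
pose B2 := (B :\: inn s t B W) :|: B1; pose F2 := (F :\: inn s t F W) :|: F1.
have sp2 : sparse s t 1 F2.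
  apply: glue_forest => // Y YW Y0; exact: (sparse_in F1W spF1 YW Y0).
exists B2, F2; split=> //.
- apply/setP => e; move/setP/(_ e): U1; rewrite /B2 /F2 !(in_setU, in_setD, in_set1) !in_inn AE.
  by case: (e == h); case: (e \in B); case: (e \in F); case: (ein s t e W) => //=;
    case: (e \in B1); case: (e \in F1).
- rewrite -setI_eq0; apply/eqP/setP => e; move/setP/(_ e): U1; have := FB e.
  have : ~~ ((e \in B1) && (e \in F1)).
    by apply/negP => /andP[eB]; rewrite (disjointFr D1 eB).
  have := B1W e; have := F1W e; have : e == h -> (e \notin B) && (e \notin F).
    by move=> /eqP ->; move: hA; rewrite AE negb_or.
  rewrite /B2 /F2 !(in_setI, in_setU, in_setD, in_set1, in_set0) !in_inn AE.
  case: (e == h); case: (e \in B); case: (e \in F); case: (ein s t e W) => //=;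
    case: (e \in B1); case: (e \in F1) => //=;
    (try by move=> /(_ isT)); (try by move=> _ /(_ isT)); (try by move=> _ _ /(_ isT));
    try by move=> _ _ _ _ /(_ isT).
- apply: glue_sparse => // Y YW Y0; exact: (sparse_in B1W sp1 YW Y0).
move=> Y tY.
have ncr2 e : e \in F2 -> (s e \in W) = (t e \in W).
  rewrite in_setU in_setD => /orP[/andP[_ /ncr]|/F1W/andP[-> ->]//].
  by rewrite /cross negbK => /eqP.
have mono := mono_tight (p := fun v => v \in W) sp2 ncr2 tY.
have [y yY] := set0Pn _ (tight_neq0 tY).
have [yW|yW] := boolP (y \in W).
  have YW : Y \subset W by apply/subsetP => x xY; rewrite -(mono y x yY xY).
  have tY1 : tight s t 1 F1 Y.
    move: tY; rewrite !tight_def; have -> // : inn s t F2 Y = inn s t F1 Y.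
    apply/setP => e; rewrite !in_inn in_setU in_setD in_inn.
    case eY: (ein s t e Y); rewrite ?andbF // !andbT.
    have -> : ein s t e W by case/andP: eY => ? ?; rewrite /ein !(subsetP YW).
    by rewrite andbT; case: (e \in F).
  have := g1 _ (tight_restrict sW F1W YW tY1).
  by rewrite -card_restrict (val_preim sW).
apply: gF; apply: (tight_transfer spF tY) => e; rewrite in_setU in_setD.
case/orP => [/andP[_ ->]//|/F1W/andP[sE _]] /andP[sY _].
by rewrite (mono y (s e) yY sY) sE in yW.
Qed.

Theorem decompose_all : decomposed s t k d [set: E].
Proof.
suff H n : forall A : {set E}, #|A| = n -> decomposed s t k d A by apply: H erefl.
elim: n => [|n IH] A cA.
  rewrite (cards0_eq cA); exists set0, set0.
  have inn0 X : inn s t set0 X = set0 by apply/setP => e; rewrite in_inn !inE.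
  have sp0 m : sparse s t m set0.
    apply/sparseP => X X0; rewrite inn0 cards0 add0n -[leqLHS]muln1 leq_mul2l card_gt0 X0 orbT //.
  split=> //; first by rewrite setU0.
    by rewrite -setI_eq0 setI0.
  by move=> X /tightE; rewrite inn0 cards0 mul1n => <-.
have /set0Pn[h hA] : A != set0 by rewrite -card_gt0 cA.
have -> : A = h |: (A :\ h) by rewrite setD1K.
apply: outer_step; first by rewrite !inE eqxx.
by apply: IH; move: cA; rewrite (cardsD1 h) hA => -[].
Qed.

End Outer.

(** * From fractional arboricity to forests *)

Local Open Scope ring_scope.

Section Final.
Variable G : multigraph.
Implicit Types (F : {set edge G}) (X : {set vertex G}) (x y : vertex G).

Lemma ends_pair : exists s t : edge G -> vertex G,
  forall e, s e != t e /\ ends e = [set s e; t e].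
Proof.
have H e : exists x : vertex G, exists y, x != y /\ ends e = [set x; y].
  by have /eqP/cards2P[x [y xy]] := card_ends e; exists x, y.
have [s Hs] := fin_all_exists H; have [t Ht] := fin_all_exists Hs.
by exists s, t.
Qed.

Variables (s t : edge G -> vertex G).
Hypothesis (st : forall e, s e != t e /\ ends e = [set s e; t e]).

Lemma ends_sub e X : (ends e \subset X) = ein s t e X.
Proof. by have [_ ->] := st e; rewrite subUset !sub1set. Qed.

(** A cycle spans at least as many edges as it has vertices. *)
Lemma sparse_acyclic F : sparse s t 1 F -> forest F.
Proof.
move=> spF n v e [n2 vI eI ev] eF; pose X := [set v i | i in 'I_n].
have cX : #|X| = n by rewrite card_imset // card_ord.
have X0 : X != set0 by rewrite -card_gt0 cX ltnW.
have : (#|[set e i | i in 'I_n]| <= #|inn s t F X|)%N.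
  apply/subset_leq_card/subsetP => f /imsetP[i _ ->].
  by rewrite in_inn eF -ends_sub ev subUset !sub1set !imset_f.
have := sparseP _ _ _ _ spF X X0; rewrite cX card_imset // card_ord.
by clear; lia.
Qed.

Lemma component_bound F d x : sparse s t 1 F -> good s t d F ->
  (#|component_edges F x| <= d)%N.
Proof.
move=> spF gF; have xb := block_self x spF.
have sub : component F x \subset block s t 1 F x.
  apply/subsetP => y; rewrite inE => /connectP[p pth ->].
  have H u : u \in block s t 1 F x -> path (adj F) u p -> last u p \in block s t 1 F x.
    elim: p {pth} u => //= z p IH u ub /andP[/existsP[e /andP[eF /eqP ee]] pz].
    apply: IH pz; have [_ es] := st e.
    have [ue ze] : u \in [set s e; t e] /\ z \in [set s e; t e].
      by rewrite -es ee !inE !eqxx orbT.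
    have eb := edge_block x spF eF.
    have sb : s e \in block s t 1 F x.
      by move: ue; rewrite in_set2 => /orP[] /eqP ue; [rewrite -ue|rewrite eb -ue].
    by move: ze; rewrite in_set2 => /orP[] /eqP ->; rewrite -?eb.
  exact: H.
have C0 : component F x != set0 by apply/set0Pn; exists x; rewrite inE connect0.
have -> : component_edges F x = inn s t F (component F x).
  by apply/setP => e; rewrite in_inn inE ends_sub.
have := sparseP _ _ _ _ spF _ C0; have := subset_leq_card sub.
by have := gF _ (block_tight x spF); clear; lia.
Qed.

Lemma gamma_density (k d : nat) : (0 < k)%N -> gamma G <= k%:R + d%:R / (d + k + 1)%:R ->
  forall X, (1 < #|X|)%N ->
    ((d + k.+1) * #|inn s t [set: edge G] X| <= (k * (d + k.+1) + d) * (#|X| - 1))%N.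
Proof.
move=> k0 gG X cX; set m := #|inn s t _ X|.
have c1 : (0 : rat) < #|X|%:R - 1 by rewrite subr_gt0 ltr1n.
have D0 : (0 : rat) < (d + k + 1)%:R by rewrite ltr0n addn1.
have : m%:R / (#|X|%:R - 1) <= k%:R + d%:R / (d + k + 1)%:R :> rat.
  apply: le_trans gG; rewrite /gamma.
  have := @le_bigmax_cond _ rat _ 0 (X, inn s t [set: edge G] X)
    (fun H : {set vertex G} * {set edge G} => is_subgraph H && (2 <= #|H.1|)%N)
    (fun H => #|H.2|%:R / (#|H.1|%:R - 1)).
  rewrite /= cX andbT => -> //; apply/forallP => e; apply/implyP.
  by rewrite /= in_inn ends_sub => /andP[].
rewrite ler_pdivrMr // => le1.
have : m%:R * (d + k + 1)%:R <= (k%:R * (d + k + 1)%:R + d%:R) * (#|X|%:R - 1) :> rat.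
  have := ler_wpM2r (ltW D0) le1.
  rewrite mulrAC mulrDl divfK //; exact: lt0r_neq0.
have -> : #|X|%:R - 1 = (#|X| - 1)%:R :> rat by rewrite natrB // ltnW.
rewrite -!natrM -natrD -natrM ler_nat.
by rewrite (mulnC m) -!addnA addn1.
Qed.

End Final.

Theorem theorem1p7 (k d : nat) (k_gt0 : (0 < k)%N) (d_gt0 : (0 < d)%N)
    (d_le : (d <= 2 * (k + 1))%N) (G : multigraph)
    (gammaG : gamma G <= k%:R + d%:R / (d + k + 1)%:R) :
  exists P : 'I_(k + 1) -> {set edge G},
    [/\ edge_partition P,
        forall i, forest (P i)
      & exists i, forall x : vertex G, (#|component_edges (P i) x| <= d)%N].
Proof.
have [s [t st]] := ends_pair G.
have noloop e : s e != t e by case: (st e).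
have dens := gamma_density st k_gt0 gammaG.
rewrite addn1 in d_le.
have [B [F [U D spB spF gF]]] := decompose_all k_gt0 d_gt0 d_le noloop dens.
have [c cP] := nash_williams k_gt0 spB.
pose P (i : 'I_(k + 1)) := if insub (val i) is Some j then [set y in B | c y == j] else F.
have FB e : e \in F -> e \notin B by move=> eF; rewrite (disjointFl D eF).
have Pspec (i : 'I_(k + 1)) : (exists j : 'I_k, val j = val i /\ P i = [set y in B | c y == j])
    \/ (val i = k /\ P i = F).
  rewrite /P; case: insubP => [j _ ji|ik]; first by left; exists j.
  right; split=> //; apply/eqP; rewrite eqn_leq [(k <= _)%N]leqNgt ik andbT.
  by rewrite -ltnS -[k.+1]addn1; apply: ltn_ord.
have spP i : sparse s t 1 (P i) by case: (Pspec i) => [[j [_ ->]]|[_ ->]].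
exists P; split.
- split=> [i i' ne|].
    rewrite -setI_eq0; apply/eqP/setP => e; rewrite in_setI in_set0; apply/negP.
    case: (Pspec i) => [[j [ji ->]]|[ik ->]]; case: (Pspec i') => [[j' [ji' ->]]|[ik' ->]].
    + rewrite !inE => /andP[/andP[_ /eqP ej] /andP[_ /eqP ej']].
      by case/eqP: ne; apply: val_inj; rewrite -ji -ji' -ej -ej'.
    + by rewrite inE => /andP[/andP[eB _] /FB]; rewrite eB.
    + by rewrite inE => /andP[/FB eB /andP[eB' _]]; rewrite eB' in eB.
    + by case/eqP: ne; apply: val_inj; rewrite ik ik'.
  apply/setP => e; rewrite in_setT; apply/bigcupP.
  have kk : (k < k + 1)%N by rewrite addn1.
  have [eB|eB] := boolP (e \in B).
    have lt : (c e < k + 1)%N by apply: ltn_trans (ltn_ord _) kk.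
    exists (Ordinal lt) => //; rewrite /P /= insubT ?ltn_ord // => h.
    rewrite inE eB /=; apply/eqP/val_inj => //.
  exists (Ordinal kk) => //; rewrite /P /= insubF ?ltnn //.
  by move/setP/(_ e): U; rewrite !inE (negbTE eB).
- by move=> i; apply: (sparse_acyclic st).
have kk : (k < k + 1)%N by rewrite addn1.
exists (Ordinal kk) => x; rewrite /P /= insubF ?ltnn //.
exact: (component_bound st x spF gF).
Qed.
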